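(* Let $G=(V,E)$ be a directed graph with $n=|V|$, $m=|E|$, non-negative edge lengths $\ell$ and non-negative edge delays $d$, let $\varepsilon>0$, and let $0<D_{\min}\le D_{\max}$ satisfy $D_{\max}/D_{\min}=O(\mathrm{poly}(n))$. There is a Monte Carlo randomized data structure which, after preprocessing $G$ in $O\big(mn\log^3(n)/\varepsilon+n^2\log^5(n)/\varepsilon^2\big)$ time, answers the following queries in constant time: given $s,t\in V$ and $D\in[D_{\min},D_{\max}]$, compute the length of some $(s,t)$-path $P_{s,t}$ in $G$ such that $\ell(P_{s,t})\le\mathrm{dist}_G(s,t,D)$ and $d(P_{s,t})\le(1+\varepsilon)D$. The answers are correct with high probability.
   Context: For a path $P$, $\ell(P)=\sum_{e\in P}\ell(e)$ and $d(P)=\sum_{e\in P}d(e)$. For $s,t\in V$ and $D\ge 0$, $\mathrm{dist}_G(s,t,D)$ is the minimum of $\ell(P)$ over $(s,t)$-paths $P$ in $G$ with $d(P)\le D$ ($\infty$ if none). ''With high probability'' means with probability at least $1-1/\mathrm{poly}(n)$. Standing assumption of the paper: $\varepsilon^{-1}=\mathrm{poly}(n)$.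
   Formalization: In the preprocessing time bound, 1/ε is read as max(1, 1/ε), since for ε → ∞ the stated bound tends to 0 and cannot hold; and n ≥ 2 is assumed, since log 1 = 0 makes the bound zero. *)

(* Defs.v *)
From HB Require Import structures.
From mathcomp Require Import all_boot all_order all_algebra.
From mathcomp Require Import all_classical all_reals all_analysis.

Set Implicit Arguments.
Unset Strict Implicit.
Unset Printing Implicit Defensive.

Import Order.TTheory GRing.Theory Num.Theory.
Local Open Scope ring_scope.

(** * Directed graphs with edge lengths and delays *)

(* V = 'I_n; the edges are enumerated, in an arbitrary order, by 'I_(nedges G).
   Injectivity of [ends] says E is a set of ordered pairs (loops allowed). *)
Record digraph (R : realType) (n : nat) := Digraph {
  nedges : nat;
  ends : 'I_nedges -> 'I_n * 'I_n;
  elen : 'I_nedges -> R;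
  edel : 'I_nedges -> R;
  ends_inj : injective ends;
  elen_ge0 : forall e, 0 <= elen e;
  edel_ge0 : forall e, 0 <= edel e }.

Section Paths.
Context {R : realType} {n : nat} (G : digraph R n).

(* Vertices may repeat; the empty path goes from s to s. *)
Fixpoint is_path (s t : 'I_n) (p : seq 'I_(nedges G)) : bool :=
  if p is e :: p' then ((ends e).1 == s) && is_path (ends e).2 t p'
  else s == t.

Definition plen (p : seq 'I_(nedges G)) : R := \sum_(e <- p) elen e.
Definition pdel (p : seq 'I_(nedges G)) : R := \sum_(e <- p) edel e.

(* +oo if there is no such path.  Otherwise the infimum is attained: deleting
   cycles increases neither length nor delay, so that the finitely many simple
   paths suffice. *)
Definition dist (s t : 'I_n) (D : R) : \bar R :=
  ereal_inf [set x | exists p,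
    [/\ is_path s t p, pdel p <= D & x = (plen p)%:E]].

(* [None] stands for the answer "infinity", which is acceptable only if
   dist_G(s,t,D) is infinite. *)
Definition correct_answer (eps : R) (s t : 'I_n) (D : R) (ans : option R) :=
  if ans is Some x then
    exists p, [/\ is_path s t p, plen p = x,
                  ((plen p)%:E <= dist s t D)%E & pdel p <= (1 + eps) * D]
  else dist s t D = +oo%E.

End Paths.

(** * A randomized RAM with words and reals

    Programs are first-order finite objects, containing no real constant, and
    are written in a structured language.  Words are natural numbers below the
    word bound [W]; word arithmetic is modulo [W], except for subtraction,
    which is truncated at 0.  There are finitely many named word and real
    arrays in a given program, indexed by words.  Reals support the field
    operations and comparisons; they can be converted to words only through a
    floor operation that is truncated to the range of a word.  Every node of an
    expression and every command costs one unit of time. *)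

Inductive wop := Wadd | Wsub | Wmul | Wdiv | Wmod.
Inductive rop := Radd | Rsub | Rmul | Rdiv.

Inductive wexp :=
  | WLit of nat
  | WVar of nat
  | WLoad of nat & wexp
  | WOp of wop & wexp & wexp.

Inductive rexp :=
  | RVar of nat
  | RLoad of nat & wexp
  | ROfWord of wexp
  | ROp of rop & rexp & rexp.

Inductive bexp :=
  | BWle of wexp & wexp
  | BRle of rexp & rexp
  | BNot of bexp
  | BAnd of bexp & bexp.

Inductive cmd :=
  | Skip
  | WSet of nat & wexp
  | RSet of nat & rexp
  | WStore of nat & wexp & wexp   (* array, index, value *)
  | RStore of nat & wexp & rexp   (* array, index, value *)
  | Floor of nat & rexp
  | Rand of nat
  | Seq of cmd & cmd
  | If of bexp & cmd & cmd
  | While of bexp & cmd.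

Fixpoint wcost (e : wexp) : nat :=
  match e with
  | WLit _ | WVar _ => 1
  | WLoad _ i => (wcost i).+1
  | WOp _ e1 e2 => (wcost e1 + wcost e2).+1
  end.

Fixpoint rcost (e : rexp) : nat :=
  match e with
  | RVar _ => 1
  | RLoad _ i => (wcost i).+1
  | ROfWord i => (wcost i).+1
  | ROp _ e1 e2 => (rcost e1 + rcost e2).+1
  end.

Fixpoint bcost (b : bexp) : nat :=
  match b with
  | BWle e1 e2 => (wcost e1 + wcost e2).+1
  | BRle e1 e2 => (rcost e1 + rcost e2).+1
  | BNot b1 => (bcost b1).+1
  | BAnd b1 b2 => (bcost b1 + bcost b2).+1
  end.

(* [tape] is the list of random words not used yet. *)
Record state (R : realType) := State {
  wreg : nat -> nat;
  rreg : nat -> R;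
  wmem : nat -> nat -> nat;
  rmem : nat -> nat -> R;
  tape : seq nat }.

Definition upd {T : Type} (f : nat -> T) (i : nat) (v : T) : nat -> T :=
  fun j => if j == i then v else f j.

Definition upd2 {T : Type} (f : nat -> nat -> T) (a i : nat) (v : T) :
    nat -> nat -> T :=
  upd f a (upd (f a) i v).

Section Semantics.
Context {R : realType} (W : nat).
Implicit Types st : state R.

Definition set_wreg st x v :=
  State (upd (wreg st) x v) (rreg st) (wmem st) (rmem st) (tape st).
Definition set_rreg st x v :=
  State (wreg st) (upd (rreg st) x v) (wmem st) (rmem st) (tape st).
Definition set_wmem st a i v :=
  State (wreg st) (rreg st) (upd2 (wmem st) a i v) (rmem st) (tape st).
Definition set_rmem st a i v :=
  State (wreg st) (rreg st) (wmem st) (upd2 (rmem st) a i v) (tape st).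
Definition set_tape st r :=
  State (wreg st) (rreg st) (wmem st) (rmem st) r.

Definition wop_sem (o : wop) (u v : nat) : nat :=
  match o with
  | Wadd => (u + v) %% W
  | Wsub => u - v
  | Wmul => (u * v) %% W
  | Wdiv => u %/ v
  | Wmod => u %% v
  end%N.

Definition rop_sem (o : rop) (u v : R) : R :=
  match o with
  | Radd => u + v
  | Rsub => u - v
  | Rmul => u * v
  | Rdiv => u / v
  end.

Fixpoint weval st (e : wexp) : nat :=
  match e with
  | WLit k => (k %% W)%N
  | WVar x => wreg st x
  | WLoad a i => wmem st a (weval st i)
  | WOp o e1 e2 => wop_sem o (weval st e1) (weval st e2)
  end.

Fixpoint reval st (e : rexp) : R :=
  match e with
  | RVar x => rreg st x
  | RLoad a i => rmem st a (weval st i)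
  | ROfWord i => (weval st i)%:R
  | ROp o e1 e2 => rop_sem o (reval st e1) (reval st e2)
  end.

Fixpoint beval st (b : bexp) : bool :=
  match b with
  | BWle e1 e2 => (weval st e1 <= weval st e2)%N
  | BRle e1 e2 => reval st e1 <= reval st e2
  | BNot b1 => ~~ beval st b1
  | BAnd b1 b2 => beval st b1 && beval st b2
  end.

(* [exec c st st' k]: started in [st], [c] halts in [st'] after time [k].
   [Rand] is stuck on an empty tape. *)
Inductive exec : cmd -> state R -> state R -> nat -> Prop :=
  | ExSkip st : exec Skip st st 1
  | ExWSet st x e :
      exec (WSet x e) st (set_wreg st x (weval st e)) (wcost e).+1
  | ExRSet st x e :
      exec (RSet x e) st (set_rreg st x (reval st e)) (rcost e).+1
  | ExWStore st a i e :
      exec (WStore a i e) st (set_wmem st a (weval st i) (weval st e))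
           (wcost i + wcost e).+1
  | ExRStore st a i e :
      exec (RStore a i e) st (set_rmem st a (weval st i) (reval st e))
           (wcost i + rcost e).+1
  | ExFloor st x e :
      (* [Num.truncn] is the floor on nonnegative reals, and 0 elsewhere *)
      exec (Floor x e) st
           (set_wreg st x (minn (Num.truncn (reval st e)) W.-1)) (rcost e).+1
  | ExRand st x v r : tape st = v :: r ->
      exec (Rand x) st (set_tape (set_wreg st x v) r) 1
  | ExSeq c1 c2 st st1 st2 k1 k2 :
      exec c1 st st1 k1 -> exec c2 st1 st2 k2 ->
      exec (Seq c1 c2) st st2 (k1 + k2).+1
  | ExIf b c1 c2 st st1 k :
      exec (if beval st b then c1 else c2) st st1 k ->
      exec (If b c1 c2) st st1 (bcost b + k).+1
  | ExWhileF b c st : ~~ beval st b ->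
      exec (While b c) st st (bcost b).+1
  | ExWhileT b c st st1 st2 k1 k2 : beval st b ->
      exec c st st1 k1 -> exec (While b c) st1 st2 k2 ->
      exec (While b c) st st2 (bcost b + k1 + k2).+1.

Lemma exec_det c st st1 st2 k1 k2 :
  exec c st st1 k1 -> exec c st st2 k2 -> st1 = st2 /\ k1 = k2.
Proof.
move=> H; elim: H st2 k2 => {c st st1 k1}.
- by move=> st st2 k2 H; inversion H; subst.
- by move=> st x e st2 k2 H; inversion H; subst.
- by move=> st x e st2 k2 H; inversion H; subst.
- by move=> st a i e st2 k2 H; inversion H; subst.
- by move=> st a i e st2 k2 H; inversion H; subst.
- by move=> st x e st2 k2 H; inversion H; subst.
- move=> st x v r E st2 k2 H; inversion H as [| | | | | |? ? v' r' E'| | | |].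
  by subst; move: E'; rewrite E => -[-> ->].
- move=> c1 c2 st st1 st3 k1 k3 _ IH1 _ IH2 st2 k2 H.
  inversion H as [| | | | | | |? ? ? ? ? ? ? Ha Hb| | |]; subst.
  by have [? ?] := IH1 _ _ Ha; subst; have [? ?] := IH2 _ _ Hb; subst.
- move=> b c1 c2 st st1 k _ IH st2 k2 H.
  inversion H as [| | | | | | | |? ? ? ? ? ? Ha| |]; subst.
  by have [? ?] := IH _ _ Ha; subst.
- move=> b c st Hb st2 k2 H; inversion H as [| | | | | | | | | |? ? ? ? ? ? ? Hb']; subst => //.
  by rewrite Hb' in Hb.
- move=> b c st st1 st3 k1 k3 Hb _ IH1 _ IH2 st2 k2 H.
  inversion H as [| | | | | | | | |? ? ? Hb'|? ? ? ? ? ? ? _ Ha Hc]; subst.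
    by rewrite Hb in Hb'.
  by have [? ?] := IH1 _ _ Ha; subst; have [? ?] := IH2 _ _ Hc; subst.
Qed.

End Semantics.

(** * Input/output conventions *)

(* Words of O(log n) bits.  As n >= 2, all of n, m <= n ^ 2 and the vertices
   are words. *)
Definition word_bound (kappa n : nat) : nat := 2 ^ (kappa.+3 * up_log 2 n).

Section IO.
Context {R : realType} {n : nat} (G : digraph R n) (eps Dmin Dmax : R).

(* Word registers 0, 1: n and m.  Real registers 0, 1, 2: eps, Dmin and Dmax.
   Word arrays 0, 1: tails and heads; real arrays 0, 1: lengths and delays of
   the edges.  Everything else is 0. *)
Definition init_state (rnd : seq nat) : state R :=
  let edges := enum 'I_(nedges G) in
  State
    (nth 0 [:: n; nedges G])%N
    (nth 0 [:: eps; Dmin; Dmax])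
    (nth (fun=> 0) [:: nth 0 [seq val (ends e).1 | e <- edges];
                       nth 0 [seq val (ends e).2 | e <- edges]])%N
    (nth (fun=> 0) [:: nth 0 [seq elen e | e <- edges];
                       nth 0 [seq edel e | e <- edges]])
    rnd.

(* A query is passed in word registers 0, 1 and real register 0; queries do not
   use random words. *)
Definition load_query (st : state R) (s t : 'I_n) (D : R) : state R :=
  set_tape (set_rreg (set_wreg (set_wreg st 0 s) 1 t) 0 D) [::].

(* Word register 0 tells whether the answer is finite, real register 0 contains
   it if so. *)
Definition answer (st : state R) : option R :=
  if wreg st 0 == 0%N then None else Some (rreg st 0).

Variables (W : nat) (query : cmd).

(* The states of the data structure after some finite sequence of queries. *)
Inductive reachable (st : state R) : state R -> Prop :=
  | Reach0 : reachable st st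
  | ReachS st1 st2 s t D k : reachable st st1 -> Dmin <= D <= Dmax ->
      exec W query (load_query st1 s t D) st2 k -> reachable st st2.

Definition queries_halt (Q : nat) (st : state R) : Prop :=
  forall st1, reachable st st1 ->
  forall (s t : 'I_n) (D : R), Dmin <= D <= Dmax ->
  exists st2 k, exec W query (load_query st1 s t D) st2 k /\ (k <= Q)%N.

Definition queries_correct (st : state R) : Prop :=
  forall st1, reachable st st1 ->
  forall (s t : 'I_n) (D : R), Dmin <= D <= Dmax ->
  forall st2 k, exec W query (load_query st1 s t D) st2 k ->
  correct_answer G eps s t D (answer st2).

End IO.

(* The uniform probability on sequences of [L] random words. *)
Definition tape_prob (R : realType) (W L : nat)
    (P : L.-tuple 'I_W -> Prop) : R :=
  #|[set r : L.-tuple 'I_W | `[< P r >]]|%:R / #|{: L.-tuple 'I_W}|%:R.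

(* mn log^3(n)/eps + n^2 log^5(n)/eps^2, where 1/eps is understood as
   max(1, 1/eps): for eps <= 1 this changes nothing, while for eps -> oo the
   bound would otherwise tend to 0. *)
Definition prep_bound (R : realType) (n m : nat) (eps : R) : R :=
  let ieps := Num.max 1 eps^-1 in
  m%:R * n%:R * ln n%:R ^+ 3 * ieps + n%:R ^+ 2 * ln n%:R ^+ 5 * ieps ^+ 2.

(* Main.v *)
(* The idea is hierarchical shortcutting.  Every vertex draws a level, geometric
   with parameter 1/2 and truncated at K = ceil(log2 n): the 2-adic valuation of
   a random word.  For a scale delta = Dmin 2^k, a table T[q,s,t] is filled, for
   delay budgets q u with u = eps' delta / E, E = O(log n), eps' = min(1, eps).
   The vertices are processed by decreasing level.  A vertex s of level i runs a
   dynamic program over delays rounded up to multiples of u / 2^i, forward and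
   backward, whose initial values are the current entries T[.,s,v] (resp.
   T[.,v,s]): these act as shortcuts between s and the vertices v of higher
   level.  An optimal path from s to t is the shortcut from s to its last vertex
   v of level > i, followed by an explicit segment; the step costs an error of
   one unit u, plus u / 2^i for each edge of the segment.  Following this
   recursion, the total error in units of u is at most K + 1 plus the sum over j
   of 2^-j times the distance from either end of the path to the nearest vertex
   of level > j.  That sum has an exponential moment bounded by a power of n, so
   that it is O(log n) with high probability, simultaneously for one optimal
   simple path per scale, budget and pair (s, t).  A vertex of level i costs
   O((m + n) 2^i log n / eps), and the sum of 2^level over all vertices is
   O(n log n) with high probability; otherwise the preprocessing gives up. *)

Require Import Defs.
From HB Require Import structures.
From mathcomp Require Import all_boot all_order all_algebra.
From mathcomp Require Import all_classical all_reals all_analysis.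
From mathcomp Require Import zify ring lra.

Set Implicit Arguments.
Unset Strict Implicit.
Unset Printing Implicit Defensive.

Import Order.TTheory GRing.Theory Num.Theory.
Local Open Scope ring_scope.

(** * A program logic with running times *)

(** Completeness from level [i] is claimed for pairs with at least one endpoint of level at least
    [i]. This closes the recursion: the cut vertex has level above [i], so the shortcut from [s] to
    it is already covered although [s] itself only has level [i]. The union bound must run over
    finitely many paths fixed before the levels are drawn, whereas [D] is an arbitrary real. A query
    is therefore compared with an optimal path for the next multiple of the unit above [D]: that
    path is no longer than any path of delay at most [D], and its choice depends on the graph alone.
    The time bound has to hold for every tape; this is why the preprocessing measures the sum of
    2^level and stops if it is too large, an event charged to the failure probability. The time is
    the product of O(log n) scales, O(log n / eps) budgets, [n + m] and the sum O(n log n) of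
    2^level; the part n^2 log^3(n) / eps of it is absorbed by the second term of the claimed
    bound. *)

Fixpoint mods (atom : cmd -> seq nat) (c : cmd) : seq nat :=
  match c with
  | Seq c1 c2 | If _ c1 c2 => mods atom c1 ++ mods atom c2
  | While _ c1 => mods atom c1
  | _ => atom c
  end.

Definition wmod := mods (fun c =>
  match c with WSet x _ | Floor x _ | Rand x => [:: x] | _ => [::] end).
Definition rmod := mods (fun c => if c is RSet x _ then [:: x] else [::]).
Definition wamod := mods (fun c => if c is WStore a _ _ then [:: a] else [::]).
Definition ramod := mods (fun c => if c is RStore a _ _ then [:: a] else [::]).

Fixpoint straight (c : cmd) : bool :=
  match c with
  | Rand _ | While _ _ => false
  | Seq c1 c2 | If _ c1 c2 => straight c1 && straight c2
  | _ => true
  end.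

(** A bound for [straight] commands only, whence the dummy 0 for loops. Adding both branches of a
    conditional is crude, but such code has constant size. *)
Fixpoint max_time (c : cmd) : nat :=
  match c with
  | Skip | Rand _ => 1
  | WSet _ e => (wcost e).+1
  | RSet _ e | Floor _ e => (rcost e).+1
  | WStore _ i e => (wcost i + wcost e).+1
  | RStore _ i e => (wcost i + rcost e).+1
  | Seq c1 c2 => (max_time c1 + max_time c2).+1
  | If b c1 c2 => (bcost b + (max_time c1 + max_time c2)).+1
  | While _ _ => 0
  end.

(* The register [x] runs from 0 to the content of the register [y]. *)
Definition For (x y : nat) (c : cmd) : cmd :=
  Seq (WSet x (WLit 0))
      (While (BNot (BWle (WVar y) (WVar x)))
             (Seq c (WSet x (WOp Wadd (WVar x) (WLit 1))))).

Section Logic.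
Context {R : realType} (W : nat).
Implicit Types (st : state R) (c : cmd).

(** The tape is not framed: until the levels are drawn, the specifications carry it explicitly. *)
Definition frame c st st' : Prop :=
  [/\ forall x, x \notin wmod c -> wreg st' x = wreg st x,
      forall x, x \notin rmod c -> rreg st' x = rreg st x,
      forall a, a \notin wamod c -> wmem st' a = wmem st a &
      forall a, a \notin ramod c -> rmem st' a = rmem st a].

Lemma frame_trans c st1 st2 st3 :
  frame c st1 st2 -> frame c st2 st3 -> frame c st1 st3.
Proof.
move=> [a1 a2 a3 a4] [b1 b2 b3 b4]; split=> x hx.
- by rewrite b1 ?a1.
- by rewrite b2 ?a2.
- by rewrite b3 ?a3.
- by rewrite b4 ?a4.
Qed.

Lemma frame_sub c c' st st' :
  {subset wmod c <= wmod c'} -> {subset rmod c <= rmod c'} ->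
  {subset wamod c <= wamod c'} -> {subset ramod c <= ramod c'} ->
  frame c st st' -> frame c' st st'.
Proof.
move=> h1 h2 h3 h4 [a1 a2 a3 a4]; split=> x hx.
- by apply: a1; apply: contra hx => /h1.
- by apply: a2; apply: contra hx => /h2.
- by apply: a3; apply: contra hx => /h3.
- by apply: a4; apply: contra hx => /h4.
Qed.

Lemma upd_neq (T : Type) (f : nat -> T) i v j : j != i -> upd f i v j = f j.
Proof. by rewrite /upd => /negbTE ->. Qed.

Lemma exec_frame c st st' k : exec W c st st' k -> frame c st st'.
Proof.
elim=> {c st st' k} //.
- by move=> st x e; split=> //= y; rewrite inE => h; rewrite upd_neq.
- by move=> st x e; split=> //= y; rewrite inE => h; rewrite upd_neq.
- by move=> st a i e; split=> //= y; rewrite inE => h; rewrite /upd2 upd_neq.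
- by move=> st a i e; split=> //= y; rewrite inE => h; rewrite /upd2 upd_neq.
- by move=> st x e; split=> //= y; rewrite inE => h; rewrite upd_neq.
- by move=> st x v r _; split=> //= y; rewrite inE => h; rewrite upd_neq.
- move=> c1 c2 st st1 st2 k1 k2 _ h1 _ h2; apply: (@frame_trans _ _ st1).
    by apply: frame_sub h1 => x /= hx; rewrite mem_cat hx.
  by apply: frame_sub h2 => x /= hx; rewrite mem_cat hx orbT.
- move=> b c1 c2 st st1 k _ h.
  by case: (beval _ _ _) h => h; apply: frame_sub h => x /= hx;
     rewrite mem_cat hx ?orbT.
- by move=> b c st st1 st2 k1 k2 _ _ h1 _ h2; apply: (frame_trans h1 h2).
Qed.

(** Total correctness with a time bound. By [exec_det] the execution found here is the only one. *)
Definition wp c (T : nat) (Post : state R -> Prop) st : Prop :=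
  exists st' k, [/\ exec W c st st' k, (k <= T)%N & Post st'].

Lemma wp_frame c T Post st :
  wp c T (fun st' => frame c st st' -> Post st') st -> wp c T Post st.
Proof.
by move=> [st' [k [h hk hP]]]; exists st', k; split=> //;
   apply: hP; apply: exec_frame h.
Qed.

Lemma wp_weaken c T T' (Post Post' : state R -> Prop) st :
  wp c T Post st -> (T <= T')%N -> (forall st', Post st' -> Post' st') ->
  wp c T' Post' st.
Proof.
move=> [st' [k [h hk hP]]] hT hPP; exists st', k.
by split=> //; [exact: leq_trans hT|exact: hPP].
Qed.

(** The frame of the first command is handed over for free, so that a specification only has to
    mention what changes. *)
Lemma wp_seq c1 c2 T1 T2 Post st :
  wp c1 T1 (fun st1 => frame c1 st st1 -> wp c2 T2 Post st1) st ->
  wp (Seq c1 c2) (T1 + T2).+1 Post st.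
Proof.
move=> /wp_frame [st1 [k1 [h1 l1 [st2 [k2 [h2 l2 hP]]]]]].
exists st2, (k1 + k2).+1; split=> //; first exact: ExSeq h1 h2.
by rewrite ltnS leq_add.
Qed.

Lemma wp_if b c1 c2 T Post st :
  wp (if beval W st b then c1 else c2) T Post st ->
  wp (If b c1 c2) (bcost b + T).+1 Post st.
Proof.
move=> [st1 [k [h hk hP]]]; exists st1, (bcost b + k).+1.
by split=> //; [exact: ExIf|rewrite ltnS leq_add2l].
Qed.

(** An evaluator for loop-free code, whose effect is thus obtained by computation; [Rand] and
    [While] get a dummy value. *)
Fixpoint den c st : state R :=
  match c with
  | Skip | Rand _ | While _ _ => st
  | WSet x e => set_wreg st x (weval W st e)
  | RSet x e => set_rreg st x (reval W st e)
  | WStore a i e => set_wmem st a (weval W st i) (weval W st e)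
  | RStore a i e => set_rmem st a (weval W st i) (reval W st e)
  | Floor x e =>
      set_wreg st x (minn (Num.truncn (reval W st e)) W.-1)
  | Seq c1 c2 => den c2 (den c1 st)
  | If b c1 c2 => if beval W st b then den c1 st else den c2 st
  end.

Lemma wp_den c (Post : state R -> Prop) st :
  straight c -> Post (den c st) -> wp c (max_time c) Post st.
Proof.
move=> hs hP.
suff [k [h hk]] : exists k, exec W c st (den c st) k /\ (k <= max_time c)%N.
  by exists (den c st), k.
elim: c st hs {hP} => //=; try by move=> *; eexists; split; [constructor|].
- move=> c1 IH1 c2 IH2 st /andP[s1 s2].
  have [k1 [h1 l1]] := IH1 st s1; have [k2 [h2 l2]] := IH2 (den c1 st) s2.
  by exists (k1 + k2).+1; split; [exact: ExSeq h1 h2|rewrite ltnS leq_add].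
- move=> b c1 IH1 c2 IH2 st /andP[s1 s2].
  have [k1 [h1 l1]] := IH1 st s1; have [k2 [h2 l2]] := IH2 st s2.
  case Eb : (beval W st b).
  - exists (bcost b + k1).+1; split; first by apply: ExIf; rewrite Eb.
    by rewrite ltnS leq_add2l (leq_trans l1) ?leq_addr.
  - exists (bcost b + k2).+1; split; first by apply: ExIf; rewrite Eb.
    by rewrite ltnS leq_add2l (leq_trans l2) ?leq_addl.
Qed.

(** Induction on the number [d] of remaining rounds. A round costs 10 on top of the body: 4 for the
    test, 4 for the increment, 1 each for [Seq] and [While]. The final 8 pays for the initial
    assignment (2), the outer [Seq] (1) and the failing test (5). The bound [N < W] keeps the
    counter from wrapping. *)
Lemma wp_for x y c N (I : nat -> state R -> Prop) (t : nat -> nat) st0 :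
  x \notin wmod c -> y \notin wmod c -> x != y -> (N < W)%N ->
  wreg st0 y = N -> I 0%N (set_wreg st0 x 0) ->
  (forall i st, (i < N)%N -> frame (For x y c) st0 st -> wreg st x = i ->
     I i st -> wp c (t i) (fun st' => frame c st st' ->
                             I i.+1 (set_wreg st' x i.+1)) st) ->
  wp (For x y c) (\sum_(i < N) (t i + 10) + 8) (I N) st0.
Proof.
move=> xc yc xy NW hy I0 hI.
pose c' := Seq c (WSet x (WOp Wadd (WVar x) (WLit 1))).
pose b := BNot (BWle (WVar y) (WVar x)).
have step d : (d <= N)%N -> forall st, frame (For x y c) st0 st ->
    wreg st x = (N - d)%N -> I (N - d)%N st ->
    wp (While b c') (\sum_(N - d <= i < N) (t i + 10) + 5) (I N) st.
  elim: d => [|d IH] hd st fst hx Ist.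
    rewrite subn0 in hx Ist *.
    have yN : wreg st y = N.
      by case: fst => -> //; rewrite /= inE mem_cat !inE eq_sym !negb_or xy yc.
    exists st, 5%N; split=> //; last by rewrite leq_addl.
    by apply: ExWhileF; rewrite /= yN hx leqnn.
  have ltN : (N - d.+1 < N)%N by lia.
  have yN : wreg st y = N.
    by case: fst => -> //; rewrite /= inE mem_cat !inE eq_sym !negb_or xy yc.
  have /wp_frame [st1 [k1 [h1 l1 [fr1 P1]]]] :
    wp c (t (N - d.+1)%N) (fun st' => frame c st st' ->
      frame c st st' /\ I (N - d.+1).+1 (set_wreg st' x (N - d.+1).+1)) st.
    have [st1 [k1 [h1 l1 P1]]] := hI _ _ ltN fst hx Ist.
    by exists st1, k1; split=> // fr; split=> //; exact: P1.
  have x1 : wreg st1 x = (N - d.+1)%N by case: fr1 => ->.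
  have eS : (N - d.+1).+1 = (N - d)%N by lia.
  set st2 := set_wreg st1 x (N - d.+1).+1.
  have h2 : exec W c' st st2 (k1 + 4).+1.
    apply: ExSeq h1 _.
    have -> : st2 = set_wreg st1 x
       (weval W st1 (WOp Wadd (WVar x) (WLit 1))).
      rewrite /= x1 modnDmr modn_small ?addn1 //; lia.
    exact: ExWSet.
  have [st3 [k3 [h3 l3 P3]]] : wp (While b c')
      (\sum_(N - d <= i < N) (t i + 10) + 5) (I N) st2.
    apply: IH; rewrite -?eS //; first lia; last first.
      by rewrite /= /upd eqxx.
    have f2 := exec_frame h2.
    apply: frame_trans fst _; apply: frame_sub f2 => z /= hz //.
    by rewrite inE hz orbT.
  exists st3, (4 + (k1 + 4).+1 + k3).+1; split=> //.
    apply: ExWhileT h2 h3; rewrite /= yN hx; lia.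
  rewrite (big_ltn ltN) eS.
  move: l1 l3; set S := \sum_(_ <= _ < _) _; lia.
have [st1 [k1 [h1 l1 P1]]] : wp (While b c')
    (\sum_(N - N <= i < N) (t i + 10) + 5) (I N) (set_wreg st0 x 0).
  apply: step => //; rewrite ?subnn //.
    by split=> // z; rewrite /= inE mem_cat !negb_or => /andP[zx _]; rewrite upd_neq.
  by rewrite /= /upd eqxx.
exists st1, (2 + k1).+1; split=> //.
  apply: (ExSeq (st1 := set_wreg st0 x 0)) h1.
  have -> : set_wreg st0 x 0 = set_wreg st0 x (weval W st0 (WLit 0)).
    by rewrite /= mod0n.
  exact: ExWSet.
rewrite subnn big_mkord in l1; move: l1; lia.
Qed.

Lemma wp_for_const x y c N (I : nat -> state R -> Prop) (t : nat) st0 :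
  x \notin wmod c -> y \notin wmod c -> x != y -> (N < W)%N ->
  wreg st0 y = N -> I 0%N (set_wreg st0 x 0) ->
  (forall i st, (i < N)%N -> frame (For x y c) st0 st -> wreg st x = i ->
     I i st -> wp c t (fun st' => frame c st st' ->
                             I i.+1 (set_wreg st' x i.+1)) st) ->
  wp (For x y c) (N * (t + 10) + 8) (I N) st0.
Proof.
move=> xc yc xy NW hy I0 hI.
apply: (wp_weaken (wp_for (t := fun=> t) xc yc xy NW hy I0 hI)) => //.
by rewrite sum_nat_const card_ord.
Qed.

End Logic.

(** * Paths, dynamic programming and the recursion on levels *)

Section Graphs.
Context {R : realType} {n : nat} (G : digraph R n).
Local Notation E := 'I_(nedges G).
Implicit Types (s t v : 'I_n) (p : seq E) (e : E).

Definition verts s p : seq 'I_n := s :: [seq (ends e).2 | e <- p].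
Definition path_end s p : 'I_n := last s [seq (ends e).2 | e <- p].

Lemma is_path_cat s t p1 p2 :
  is_path s t (p1 ++ p2) = is_path s (path_end s p1) p1 && is_path (path_end s p1) t p2.
Proof.
elim: p1 s => [|e p1 IH] s /=; first by rewrite eqxx.
by rewrite IH andbA.
Qed.

Lemma is_path_end s t p : is_path s t p -> t = path_end s p.
Proof.
elim: p s => [|e p IH] s /=; first by move/eqP.
by case/andP=> _ /IH.
Qed.

Lemma is_path_rcons s t p e :
  is_path s t (rcons p e) = is_path s (ends e).1 p && ((ends e).2 == t).
Proof.
rewrite -cats1 is_path_cat /= [(ends e).1 == _]eq_sym.
apply/idP/idP; first by case/and3P=> hp /eqP <- ->; rewrite hp.
by case/andP=> hp ht; rewrite -(is_path_end hp) hp eqxx.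
Qed.

Lemma plen_cat p1 p2 : plen (p1 ++ p2) = plen p1 + plen p2.
Proof. exact: big_cat. Qed.

Lemma pdel_cat p1 p2 : pdel (p1 ++ p2) = pdel p1 + pdel p2.
Proof. exact: big_cat. Qed.

Lemma plen_ge0 p : 0 <= plen p.
Proof. by apply: sumr_ge0 => e _; exact: elen_ge0. Qed.

Lemma pdel_ge0 p : 0 <= pdel p.
Proof. by apply: sumr_ge0 => e _; exact: edel_ge0. Qed.

Lemma verts_cat s p1 p2 :
  verts s (p1 ++ p2) = verts s p1 ++ [seq (ends e).2 | e <- p2].
Proof. by rewrite /verts map_cat. Qed.

(** This cut serves twice: to remove cycles, and to find the last vertex of high level. *)
Lemma split_last_vertex s p (a : pred 'I_n) : has a (verts s p) ->
  exists p1 p2, [/\ p = p1 ++ p2, a (path_end s p1) &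
                    all (predC a) [seq (ends e).2 | e <- p2]].
Proof.
elim/last_ind: p => [|p e IH].
  by rewrite /= orbF => h; exists [::], [::].
have [ae|nae] := boolP (a (ends e).2).
  by exists (rcons p e), [::]; split; rewrite ?cats0 // /path_end map_rcons last_rcons.
rewrite /verts map_rcons -rcons_cons has_rcons (negbTE nae) /= => /IH.
move=> [p1 [p2 [-> h1 h2]]]; exists p1, (rcons p2 e).
by rewrite rcons_cat map_rcons all_rcons /= nae.
Qed.

(** If the simplified tail comes back to [s], everything before its last visit to [s] is dropped,
    which increases neither sum. *)
Lemma simple_path s t p : is_path s t p ->
  exists p', [/\ is_path s t p', uniq (verts s p'), plen p' <= plen p &
                 pdel p' <= pdel p].
Proof.
elim: p s => [|e p IH] s /=; first by move=> h; exists [::].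
move=> /andP[/eqP es /IH [p' [hp' up' lp' dp']]].
have lep : plen p' <= plen (e :: p).
  by rewrite /plen big_cons; apply: le_trans lp' _; rewrite lerDr elen_ge0.
have dep : pdel p' <= pdel (e :: p).
  by rewrite /pdel big_cons; apply: le_trans dp' _; rewrite lerDr edel_ge0.
have [sin|sout] := boolP (s \in verts (ends e).2 p'); last first.
  exists (e :: p'); split=> //=; rewrite ?es ?eqxx //.
  - by rewrite sout.
  - by rewrite /plen !big_cons lerD2l.
  - by rewrite /pdel !big_cons lerD2l.
have /split_last_vertex [p1 [p2 [e12 /eqP e2 _]]] : has (pred1 s) (verts (ends e).2 p').
  by rewrite has_pred1.
exists p2; rewrite e12 is_path_cat e2 in hp' up' lep dep *.
case/andP: hp' => hp1 hp2; split=> //.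
- rewrite verts_cat cat_uniq /= in up' *; case/and3P: up' => _ /hasPn h ->.
  have sp1 : s \in verts (ends e).2 p1 by rewrite -e2 mem_last.
  by rewrite andbT; apply/negP => /h /negP.
- by apply: le_trans lep; rewrite plen_cat lerDr plen_ge0.
- by apply: le_trans dep; rewrite pdel_cat lerDr pdel_ge0.
Qed.

Lemma size_simple s p : uniq (verts s p) -> (size p < n)%N.
Proof.
move/card_uniqP => /= h.
have := max_card (mem (verts s p)); rewrite h card_ord size_map.
exact.
Qed.

(** Simple paths have fewer than [n] edges and so live in the finite type of bounded sequences,
    where a minimum exists; [simple_path] extends minimality to all paths. *)
Lemma min_path s t D : (exists p, is_path s t p /\ pdel p <= D) ->
  exists p, [/\ is_path s t p, pdel p <= D, uniq (verts s p) &
    forall p', is_path s t p' -> pdel p' <= D -> plen p <= plen p'].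
Proof.
move=> [p0 [/simple_path [p1 [h1 u1 _ d1]] d0]].
have s1 := size_simple u1.
pose a (p : n.-bseq E) := [&& is_path s t p, pdel p <= D & uniq (verts s p)].
have a1 : a (Bseq (ltnW s1)) by apply/and3P; split=> //; exact: le_trans d1 d0.
case: (@arg_minP _ _ _ (Bseq (ltnW s1)) a (fun p : n.-bseq E => plen p) a1) => p.
move=> /and3P[hp dp up] minp; exists p; split=> // p' hp' dp'.
have [p2 [h2 u2 l2 d2]] := simple_path hp'.
have s2 := size_simple u2; apply: le_trans l2.
apply: (minp (Bseq (ltnW s2))).
by apply/and3P; split=> //; exact: le_trans d2 dp'.
Qed.

Lemma plen_simple s p : uniq (verts s p) -> plen p <= \sum_(e < nedges G) elen e.
Proof.
move=> /= /andP[_ /map_uniq up]; rewrite /plen big_uniq //=.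
by rewrite [leRHS](bigID (mem p)) /= lerDl sumr_ge0 // => e _; exact: elen_ge0.
Qed.

(** The equations of the dynamic program, independent of the order of relaxation: a cell is attained
    by one of its candidates and bounded by all of them. Row [b] is a budget in fine units, [pp] of
    which make one unit of [T0]. An edge uses [(w e).+1] fine units, so that even an edge of delay 0
    leads to a strictly smaller row. *)
Definition dp_ok (N pp : nat) (w : E -> nat) (T0 A : nat -> 'I_n -> R) : Prop :=
  forall b t, (b < N)%N ->
  [/\ A b t = T0 (b %/ pp)%N t \/ exists e,
        [/\ (ends e).2 = t, (w e < b)%N &
            A b t = A (b - w e).-1 (ends e).1 + elen e],
      A b t <= T0 (b %/ pp)%N t &
      forall e, (ends e).2 = t -> (w e < b)%N ->
        A b t <= A (b - w e).-1 (ends e).1 + elen e].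

(* Values [>= inf] stand for the absence of a path. *)
Definition sound_len (inf : R) s t (D x : R) : Prop :=
  inf <= x \/ exists p, [/\ is_path s t p, plen p = x & pdel p <= D].

(** Neither rounding understates a delay: an edge is charged at least its delay, and [b %/ pp]
    rounds the initial budget down. *)
Lemma dp_sound N pp w T0 A s (u inf : R) : dp_ok N pp w T0 A -> 0 <= u ->
  (forall e, (w e < N)%N -> edel e <= (w e).+1%:R * u) ->
  (forall b t, (b < N)%N ->
     sound_len inf s t ((b %/ pp)%N%:R * (pp%:R * u)) (T0 (b %/ pp)%N t)) ->
  forall b t, (b < N)%N -> sound_len inf s t (b%:R * u) (A b t).
Proof.
move=> hA u0 hw hT; elim/ltn_ind => b IH t bN.
have [h _ _] := hA b t bN; case: h => [->|[e [et web ->]]].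
  case: (hT b t bN) => [h|[p [hp <- dp]]]; [by left|right; exists p; split=> //].
  apply: le_trans dp _; rewrite mulrA -natrM ler_wpM2r // ler_nat.
  exact: leq_divM.
have lb : ((b - w e).-1 < b)%N by lia.
case: (IH _ lb (ends e).1 (ltn_trans lb bN)) => [h|[p [hp <- dp]]].
  by left; apply: le_trans h _; rewrite lerDl elen_ge0.
right; exists (rcons p e); split; first by rewrite is_path_rcons hp et eqxx.
  by rewrite -cats1 plen_cat [plen [:: e]]big_seq1.
rewrite -cats1 pdel_cat [pdel [:: e]]big_seq1.
have := hw e (ltn_trans web bN).
have -> : b%:R = (b - w e).-1%:R + (w e).+1%:R :> R by rewrite -natrD; congr _%:R; lia.
by rewrite mulrDl => h; apply: lerD.
Qed.

(** Peels off the last edge. From row [b0] on the initial value at [v] is good enough, and the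
    remaining rows pay for the edges. *)
Lemma dp_complete N pp w T0 A v t p (X : R) (b0 b : nat) : dp_ok N pp w T0 A ->
  (forall b', (b0 <= b')%N -> (b' < N)%N -> T0 (b' %/ pp)%N v <= X) ->
  is_path v t p -> (b < N)%N ->
  (b0 + \sum_(e <- p) (w e).+1 <= b)%N -> A b t <= X + plen p.
Proof.
move=> hA hT; elim/last_ind: p t b => [|p e IH] t b.
  move=> /= /eqP <- bN; rewrite big_nil addn0 /plen big_nil addr0 => b0b.
  by have [_ h _] := hA b v bN; apply: le_trans h _; exact: hT.
rewrite is_path_rcons => /andP[hp /eqP et] bN.
rewrite -cats1 big_cat big_seq1 plen_cat [plen [:: e]]big_seq1 /= => hb.
have web : (w e < b)%N by lia.
have [_ _ h] := hA b t bN; apply: le_trans (h e et web) _.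
rewrite addrA lerD2r; apply: IH => //; lia.
Qed.

End Graphs.

(* [gdir true G] is [G], [gdir false G] the reversed graph. *)
Lemma dir_ends_inj (R : realType) n (G : digraph R n) (d : bool) :
  injective (fun e : 'I_(nedges G) =>
    if d then ends e else ((ends e).2, (ends e).1)).
Proof.
move=> e e'; case: d => [/ends_inj //|[h2 h1]].
by apply: ends_inj; move: h1 h2; case: (ends e) (ends e') => a b [a' b'] /= -> ->.
Qed.

Definition gdir (d : bool) (R : realType) n (G : digraph R n) : digraph R n :=
  Digraph (@dir_ends_inj R n G d) (@elen_ge0 R n G) (@edel_ge0 R n G).

(** * Completeness of the table, from one level to the next *)

Section Levels.
Context {R : realType} {n : nat}.
Variables (lev : 'I_n -> nat) (K Q1 : nat) (u0 : R).
Hypothesis u0_gt0 : 0 < u0.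
Implicit Types (G : digraph R n) (T : nat -> 'I_n -> 'I_n -> R).

(** Without a vertex of level above [j] this is the size of [vs], a default that pays for paths
    without shortcuts. *)
Definition gap (j : nat) (vs : seq 'I_n) : nat := find (fun v => j < lev v)%N vs.

(** Taking gaps from both ends makes the error invariant under reversal, so that the same quantity
    fits forward and backward runs. *)
Definition err (i : nat) (vs : seq 'I_n) : R :=
  \sum_(i <= j < K.+1) (u0 + (gap j vs + gap j (rev vs))%:R * (u0 / 2 ^+ j)).

(* [T] stores a length at most [X] in every cell whose budget is at least [theta]. *)
Definition tab_le T s t (X theta : R) : Prop :=
  forall q, (q < Q1)%N -> theta <= q%:R * u0 -> T q s t <= X.

Definition complete_from G (i : nat) T : Prop :=
  forall s t (p : seq 'I_(nedges G)), is_path s t p ->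
  (i <= lev s)%N || (i <= lev t)%N ->
  tab_le T s t (plen p) (pdel p + err i (verts s p)).

Lemma err_rev i vs : err i (rev vs) = err i vs.
Proof. by apply: eq_bigr => j _; rewrite revK addnC. Qed.

Lemma err_term_ge0 j vs :
  0 <= u0 + (gap j vs + gap j (rev vs))%:R * (u0 / 2 ^+ j).
Proof.
by rewrite addr_ge0 ?mulr_ge0 ?invr_ge0 ?exprn_ge0 ?ler0n // ltW.
Qed.

Lemma err_recl i vs : (i <= K)%N ->
  err i vs = u0 + (gap i vs + gap i (rev vs))%:R * (u0 / 2 ^+ i) + err i.+1 vs.
Proof. by move=> iK; rewrite /err big_ltn. Qed.

Lemma err_ge0 i vs : 0 <= err i vs.
Proof. by apply: sumr_ge0 => j _; exact: err_term_ge0. Qed.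

Lemma err_mono i vs : err i.+1 vs <= err i vs.
Proof.
have [iK|Ki] := leqP i K; first by rewrite [leRHS]err_recl // lerDr err_term_ge0.
by rewrite /err !big_geq // ltnS ltnW.
Qed.

Lemma tab_le_weaken T T' s t X X' th th' : (forall q, (q < Q1)%N -> T' q s t <= T q s t) ->
  X <= X' -> th <= th' -> tab_le T s t X th -> tab_le T' s t X' th'.
Proof.
move=> TT XX hth h q qQ hq; apply: le_trans (TT q qQ) _; apply: le_trans XX.
by apply: h => //; apply: le_trans hq.
Qed.

(** The shortcut from [s] to [v] is read at a multiple of [u0], which costs at most one [u0]; each
    edge of [p] then loses at most one fine unit to rounding. *)
Lemma tab_le_extend G T T' A s v t (p : seq 'I_(nedges G)) X theta i w : (i <= K)%N ->
  dp_ok (G := G) (Q1.-1 * 2 ^ i).+1 (2 ^ i) w (fun h x => T h s x) A ->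
  (forall q, (q < Q1)%N -> T' q s t = A (q * 2 ^ i)%N t) ->
  (forall e, (w e)%:R * (u0 / 2 ^+ i) <= edel e) ->
  0 <= theta -> tab_le T s v X theta -> is_path v t p ->
  tab_le T' s t (X + plen p)
    (theta + pdel p + u0 + (size p)%:R * (u0 / 2 ^+ i)).
Proof.
move=> iK hA hT' hw th0 hv hp q qQ hq; rewrite hT' //.
set u := u0 / 2 ^+ i in hw hq *.
have u_gt0 : 0 < u by rewrite divr_gt0 ?exprn_gt0.
have u0E : u0 = (2 ^ i)%:R * u by rewrite natrX /u mulrC divfK // expf_neq0.
have p2 : (0 < 2 ^ i)%N by rewrite expn_gt0.
(* The first budget strictly above [theta]; it exceeds [theta] by at most one unit. *)
set q0 := (Num.truncn (theta / u0)).+1.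
have /andP[lo hi] : ((q0.-1)%:R <= theta / u0) && (theta / u0 < q0%:R).
  by rewrite /q0 /=; apply: truncn_itv; rewrite divr_ge0 // ltW.
have th_q0 : theta <= q0%:R * u0 by rewrite -ler_pdivrMr // ltW.
have q0_th : q0%:R * u0 <= theta + u0.
  by rewrite /q0 -natr1 mulrDl mul1r lerD2r -ler_pdivlMr.
apply: (dp_complete hA (b0 := (q0 * 2 ^ i)%N) _ hp) => [b' h1 h2||].
- apply: hv; first by rewrite ltn_divLR //; lia.
  by apply: le_trans th_q0 _; rewrite ler_pM2r // ler_nat leq_divRL.
- by rewrite ltnS leq_mul2r; apply/orP; right; lia.
rewrite -(ler_nat R) -(ler_pM2r u_gt0) natrD mulrDl natrM -mulrA -u0E.
rewrite natrM -mulrA -u0E.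
apply: le_trans hq.
have -> : (\sum_(e <- p) (w e).+1)%N%:R * u = \sum_(e <- p) ((w e)%:R * u) + (size p)%:R * u.
  rewrite natr_sum mulr_suml.
  under eq_bigr do rewrite -natr1 mulrDl mul1r.
  rewrite big_split /=; congr (_ + _).
  by rewrite big_const_seq count_predT iter_addr_0 mulr_natl.
have -> : theta + pdel p + u0 + (size p)%:R * u =
   (theta + u0) + (pdel p + (size p)%:R * u) by ring.
apply: lerD => //; rewrite lerD2r.
by apply: ler_sum => e _; exact: hw.
Qed.

Lemma gap_le_cat j vs1 vs2 : (gap j vs1 <= gap j (vs1 ++ vs2))%N.
Proof.
rewrite /gap find_cat; case: ifP => // /negbT h.
by rewrite hasNfind // leq_addr.
Qed.

(* A path is cut at its last vertex of level [> i], if any. *)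
Lemma complete_step G T T' A s i w : (i <= K)%N ->
  dp_ok (G := G) (Q1.-1 * 2 ^ i).+1 (2 ^ i) w (fun h x => T h s x) A ->
  (forall q t, (q < Q1)%N -> T' q s t = A (q * 2 ^ i)%N t) ->
  (forall e, (w e)%:R * (u0 / 2 ^+ i) <= edel e) ->
  (forall q, (q < Q1)%N -> T q s s <= 0) ->
  complete_from G i.+1 T ->
  forall t (p : seq 'I_(nedges G)), is_path s t p ->
    tab_le T' s t (plen p) (pdel p + err i (verts s p)).
Proof.
move=> iK hA hT' hw Tss hC t p hp.
have hT't q : (q < Q1)%N -> T' q s t = A (q * 2 ^ i)%N t by move=> h; exact: hT'.
pose a := fun v => (i < lev v)%N.
have u_ge0 : 0 <= u0 / 2 ^+ i by rewrite divr_ge0 ?exprn_ge0 // ltW.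
(* Without a vertex of level above [i], the shortcut is the trivial one from [s] to [s], and the gap
   exceeds the number of edges by one. *)
have [ha|/hasPn hna] := boolP (has a (verts s p)); last first.
  have c0 : tab_le T s s 0 0 by move=> q qQ _; exact: Tss.
  have := tab_le_extend iK hA hT't hw (lexx 0) c0 hp.
  apply: tab_le_weaken => //; rewrite ?add0r // -addrA lerD2l err_recl //.
  rewrite -addrA lerD2l; apply: ler_wpDr; first exact: err_ge0.
  rewrite (ler_wpM2r u_ge0) // ler_nat /gap hasNfind.
    by rewrite /= size_map; lia.
  by rewrite -all_predC; apply/allP => v /hna.
have [p1 [p2 [e12 av alln]]] := split_last_vertex ha.
set v := path_end s p1 in av.
have [hp1 hp2] : is_path s v p1 /\ is_path v t p2.
  by move: hp; rewrite e12 is_path_cat => /andP[].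
(* The hypothesis applies through the endpoint [v], whose level is above [i]. *)
have c1 := hC s v p1 hp1.
rewrite [(i.+1 <= lev v)%N]av orbT in c1.
have th0 : 0 <= pdel p1 + err i.+1 (verts s p1).
  by rewrite addr_ge0 ?pdel_ge0 ?err_ge0.
have := tab_le_extend iK hA hT't hw th0 (c1 isT) hp2.
apply: tab_le_weaken => //; first by rewrite e12 plen_cat.
rewrite {1}e12 pdel_cat (err_recl (verts s p) iK).
(* No vertex entered along [p2] has level above [i]; seen from the end, [p2] thus adds its full size
   to every gap with [i <= j]. This pays for the segment at level [i], and shows that at higher
   levels the prefix has no larger error than the whole path. *)
have gE j : (i <= j)%N -> (size p2 + gap j (rev (verts s p1)) <= gap j (rev (verts s p)))%N.
  move=> ij; rewrite e12 verts_cat rev_cat /gap find_cat.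
  rewrite size_rev size_map; case: ifP => // /hasP [x].
  rewrite mem_rev => /(allP alln) /= xi xj.
  by move: (leq_ltn_trans ij xj); rewrite -[(i < lev x)%N]/(a x) (negbTE xi).
have h1 : err i.+1 (verts s p1) <= err i.+1 (verts s p).
  rewrite /err !big_nat; apply: ler_sum => j /andP[ij _].
  rewrite lerD2l ler_pM2r ?divr_gt0 ?exprn_gt0 // ler_nat.
  have := gE j (ltnW ij); rewrite {2}e12 verts_cat.
  have := gap_le_cat j (verts s p1) [seq (ends e).2 | e <- p2]; lia.
have h2 : (size p2)%:R * (u0 / 2 ^+ i) <=
    (gap i (verts s p) + gap i (rev (verts s p)))%:R * (u0 / 2 ^+ i).
  by rewrite (ler_wpM2r u_ge0) // ler_nat; have := gE i (leqnn i); lia.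
lra.
Qed.

End Levels.

(** * Reversed paths *)

Section Direction.
Context {R : realType} {n : nat} (G : digraph R n).

Lemma is_path_rev s t (p : seq 'I_(nedges G)) :
  @is_path R n (gdir false G) t s (rev p) = is_path s t p.
Proof.
elim: p s t => [|e p IH] s t /=; first by rewrite eq_sym.
by rewrite rev_cons (@is_path_rcons R n (gdir false G)) IH /= andbC.
Qed.

Lemma verts_rev s t (p : seq 'I_(nedges G)) : is_path s t p ->
  @verts R n (gdir false G) t (rev p) = rev (verts s p).
Proof.
elim: p s t => [|e p IH] s t /=; first by move/eqP=> ->.
move=> /andP[/eqP es /IH h].
rewrite /verts rev_cons map_rcons -rcons_cons -/(verts _ _) h /=.
by rewrite !rev_cons es.
Qed.

Lemma plen_rev (p : seq 'I_(nedges G)) : plen (rev p) = plen p.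
Proof. by rewrite /plen (perm_big p) // perm_rev. Qed.

Lemma pdel_rev (p : seq 'I_(nedges G)) : pdel (rev p) = pdel p.
Proof. by rewrite /pdel (perm_big p) // perm_rev. Qed.

Lemma sound_len_rev inf s t D x :
  @sound_len R n (gdir false G) inf t s D x <-> @sound_len R n G inf s t D x.
Proof.
split=> -[h|[p [hp <- dp]]]; [by left| |by left|]; right.
- exists (rev p); split; [|by rewrite plen_rev|by rewrite pdel_rev].
  by rewrite -is_path_rev revK.
- exists (rev p); split; [by rewrite is_path_rev|exact: plen_rev|].
  by rewrite [pdel _](pdel_rev p).
Qed.

End Direction.

(** * Random levels *)

(* The 2-adic valuation of [r], truncated to [K]. *)
Fixpoint level (K r : nat) : nat :=
  if K is K'.+1 then
    let l := level K' r in if (2 ^ l.+1 %| r)%N then l.+1 else l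
  else 0.

Lemma level_le K r : (level K r <= K)%N.
Proof. by elim: K => //= K IH; case: ifP => _ //; rewrite leqW. Qed.

(** Once the level lags behind the number of steps, a test of divisibility by the next power of two
    has failed, and all later steps repeat that same test. The divisibility form yields exact tail
    probabilities. *)
Lemma leq_level K r i : (i <= K)%N -> (i <= level K r)%N = (2 ^ i %| r)%N.
Proof.
elim: K i => [|K IH] i /=; first by rewrite leqn0 => /eqP ->; rewrite expn0 dvd1n.
set l := level K r; have lK : (l <= K)%N := level_le K r.
have hl : (2 ^ l %| r)%N by rewrite -(IH l lK).
have hS : (l < K)%N -> (2 ^ l.+1 %| r)%N = false.
  by move=> h; rewrite -(IH _ h) ltnn.
rewrite leq_eqVlt ltnS => /orP[/eqP ->|iK].
  have [lltK|Klel] := ltnP l K.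
    rewrite hS // leqNgt ltnW //=; apply/esym/negbTE/negP => h.
    move/negP: (negbT (hS lltK)); apply; apply: dvdn_trans h.
    by apply: dvdn_exp2l; rewrite ltnS ltnW.
  have -> : l = K by apply/eqP; rewrite eqn_leq lK.
  by case: ifP => _; rewrite ?ltnSn ?ltnn.
rewrite -(IH i iK) -/l; case: ifP => // h.
have -> : l = K by apply/eqP; rewrite eqn_leq lK leqNgt; apply/negP => /hS; rewrite h.
by rewrite iK leqW.
Qed.

Lemma sum_dvdn d k : (0 < d)%N -> (\sum_(w < d * k) (d %| w) = k)%N.
Proof.
move=> d0; rewrite -(big_mkord xpredT (fun w => (d %| w) : nat)).
elim: k => [|k IH]; first by rewrite muln0 big_geq.
have h : (d * k <= d * k.+1)%N by rewrite leq_mul2l leqnSn orbT.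
rewrite (big_cat_nat (leq0n _) h) /= IH mulnS addnC.
rewrite -{1}[(d * k)%N]add0n big_addn addnK big_ltn // add0n dvdn_mulr //.
rewrite big_nat big1 => [|i /andP[i0 id]]; first by rewrite addn0; lia.
by rewrite dvdn_addl ?dvdn_mulr // gtnNdvd.
Qed.

Section Probability.
Context {R : realType}.
Variables (L b K n : nat).
Hypothesis Kb : (K <= b)%N.
Hypothesis nL : (n <= L)%N.
Local Notation W := (2 ^ b)%N.
Local Notation tapes := (L.-tuple 'I_W).
Implicit Types (r : tapes) (w : 'I_W) (v : 'I_n) (vs : seq 'I_n).

(** The tape is as long as the time bound; the vertices read its first [n] words. *)
Definition slot v : 'I_L := widen_ord nL v.
Definition vlev r v : nat := level K (tnth r (slot v)).

Lemma sum_level i : (i <= K)%N ->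
  (\sum_(w < W) (i <= level K w) = 2 ^ (b - i))%N.
Proof.
move=> iK; under eq_bigr => w _ do rewrite (leq_level _ iK).
rewrite -[in LHS](subnKC (leq_trans iK Kb)) expnD sum_dvdn ?expn_gt0 //.
Qed.

Definition reset r (x : 'I_L) w : tapes :=
  [tuple if y == x then w else tnth r y | y < L].

Lemma vlev_reset r v w v' : v' != v -> vlev (reset r (slot v) w) v' = vlev r v'.
Proof.
by move=> h; rewrite /vlev tnth_mktuple ifN.
Qed.

(* Resampling: [(r, w) |-> (r with x := w, r x)] is an involution. *)
Lemma resample (x : 'I_L) (H : 'I_W -> tapes -> R) :
  (forall w w' r, H w (reset r x w') = H w r) ->
  W%:R * \sum_r H (tnth r x) r = \sum_w \sum_r H w r.
Proof.
move=> hH; rewrite exchange_big.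
have -> : W%:R * \sum_r H (tnth r x) r =
    \sum_(r : tapes) \sum_(w : 'I_W) H (tnth r x) r.
  rewrite mulr_sumr; apply: eq_bigr => r _.
  by rewrite sumr_const card_ord mulr_natl.
rewrite !pair_big /=.
pose f (rw : tapes * 'I_W) := (reset rw.1 x rw.2, tnth rw.1 x).
have ff : involutive f.
  move=> [r w]; rewrite /f /= tnth_mktuple eqxx; congr (_, _).
  apply: eq_from_tnth => y; rewrite !tnth_mktuple.
  by case: eqP => // ->.
rewrite (reindex_inj (inv_inj ff)) /=.
by apply: eq_bigr => -[r w] _; rewrite /= tnth_mktuple eqxx hH.
Qed.

Lemma sum_tapes (c : R) : \sum_(r : tapes) c = (W ^ L)%N%:R * c.
Proof. by rewrite sumr_const card_tuple card_ord mulr_natl. Qed.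

(** The random part of [err]. Level [K] is left out, since there a gap of at most [n <= 2 ^ K] is
    bounded trivially; [M] serves the induction along the list. *)
Definition gap_cost (lev : 'I_n -> nat) M vs : R :=
  \sum_(M <= j < K) (gap lev j vs)%:R / 2 ^+ j.

Lemma gap_reset r v w j vs : v \notin vs ->
  gap (vlev (reset r (slot v) w)) j vs = gap (vlev r) j vs.
Proof.
move=> vvs; apply: eq_in_find => u uvs; rewrite vlev_reset //.
by apply: contraNneq vvs => <-.
Qed.

(** The first vertex makes all gaps below its level vanish and adds one to the others. *)
Lemma gap_cost_cons lev M v vs :
  gap_cost lev M (v :: vs) =
  \sum_(maxn M (lev v) <= j < K) 2 ^- j + gap_cost lev (maxn M (lev v)) vs.
Proof.
rewrite /gap_cost -big_split /=; set M' := maxn _ _.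
have MM : (M <= M')%N by rewrite leq_maxl.
have [h|h] := leqP M' K; last first.
  rewrite [RHS]big_geq 1?ltnW // big_nat big1 // => j /andP[Mj jK].
  by rewrite ifT ?mul0r //; lia.
rewrite (big_cat_nat MM h) /= big_nat big1 ?add0r => [|j /andP[Mj jM]]; last first.
  by rewrite ifT ?mul0r //; lia.
rewrite !big_nat; apply: eq_bigr => j /andP[Mj jK].
by rewrite ifN; [rewrite -natr1 mulrDl mul1r addrC|lia].
Qed.

Lemma sum_half_pow M : \sum_(M <= j < K) 2 ^- j <= 2 * 2 ^- M :> R.
Proof.
have [h|h] := leqP M K; last first.
  by rewrite big_geq 1?ltnW // mulr_ge0 // invr_ge0 exprn_ge0.
suff -> : \sum_(M <= j < K) 2 ^- j = 2 * 2 ^- M - 2 * 2 ^- K :> R.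
  by rewrite gerBl mulr_ge0 // invr_ge0 exprn_ge0.
elim: K h => [|k IH].
  by rewrite leqn0 => /eqP ->; rewrite big_geq // subrr.
rewrite leq_eqVlt => /orP[/eqP ->|]; first by rewrite big_geq // subrr.
rewrite ltnS => h; rewrite big_nat_recr //= IH // exprS invfM.
by rewrite mulrA divff // mul1r; lra.
Qed.

Lemma expR_le_inv (y : R) : y < 1 -> expR y <= (1 - y)^-1.
Proof.
move=> y1; rewrite -[y in expR y]opprK expRN lef_pV2 ?posrE ?expR_gt0 ?subr_gt0 //.
exact: expR_ge1Dx.
Qed.

(* Induction along the path, where [M] is the largest level met so far: a vertex
   costs at most [2 * 2 ^- M], but it raises [M], which halves the bound, with
   probability at least [2 ^- M.+1]. *)
Lemma mgf_gap_cost vs M : uniq vs -> (M <= K)%N ->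
  \sum_(r : tapes) expR (8^-1 * gap_cost (vlev r) M vs) <=
    (W ^ L)%N%:R * 2 ^+ (K - M).
Proof.
elim: vs M => [|v vs IH] M /=.
  move=> _ MK; under eq_bigr => r _.
    rewrite /gap_cost big1 ?mulr0 ?expR0 => [|j _]; last by rewrite mul0r.
    over.
  by rewrite sum_tapes mulr1 ler_peMr ?ler0n // exprn_ege1 // ler1n.
move=> /andP[vvs uvs]; rewrite leq_eqVlt => /orP[/eqP ->|MK].
  under eq_bigr => r _ do rewrite /gap_cost big_geq // mulr0 expR0.
  by rewrite sum_tapes subnn expr0.
pose H w r : R := expR (8^-1 * \sum_(maxn M (level K w) <= j < K) 2 ^- j) *
  expR (8^-1 * gap_cost (vlev r) (maxn M (level K w)) vs).
have W0 : 0 < W%:R :> R by rewrite ltr0n expn_gt0.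
rewrite -(ler_pM2l W0).
have -> : \sum_(r : tapes) expR (8^-1 * gap_cost (vlev r) M (v :: vs)) =
    \sum_(r : tapes) H (tnth r (slot v)) r.
  by apply: eq_bigr => r _; rewrite gap_cost_cons mulrDr expRD.
rewrite resample => [|w w' r]; last first.
  rewrite /H /gap_cost; congr (_ * expR (_ * _)); apply: eq_bigr => j _.
  by rewrite gap_reset.
(* [y] bounds the exponent [8^-1 * (2 * 2 ^- M)] paid by [v]. The expected gain is [y] as well,
   since the bound is halved with probability [2 ^- M.+1]. The rate [8^-1] is chosen to make the two
   agree: [expR y * (1 - y) <= 1] then closes the induction. *)
pose y : R := 4^-1 * 2 ^- M.
have y_gt0 : 0 < y by rewrite mulr_gt0 // invr_gt0 exprn_gt0.
have p1 : 2 ^- M <= 1 :> R by rewrite invf_le1 ?exprn_gt0 // exprn_ege1 // ler1n.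
have y_lt1 : y < 1 by rewrite /y; lra.
pose lw w : R := (M < level K w)%:R.
have hw w : \sum_r H w r <=
    expR y * ((W ^ L)%N%:R * (2 ^+ (K - M) * (1 - 2^-1 * lw w))).
  rewrite -mulr_sumr; apply: ler_pM; rewrite ?expR_ge0 //.
  - by apply: sumr_ge0 => r _; exact: expR_ge0.
  - rewrite ler_expR; apply: le_trans (_ : 8^-1 * (2 * 2 ^- M) <= _); last first.
      by rewrite /y; lra.
    rewrite ler_pM2l ?invr_gt0 //; apply: le_trans (sum_half_pow _) _.
    rewrite ler_pM2l // lef_pV2 ?posrE ?exprn_gt0 //.
    by rewrite ler_eXn2l ?ltr1n // leq_maxl.
  apply: le_trans (IH _ uvs _) _; first by rewrite geq_max (ltnW MK) level_le.
  rewrite ler_wpM2l ?ler0n // /lw; case: ltnP => h.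
    rewrite mulr1 (_ : 1 - 2^-1 = 2^-1) ?ler_pdivlMr //; last by lra.
    rewrite -exprSr ler_eXn2l ?ltr1n //; have := level_le K w; lia.
  by rewrite mulr0 subr0 mulr1.
apply: le_trans (ler_sum _ (fun w _ => hw w)) _.
rewrite -!mulr_sumr mulrCA [leRHS]mulrCA; apply: ler_wpM2l; first by rewrite ler0n.
rewrite mulrCA [leRHS]mulrC; apply: ler_wpM2l; first by rewrite exprn_ge0.
rewrite sumrB sumr_const card_ord -mulr_sumr.
have -> : \sum_w lw w = W%:R * (2^-1 * 2 ^- M).
  rewrite /lw -natr_sum sum_level // -invfM -exprS.
  have -> : W%:R = (2 ^ (b - M.+1))%N%:R * 2 ^+ M.+1 :> R.
    by rewrite -natrX -natrM -expnD subnK // (leq_trans MK).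
  by rewrite mulfK // expf_neq0.
rewrite -[_ *+ W]mulr_natl mulr1.
have -> : W%:R - 2^-1 * (W%:R * (2^-1 * 2 ^- M)) = (1 - y) * W%:R :> R.
  by rewrite /y; field; rewrite expf_neq0.
rewrite mulrA ler_piMl ?ler0n // -ler_pdivlMr ?subr_gt0 // mul1r.
exact: expR_le_inv.
Qed.

(** [2 ^ l] is at most the sum of [2 ^ i] over [i <= l], and a level of at least [i] has probability
    [2 ^- i]: each of the [K.+1] values of [i] contributes [W]. *)
Lemma sum_pow_level : (\sum_(w < W) 2 ^ level K w <= K.+1 * W)%N.
Proof.
apply: (@leq_trans (\sum_(w < W) \sum_(i < K.+1) 2 ^ i * (i <= level K w))).
  apply: leq_sum => w _.
  have h : (level K w < K.+1)%N by rewrite ltnS level_le.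
  by rewrite (bigD1 (Ordinal h)) //= leqnn muln1 leq_addr.
rewrite exchange_big /= -[K.+1 in leqRHS]card_ord -sum_nat_const.
apply: leq_sum => i _; rewrite -big_distrr /=.
have iK : (i <= K)%N by rewrite -ltnS.
by rewrite sum_level // -expnD subnKC // (leq_trans iK).
Qed.

Definition work r : nat := (\sum_(v < n) 2 ^ vlev r v)%N.

(** Vertices are peeled off one at a time by [resample]. The scaling by [2 ^+ K.+1] keeps each
    exponent, written [z / 2], at most one half, where [expR (z / 2) <= 1 + z]; hence only the
    expectation of 2^level enters. *)
Lemma mgf_work : \sum_(r : tapes) expR ((work r)%:R / 2 ^+ K.+1) <=
  (W ^ L)%N%:R * (1 + K.+1%:R / 2 ^+ K) ^+ n :> R.
Proof.
pose c : R := 1 + K.+1%:R / 2 ^+ K.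
have c_ge0 : 0 <= c by rewrite addr_ge0 // divr_ge0 ?exprn_ge0.
suff h vs : uniq vs -> \sum_(r : tapes) expR
    ((\sum_(v <- vs) 2 ^ vlev r v)%N%:R / 2 ^+ K.+1) <= (W ^ L)%N%:R * c ^+ size vs.
  have := h (index_enum 'I_n) (index_enum_uniq _).
  suff -> : size (index_enum 'I_n) = n by [].
  by rewrite -[RHS]card_ord cardT enumT.
elim: vs => [|v vs IH] /=.
  move=> _; under eq_bigr => r _ do rewrite big_nil mul0r expR0.
  by rewrite sum_tapes.
move=> /andP[vvs /IH {}IH].
pose H w r : R := expR ((2 ^ level K w)%N%:R / 2 ^+ K.+1) *
  expR ((\sum_(v <- vs) 2 ^ vlev r v)%N%:R / 2 ^+ K.+1).
have W0 : 0 < W%:R :> R by rewrite ltr0n expn_gt0.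
rewrite -(ler_pM2l W0).
rewrite (eq_bigr (fun r => H (tnth r (slot v)) r)) => [|r _]; last first.
  by rewrite /H -expRD -mulrDl -natrD big_cons.
rewrite resample => [|w w' r]; last first.
  rewrite /H; suff -> : (\sum_(u <- vs) 2 ^ vlev (reset r (slot v) w') u =
      \sum_(u <- vs) 2 ^ vlev r u)%N by [].
  rewrite !big_seq; apply: eq_bigr => u uvs; rewrite vlev_reset //.
  by apply: contraNneq vvs => <-.
under eq_bigr do rewrite -mulr_sumr.
rewrite -mulr_suml.
have hS : \sum_(w < W) expR ((2 ^ level K w)%N%:R / 2 ^+ K.+1) <= W%:R * c.
  apply: le_trans (_ : \sum_(w < W) (1 + (2 ^ level K w)%N%:R / 2 ^+ K) <= _).
    apply: ler_sum => w _.
    set z : R := (2 ^ level K w)%N%:R / 2 ^+ K.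
    have z0 : 0 <= z by rewrite divr_ge0 ?exprn_ge0.
    have z1 : z <= 1.
      by rewrite ler_pdivrMr ?exprn_gt0 // mul1r natrX ler_eXn2l ?ltr1n // level_le.
    have -> : (2 ^ level K w)%N%:R / 2 ^+ K.+1 = 2^-1 * z.
      by rewrite exprS invfM mulrCA.
    apply: le_trans (expR_le_inv _) _; first by lra.
    rewrite -div1r ler_pdivrMr; last by lra.
    by nra.
  rewrite big_split /= sumr_const card_ord -mulr_suml -natr_sum /c mulrDr.
  rewrite mulr1 lerD2l mulrA ler_wpM2r ?invr_ge0 ?exprn_ge0 //.
  by rewrite -natrM ler_nat mulnC sum_pow_level.
have -> : W%:R * ((W ^ L)%N%:R * c ^+ (size vs).+1) =
   W%:R * c * ((W ^ L)%N%:R * c ^+ size vs) by rewrite exprS; ring.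
apply: ler_pM => //; apply: sumr_ge0 => w _; exact: expR_ge0.
Qed.

Lemma markov_tapes (f : tapes -> R) (x : R) :
  #|[set r : tapes | x < f r]|%:R <= expR (- x) * \sum_(r : tapes) expR (f r).
Proof.
rewrite expRN ler_pdivlMl ?expR_gt0 //.
rewrite [leRHS](bigID (fun r => x < f r)) /=; apply: ler_wpDr.
  by apply: sumr_ge0 => r _; exact: expR_ge0.
apply: le_trans (_ : \sum_(r | x < f r) expR x <= _); last first.
  by apply: ler_sum => r h; rewrite ler_expR ltW.
by rewrite sumr_const mulr_natr cardsE.
Qed.

Lemma expRN_nat_le (k : nat) : expR (- k%:R) <= 2 ^- k :> R.
Proof.
rewrite expRN lef_pV2 ?posrE ?exprn_gt0 ?expR_gt0 //.
rewrite -[k%:R]mulr1 expRM_natl lerXn2r ?nnegrE ?expR_ge0 //.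
by have := expR_ge1Dx (1 : R); rewrite (_ : 1 + 1 = 2).
Qed.

(** * Union bound over the bad events *)

Variables (g : nat) (I : finType) (vsf : I -> seq 'I_n).
Hypothesis vsf_uniq : forall i, uniq (vsf i).
Hypothesis K_gt0 : (0 < K)%N.
Hypothesis nK : (n <= 2 ^ K)%N.

(** The thresholds fit the exponential moments. At rate [8^-1], [8 * g * K] leaves a tail of
    [2 ^+ K * 2 ^- (g * K)]. The bound on [work] is [(g + 2) * K] after scaling, and its excess over
    [g * K] absorbs the moment [expR K.+1]. *)
Definition good r : Prop :=
  (work r <= (2 * g + 4) * (2 ^ K * K))%N /\
  forall i, gap_cost (vlev r) 0 (vsf i) <= (8 * g * K)%:R /\
            gap_cost (vlev r) 0 (rev (vsf i)) <= (8 * g * K)%:R.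

Lemma bad_gap vs : uniq vs ->
  #|[set r : tapes | (8 * g * K)%:R < gap_cost (vlev r) 0 vs]|%:R <=
    (W ^ L)%N%:R * (2 ^+ K * 2 ^- (g * K)) :> R.
Proof.
move=> uvs.
have -> : [set r : tapes | (8 * g * K)%:R < gap_cost (vlev r) 0 vs] =
    [set r : tapes | (g * K)%:R < 8^-1 * gap_cost (vlev r) 0 vs].
  apply/setP => r; rewrite !inE ltr_pdivlMl // -natrM mulnA //.
apply: le_trans (markov_tapes _ _) _.
rewrite mulrA [leRHS]mulrC; apply: ler_pM (expR_ge0 _) _ (expRN_nat_le _) _.
  by apply: sumr_ge0 => r _; exact: expR_ge0.
by have := mgf_gap_cost uvs (leq0n K); rewrite subn0.
Qed.

Lemma bad_work :
  #|[set r : tapes | ((2 * g + 4) * (2 ^ K * K) < work r)%N]|%:R <=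
    (W ^ L)%N%:R * 2 ^- (g * K) :> R.
Proof.
have -> : [set r : tapes | ((2 * g + 4) * (2 ^ K * K) < work r)%N] =
    [set r : tapes | ((g + 2) * K)%:R < (work r)%:R / 2 ^+ K.+1 :> R].
  apply/setP => r; rewrite !inE ltr_pdivlMr ?exprn_gt0 // -natrX -natrM ltr_nat.
  congr (_ < _)%N; rewrite expnS; ring.
apply: le_trans (markov_tapes _ _) _.
apply: le_trans (ler_wpM2l (expR_ge0 _) mgf_work) _.
rewrite mulrCA; apply: ler_wpM2l; first by rewrite ler0n.
have h : (1 + K.+1%:R / 2 ^+ K) ^+ n <= expR (K.+1%:R : R).
  apply: le_trans (_ : expR (K.+1%:R / 2 ^+ K) ^+ n <= _).
    by rewrite lerXn2r ?nnegrE ?expR_ge0 ?expR_ge1Dx // addr_ge0 // divr_ge0 ?exprn_ge0.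
  rewrite -expRM_natl ler_expR mulrCA ler_piMr //.
  by rewrite ler_pdivrMr ?exprn_gt0 // mul1r -natrX ler_nat.
apply: le_trans (ler_wpM2l (expR_ge0 _) h) _.
rewrite -expRD; apply: le_trans (expRN_nat_le _); rewrite ler_expR.
have : (g * K + K.+1 <= (g + 2) * K)%N by nia.
rewrite -(ler_nat R) natrD; lra.
Qed.

Lemma prob_good :
  1 - (2 * #|I|%:R * 2 ^+ K + 1) * 2 ^- (g * K) <= tape_prob R good.
Proof.
rewrite /tape_prob.
have -> : #|{: tapes}| = (W ^ L)%N by rewrite card_tuple card_ord.
have WL0 : 0 < (W ^ L)%N%:R :> R by rewrite ltr0n expn_gt0 expn_gt0.
rewrite ler_pdivlMr // mulrBl mul1r lerBlDr.
set G := [set r : tapes | `[< good r >]].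
set B0 := [set r : tapes | ((2 * g + 4) * (2 ^ K * K) < work r)%N].
pose B1 i := [set r : tapes | (8 * g * K)%:R < gap_cost (vlev r) 0 (vsf i)].
pose B2 i := [set r : tapes | (8 * g * K)%:R < gap_cost (vlev r) 0 (rev (vsf i))].
have cov : [set: tapes] \subset G :|: (B0 :|: \bigcup_i (B1 i :|: B2 i)).
  apply/fintype.subsetP => r _; rewrite !inE.
  have [//|/= nG] := boolP (`[< good r >]).
  have [//|/= nB0] := ltnP _ (work r).
  apply/bigcupP; apply: contrapT => hno; move/asboolPn: nG; apply; split=> // i.
  have nB x : (x \in B1 i :|: B2 i) -> x <> r.
    by move=> hx xr; apply: hno; exists i => //; rewrite -xr.
  split; rewrite leNgt; apply/negP => h; apply: (nB r) => //;
    by rewrite !inE h ?orbT.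
have := subset_leq_card cov; rewrite cardsT card_tuple card_ord.
move=> /leq_trans /(_ (leq_card_setU _ _)) hc.
have hc2 : (W ^ L <= #|G| + (#|B0| + \sum_i (#|B1 i| + #|B2 i|)))%N.
  apply: leq_trans hc _; rewrite leq_add2l.
  apply: leq_trans (leq_card_setU _ _) _; rewrite leq_add2l.
  apply: (@leq_trans (\sum_i #|B1 i :|: B2 i|)).
    by apply: (big_ind2 (fun (A : {set tapes}) k => (#|A| <= k)%N)) => //;
      [rewrite cards0 | move=> A1 k1 A2 k2 h1 h2;
       exact: leq_trans (leq_card_setU _ _) (leq_add h1 h2)].
  by apply: leq_sum => i _; exact: leq_card_setU.
move: hc2; rewrite -(ler_nat R) natrD natrD natr_sum => hc2.
apply: le_trans hc2 _; rewrite lerD2l.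
apply: le_trans (_ : (W ^ L)%N%:R * 2 ^- (g * K) +
   \sum_(i : I) ((W ^ L)%N%:R * (2 ^+ K * 2 ^- (g * K)) +
                 (W ^ L)%N%:R * (2 ^+ K * 2 ^- (g * K))) <= _).
  apply: lerD; first exact: bad_work.
  apply: ler_sum => i _; rewrite natrD; apply: lerD; apply: bad_gap => //.
  by rewrite rev_uniq.
rewrite sumr_const -[_ *+ #|_|]mulr_natl le_eqVlt; apply/orP; left; apply/eqP.
ring.
Qed.

End Probability.

(** * One run of the dynamic program *)

Declare Scope prog_scope.
Notation "a '+w' b" := (WOp Wadd a b) (at level 50, left associativity) : prog_scope.
Notation "a '-w' b" := (WOp Wsub a b) (at level 50, left associativity) : prog_scope.
Notation "a '*w' b" := (WOp Wmul a b) (at level 40, left associativity) : prog_scope.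
Notation "a '/w' b" := (WOp Wdiv a b) (at level 40, left associativity) : prog_scope.
Notation "a '%w' b" := (WOp Wmod a b) (at level 40, left associativity) : prog_scope.
Notation "a '+r' b" := (ROp Radd a b) (at level 50, left associativity) : prog_scope.
Notation "a '*r' b" := (ROp Rmul a b) (at level 40, left associativity) : prog_scope.
Notation "a '/r' b" := (ROp Rdiv a b) (at level 40, left associativity) : prog_scope.
Notation "c1 ';;' c2" := (Seq c1 c2) (at level 90, right associativity) : prog_scope.
Local Open Scope prog_scope.

(* Word registers: xN = n, xM = m, xK = ceil(log2 n), xP = 2^xK, xE = the slack
   E (in units of delay), xQ = the number of budgets, xNS = the number of scales,
   xS = the sum of 2^level, xK1 = xK + 1, xp = 2^level, xNB = the number of rows
   of the dynamic program; the other ones are loop counters (xk for scales, xj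
   for levels, xs and xt for vertices, xb for rows, xe for edges, xq for budgets)
   and temporary values.  Registers 0 and 1 are left to the queries. *)
Local Notation xN := 2%N (only parsing).
Local Notation xM := 3%N (only parsing).
Local Notation xK := 4%N (only parsing).
Local Notation xP := 5%N (only parsing).
Local Notation xE := 6%N (only parsing).
Local Notation xQ := 7%N (only parsing).
Local Notation xNS := 8%N (only parsing).
Local Notation xS := 9%N (only parsing).
Local Notation xK1 := 10%N (only parsing).
Local Notation xk := 11%N (only parsing).
Local Notation xj := 12%N (only parsing).
Local Notation xp := 13%N (only parsing).
Local Notation xs := 14%N (only parsing).
Local Notation xb := 15%N (only parsing).
Local Notation xNB := 16%N (only parsing).
Local Notation xt := 17%N (only parsing).
Local Notation xe := 18%N (only parsing).
Local Notation xy := 19%N (only parsing).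
Local Notation xw := 20%N (only parsing).
Local Notation xq := 21%N (only parsing).
Local Notation xz := 22%N (only parsing).
Local Notation xr := 23%N (only parsing).

(* Real registers: clipped eps, the value that stands for infinity, the scale of
   delays, the current unit of delay, a candidate length. *)
Local Notation yeps := 3%N (only parsing).
Local Notation yinf := 4%N (only parsing).
Local Notation ydel := 5%N (only parsing).
Local Notation yu := 6%N (only parsing).
Local Notation yc := 7%N (only parsing).

(* Real arrays: the table, the rows of the dynamic program, the unit of delay of
   each scale.  Word arrays: 2^level and binary logarithms. *)
Local Notation aT := 2%N (only parsing).
Local Notation aD := 3%N (only parsing).
Local Notation aU := 4%N (only parsing).
Local Notation apw := 2%N (only parsing).
Local Notation alg := 3%N (only parsing).

Definition row_exp (a b : wexp) : wexp := a *w WVar xN +w b.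
Definition Tix (q s t : wexp) : wexp :=
  row_exp (row_exp (WVar xk *w WVar xQ +w q) s) t.
(** A backward run is the same program on the transposed table with tails and heads exchanged, so
    that one specification over [gdir d G] covers both directions. *)
Definition Tixd (d : bool) (q s t : wexp) : wexp :=
  if d then Tix q s t else Tix q t s.

Definition tl_arr (d : bool) : nat := if d then 0 else 1.
Definition hd_arr (d : bool) : nat := if d then 1 else 0.

Definition relax_then (d : bool) : cmd :=
  RSet yc (RLoad aD (row_exp (WVar xb -w WVar xw -w WLit 1)
                             (WLoad (tl_arr d) (WVar xe)))
           +r RLoad 0 (WVar xe)) ;;
  WSet xy (row_exp (WVar xb) (WLoad (hd_arr d) (WVar xe))) ;;
  If (BRle (RLoad aD (WVar xy)) (RVar yc)) Skip (RStore aD (WVar xy) (RVar yc)).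

Definition relax (d : bool) : cmd :=
  Floor xw (RLoad 1 (WVar xe) /r RVar yu) ;;
  If (BNot (BWle (WVar xb) (WVar xw))) (relax_then d) Skip.

Definition fill_row (d : bool) : cmd :=
  RStore aD (row_exp (WVar xb) (WVar xt))
    (RLoad aT (Tixd d (WVar xb /w WVar xp) (WVar xs) (WVar xt))).

Definition write_back (d : bool) : cmd :=
  RStore aT (Tixd d (WVar xq) (WVar xs) (WVar xt))
    (RLoad aD (row_exp (WVar xq *w WVar xp) (WVar xt))).

(** A relaxation reads strictly earlier rows only; one pass over the edges, in any order, completes
    a row. *)
Definition run (d : bool) : cmd :=
  For xb xNB (For xt xN (fill_row d) ;; For xe xM (relax d)) ;;
  For xq xQ (For xt xN (write_back d)).

Definition tix (Q1 n k q s t : nat) : nat := (((k * Q1 + q) * n + s) * n + t)%N.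

Lemma lt_row (q n m t : nat) : (q < m -> t < n -> q * n + t < m * n)%N.
Proof. by move=> h1 h2; nia. Qed.

Lemma row_inj (q n q' t t' : nat) : (t < n -> t' < n ->
  q * n + t = q' * n + t' -> q = q' /\ t = t')%N.
Proof.
move=> h1 h2 e.
have n0 : (0 < n)%N by lia.
have e1 := congr1 (divn^~ n) e; have e2 := congr1 (modn^~ n) e.
rewrite /= !divnMDl // !divn_small // !addn0 in e1.
by rewrite /= !modnMDl !modn_small // in e2.
Qed.

Lemma tix_inj Q1 n k q s t k' q' s' t' :
  (q < Q1 -> s < n -> t < n -> q' < Q1 -> s' < n -> t' < n ->
   tix Q1 n k q s t = tix Q1 n k' q' s' t' ->
   [/\ k = k', q = q', s = s' & t = t'])%N.
Proof.
move=> h1 h2 h3 h1' h2' h3'; rewrite /tix.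
by move=> /row_inj [] // /row_inj [] // /row_inj [] // -> -> -> ->.
Qed.

Section Run.
Context {R : realType} {n : nat} (G : digraph R n) (W Q1 NS : nat).
Local Notation m := (nedges G).
Hypothesis nW : (n < W)%N.
Hypothesis mW : (m < W)%N.
Hypothesis QW : (Q1 < W)%N.
Hypothesis TW : (NS * Q1 * n * n <= W)%N.
Implicit Types st : state R.

Definition env st : Prop :=
  [/\ [/\ wreg st xN = n, wreg st xM = m & wreg st xQ = Q1],
      forall e : 'I_m, wmem st 0 e = (ends e).1 /\ wmem st 1 e = (ends e).2 &
      forall e : 'I_m, rmem st 0 e = elen e /\ rmem st 1 e = edel e].

Lemma env_frame c st st' : frame c st st' ->
  all (fun x => x \notin wmod c) [:: xN; xM; xQ] ->
  all (fun x => (x \notin wamod c) && (x \notin ramod c)) [:: 0; 1]%N ->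
  env st -> env st'.
Proof.
move=> [f1 f2 f3 f4] /and4P[h1 h2 h3 _] /and3P[/andP[g1 g2] /andP[g3 g4] _].
by move=> [[e1 e2 e3] e4 e5]; split; [rewrite !f1|rewrite !f3|rewrite !f4].
Qed.

(** Indices are tracked modulo [W]: intermediate values may wrap, and only the final index has to be
    below [W]. *)
Lemma weval_row st (e1 e2 : wexp) (a b : nat) : wreg st xN = n ->
  weval W st e1 = (a %% W)%N -> weval W st e2 = (b %% W)%N ->
  weval W st (row_exp e1 e2) = ((a * n + b) %% W)%N.
Proof. by move=> /= -> -> ->; rewrite modnMml modnDm. Qed.

Lemma weval_row_small st (e1 e2 : wexp) (a b : nat) : wreg st xN = n ->
  weval W st e1 = a -> weval W st e2 = b -> (a < W)%N -> (b < W)%N ->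
  (a * n + b < W)%N -> weval W st (row_exp e1 e2) = (a * n + b)%N.
Proof.
move=> hn h1 h2 ha hb hab.
by rewrite (@weval_row _ _ _ a b) // ?modn_small // ?h1 ?h2 // modn_small.
Qed.

Lemma tix_lt k q s t : (k < NS -> q < Q1 -> s < n -> t < n ->
  tix Q1 n k q s t < W)%N.
Proof.
move=> hk hq hs ht; apply: leq_trans TW; do 3!apply: lt_row => //.
Qed.

Lemma weval_Tixd st d (e1 e2 e3 : wexp) (k q s t : nat) :
  wreg st xN = n -> wreg st xQ = Q1 -> wreg st xk = k ->
  weval W st e1 = q -> weval W st e2 = s -> weval W st e3 = t ->
  (k < NS -> q < Q1 -> s < n -> t < n ->
   weval W st (Tixd d e1 e2 e3) =
   if d then tix Q1 n k q s t else tix Q1 n k q t s)%N.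
Proof.
move=> hn hQ hk h1 h2 h3 kN qQ sn tn.
have sm x : (x < n)%N -> (x %% W)%N = x.
  by move=> xn; rewrite modn_small // (ltn_trans xn nW).
have key (e e' : wexp) x y : weval W st e = x -> weval W st e' = y ->
    (x < n)%N -> (y < n)%N -> weval W st (Tix e1 e e') = tix Q1 n k q x y.
  move=> he he' hx hy.
  rewrite -[RHS](modn_small (tix_lt kN qQ hx hy)).
  apply: weval_row; rewrite ?he' ?(sm y hy) //.
  apply: weval_row; rewrite ?he ?(sm x hx) //=.
  by rewrite hk hQ h1 modnDml.
by case: d; apply: key.
Qed.

Definition Tval st k q (x y : 'I_n) : R := rmem st aT (tix Q1 n k q x y).
Definition Aval st b (t : 'I_n) : R := rmem st aD (b * n + t)%N.

Definition dirT (d : bool) (T : nat -> 'I_n -> 'I_n -> R) q s t : R :=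
  if d then T q s t else T q t s.

Lemma dp_ok_step d N pp (w : 'I_m -> nat) T0 A A' :
  dp_ok (G := gdir d G) N pp w T0 A ->
  (forall b t, (b < N)%N -> A' b t = A b t) ->
  (forall t, [/\ A' N t = T0 (N %/ pp)%N t \/ exists e : 'I_m,
        [/\ (@ends R n (gdir d G) e).2 = t, (w e < N)%N &
            A' N t = A' (N - w e).-1 (@ends R n (gdir d G) e).1 + elen e],
      A' N t <= T0 (N %/ pp)%N t &
      forall e : 'I_m, (@ends R n (gdir d G) e).2 = t -> (w e < N)%N ->
        A' N t <= A' (N - w e).-1 (@ends R n (gdir d G) e).1 + elen e]) ->
  dp_ok (G := gdir d G) N.+1 pp w T0 A'.
Proof.
move=> hA AA hN b t; rewrite ltnS leq_eqVlt => /orP[/eqP -> //|bN].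
have [h1 h2 h3] := hA b t bN.
have lt e : (w e < b)%N -> ((b - w e).-1 < N)%N by lia.
split; rewrite ?AA //.
- case: h1 => [->|[e [et we he]]]; [by left|right; exists e; split=> //].
  by rewrite AA // lt.
- by move=> e et we; rewrite AA ?lt //; exact: h3.
Qed.

Section Spec.
Variables (d : bool) (k NB pp : nat) (s : 'I_n) (u : R).
Hypothesis kNS : (k < NS)%N.
Hypothesis pp_gt0 : (0 < pp)%N.
Hypothesis NBE : NB = (Q1.-1 * pp).+1.
Hypothesis Q1_gt0 : (0 < Q1)%N.
Hypothesis NBW : (NB * n <= W)%N.
Hypothesis NBW1 : (NB < W)%N.

(** The cap is that of [Floor]. It hides no delay: rows are below [W], so a capped edge fails the
    test [rounded_delay e < b]. *)
Definition rounded_delay (e : 'I_m) : nat := minn (Num.truncn (edel e / u)) W.-1.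

Definition run_env st : Prop :=
  [/\ env st, [/\ wreg st xk = k, wreg st xNB = NB & wreg st xp = pp],
      wreg st xs = s & rreg st yu = u].

Lemma run_env_frame c st st' : frame c st st' ->
  all (fun x => x \notin wmod c) [:: xN; xM; xQ; xk; xNB; xp; xs] ->
  yu \notin rmod c ->
  all (fun x => (x \notin wamod c) && (x \notin ramod c)) [:: 0; 1]%N ->
  run_env st -> run_env st'.
Proof.
move=> f h1 h2 h3 [e [e1 e2 e3] e4 e5].
have [f1 f2 f3 f4] := f; split.
- apply: (env_frame f) => //; move: h1 => /=.
  by case/and5P=> -> -> ->.
- case/and5P: h1 => _ _ _ g1 /and4P[g2 g3 g4 _].
  by rewrite !f1.
- case/and5P: h1 => _ _ _ g1 /and4P[g2 g3 g4 _].
  by rewrite !f1.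
- by rewrite f2.
Qed.

Lemma div_lt_Q1 b : (b < NB)%N -> (b %/ pp < Q1)%N.
Proof. by rewrite NBE ltnS => h; rewrite ltn_divLR //; nia. Qed.

Definition row_init st0 b st : Prop :=
  forall b' (t : 'I_n), (b' < b)%N -> Aval st b' t = Aval st0 b' t.

Lemma fill_spec st b : run_env st -> (b < NB)%N -> wreg st xb = b ->
  wp W (For xt xN (fill_row d)) (n * (60 + 10) + 8)
    (fun st' => (forall t : 'I_n,
       Aval st' b t = dirT d (Tval st k) (b %/ pp) s t) /\ row_init st b st') st.
Proof.
move=> he bNB hb.
pose I (i : nat) st' := (forall t : 'I_n, (t < i)%N ->
       Aval st' b t = dirT d (Tval st k) (b %/ pp) s t) /\ row_init st b st'.
have [[[eN _ _] _ _] _ _ _] := he.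
apply: (wp_weaken (T := (n * (60 + 10) + 8)%N) (Post := I n)) => //; last first.
  by move=> st' [h1 h2]; split=> // t; exact: h1.
apply: wp_for_const => //; try by case: (d).
move=> i st1 ni f1 xi [I1 I2].
have he1 : run_env st1 by apply: (run_env_frame f1) => //; case: (d).
apply: (wp_weaken (T := max_time (fill_row d))
   (Post := fun st' => frame (fill_row d) st1 st' -> I i.+1 (set_wreg st' xt i.+1))) => //; try by case: (d).
apply: wp_den; first by case: (d).
move=> _.
have [[[eN1 eM1 eQ1] _ _] [ek eNB ep] es _] := he1.
have hb1 : wreg st1 xb = b by case: f1 => ->.
have T1 : rmem st1 aT = rmem st aT by case: f1 => _ _ _ -> //; case: (d).
have hix : weval W st1 (row_exp (WVar xb) (WVar xt)) = (b * n + i)%N.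
  apply: weval_row_small => //; [exact: ltn_trans NBW1|exact: ltn_trans nW|].
  by apply: leq_trans NBW; apply: lt_row.
have hTix : weval W st1 (Tixd d (WVar xb /w WVar xp) (WVar xs) (WVar xt)) =
   if d then tix Q1 n k (b %/ pp) s i else tix Q1 n k (b %/ pp) i s.
  by apply: weval_Tixd; rewrite //= ?hb1 ?ep //; exact: div_lt_Q1.
rewrite /I /fill_row /den [reval _ _ _]/= hix hTix T1.
split.
  move=> t; rewrite ltnS leq_eqVlt => /orP[/eqP ti|ti].
    by rewrite /Aval /= /upd2 /upd /= -ti eqxx /dirT /Tval; case: (d).
  rewrite /Aval /= /upd2 /upd /= eqn_add2l ltn_eqF //; exact: I1.
move=> b' t b'b; rewrite -(I2 _ _ b'b) /Aval /= /upd2 /upd /= ltn_eqF //.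
have tn := ltn_ord t; nia.
Qed.

Definition tlv (e : 'I_m) := (@ends R n (gdir d G) e).1.
Definition hdv (e : 'I_m) := (@ends R n (gdir d G) e).2.

(** The state after the first [i] edges. Candidates are taken from [st0], as the rows below [b] no
    longer change. *)
Definition row_ok st0 b (i : nat) st : Prop :=
  row_init st0 b st /\
  forall t, [/\ Aval st b t = dirT d (Tval st0 k) (b %/ pp) s t \/
        exists e : 'I_m, [/\ hdv e = t, (rounded_delay e < b)%N &
            Aval st b t = Aval st0 (b - rounded_delay e).-1 (tlv e) + elen e],
      Aval st b t <= dirT d (Tval st0 k) (b %/ pp) s t &
      forall e : 'I_m, (e < i)%N -> hdv e = t -> (rounded_delay e < b)%N ->
        Aval st b t <= Aval st0 (b - rounded_delay e).-1 (tlv e) + elen e].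

Lemma relax_spec st0 st b : run_env st -> (b < NB)%N -> wreg st xb = b ->
  row_ok st0 b 0 st ->
  wp W (For xe xM (relax d)) (m * (100 + 10) + 8) (row_ok st0 b m) st.
Proof.
move=> he bNB hb I0.
have [[[_ eM _] _ _] _ _ _] := he.
apply: wp_for_const => //; try by case: (d).
move=> i st1 im f1 xi [J1 J2].
have he1 : run_env st1 by apply: (run_env_frame f1) => //; case: (d).
apply: (wp_weaken (T := max_time (relax d))
   (Post := fun st' => frame (relax d) st1 st' -> row_ok st0 b i.+1 (set_wreg st' xe i.+1))) => //; try by case: (d).
apply: wp_den; first by case: (d).
move=> _.
pose e := Ordinal im.
have [[[eN1 eM1 eQ1] hends hlen] [ek eNB ep] es eu] := he1.
have hb1 : wreg st1 xb = b by case: f1 => ->.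
have htl : wmem st1 (tl_arr d) i = tlv e.
  by have [h1 h2] := hends e; rewrite /tlv /tl_arr /=; case: (d).
have hhd : wmem st1 (hd_arr d) i = hdv e.
  by have [h1 h2] := hends e; rewrite /hdv /hd_arr /=; case: (d).
have [hl hd] := hlen e; rewrite /= in hl hd.
pose st2 := set_wreg st1 xw (rounded_delay e).
have st2E : st2 = den W (Floor xw (RLoad 1 (WVar xe) /r RVar yu)) st1.
  by rewrite /st2 /rounded_delay /= xi hd eu.
have hcond : beval W st2 (BNot (BWle (WVar xb) (WVar xw))) = (rounded_delay e < b)%N.
  by rewrite /= /upd /= hb1 ltnNge.
have -> : den W (relax d) st1 = if (rounded_delay e < b)%N then den W (relax_then d) st2 else st2.
  by rewrite -hcond st2E.
case: ifPn => wb; last first.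
  split; first exact: J1.
  move=> t; have [h1 h2 h3] := J2 t; split=> // e' ; rewrite ltnS leq_eqVlt.
  move=> /orP[/eqP ee|]; last exact: h3.
  have -> : e' = e by apply: val_inj.
  by move=> _ h; rewrite h in wb.
have W1 : (1 < W)%N by have := ltn_ord s; lia.
have bW : (b < W)%N by apply: ltn_trans NBW1.
have rowlt b' (t : 'I_n) : (b' <= b)%N -> (b' * n + t < W)%N.
  by move=> h; apply: leq_trans NBW; apply: lt_row => //; apply: leq_ltn_trans bNB.
have hc : weval W st2 (row_exp (WVar xb -w WVar xw -w WLit 1)
               (WLoad (tl_arr d) (WVar xe))) = ((b - rounded_delay e).-1 * n + tlv e)%N.
  apply: weval_row_small => //=.
  - by rewrite /upd /= hb1 modn_small // subn1.
  - by rewrite /upd /= xi htl.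
  - lia.
  - exact: ltn_trans nW.
  - by apply: rowlt; lia.
set c := Aval st0 (b - rounded_delay e).-1 (tlv e) + elen e.
have hcE : rmem st1 aD ((b - rounded_delay e).-1 * n + tlv e)%N + rmem st1 0 i = c.
  rewrite hl /c; congr (_ + _); apply: J1; lia.
have hy : weval W (set_rreg st2 yc c) (row_exp (WVar xb) (WLoad (hd_arr d) (WVar xe))) =
    (b * n + hdv e)%N.
  apply: weval_row_small => //=.
  - by rewrite /upd /= xi hhd.
  - exact: ltn_trans nW.
  - exact: rowlt.
pose st4 := set_wreg (set_rreg st2 yc c) xy (b * n + hdv e)%N.
have -> : den W (relax_then d) st2 = if Aval st1 b (hdv e) <= c then st4
    else set_rmem st4 aD (b * n + hdv e)%N c.
  have cE : reval W st2 (RLoad aD (row_exp (WVar xb -w WVar xw -w WLit 1)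
      (WLoad (tl_arr d) (WVar xe))) +r RLoad 0 (WVar xe)) = c.
    by rewrite -hcE -hc -[X in rmem st1 0 X]xi.
  by rewrite /relax_then; cbn [den]; rewrite cE hy.
have [hle|hlt] := leP (Aval st1 b (hdv e)) c.
  split; first exact: J1.
  move=> t; have [h1 h2 h3] := J2 t; split=> // e' ; rewrite ltnS leq_eqVlt.
  move=> /orP[/eqP ee|]; last exact: h3.
  have -> : e' = e by apply: val_inj.
  by move=> <- _.
set st3 := set_wreg _ _ _.
have A3 b' (t : 'I_n) : Aval st3 b' t =
   if (b' == b) && (t == hdv e) then c else Aval st1 b' t.
  rewrite /Aval /st3 /= /upd2 /upd /=.
  case: eqP => [/row_inj [] // -> /val_inj ->|ne]; first by rewrite !eqxx.
  by case: andP => // -[/eqP bb /eqP tt]; case: ne; rewrite bb tt.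
split.
  move=> b' t b'b; rewrite A3 ltn_eqF //=; exact: J1.
move=> t; have [h1 h2 h3] := J2 t; rewrite A3 eqxx /=.
have [te|tne] := eqVneq t (hdv e).
  rewrite te in h1 h2 h3 *; split.
  - by right; exists e.
  - exact: le_trans (ltW hlt) h2.
  - move=> e'; rewrite ltnS leq_eqVlt => /orP[/eqP ee _ _|e'i h h'].
      by have -> : e' = e by apply: val_inj.
    exact: le_trans (ltW hlt) (h3 _ e'i h h').
split=> // e'; rewrite ltnS leq_eqVlt => /orP[/eqP ee|]; last exact: h3.
have -> : e' = e by apply: val_inj.
by move=> h; rewrite h eqxx in tne.
Qed.

Lemma dp_spec st : run_env st ->
  wp W (For xb xNB (For xt xN (fill_row d) ;; For xe xM (relax d)))
   (NB * (((n * 70 + 8) + (m * 110 + 8)).+1 + 10) + 8)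
   (fun st' => dp_ok (G := gdir d G) NB pp rounded_delay
      (fun h x => dirT d (Tval st k) h s x) (Aval st')) st.
Proof.
move=> he; have [_ [_ eNB _] _ _] := he.
apply: (wp_for_const (I := fun b st' => dp_ok (G := gdir d G) b pp rounded_delay
      (fun h x => dirT d (Tval st k) h s x) (Aval st'))) => //; try by case: (d).
move=> b st1 bNB f1 hb hdp.
have he1 : run_env st1 by apply: (run_env_frame f1) => //; case: (d).
have T1 : Tval st1 = Tval st.
  by rewrite /Tval; case: f1 => _ _ _ -> //; case: (d).
apply: wp_seq; apply: wp_weaken (fill_spec he1 bNB hb) _ _; first by lia.
move=> st2 [F1 F2] f2.
have he2 : run_env st2 by apply: (run_env_frame f2) => //; case: (d).
have hb2 : wreg st2 xb = b by case: f2 => -> //; case: (d).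
have T2 : Tval st2 = Tval st.
  by rewrite -T1 /Tval; case: f2 => _ _ _ -> //; case: (d).
have ok0 : row_ok st1 b 0 st2.
  split=> // t; rewrite F1; split=> //; by left.
apply: wp_weaken (relax_spec he2 bNB hb2 ok0) _ _; first by lia.
move=> st3 [G1 G2] _.
rewrite (_ : Aval (set_wreg st3 xb b.+1) = Aval st3) //.
apply: (dp_ok_step hdp) => [b' t b'b|t]; first exact: G1.
have [h1 h2 h3] := G2 t; rewrite T1 in h1 h2; split=> //.
- case: h1 => [->|[e [et we he']]]; [by left|right; exists e; split=> //].
  rewrite [LHS]he'; congr (_ + _); apply/esym; apply: G1; lia.
- move=> e et we; apply: le_trans (h3 e (ltn_ord e) et we) _.
  rewrite lerD2r le_eqVlt; apply/orP; left; apply/eqP; apply/esym; apply: G1; lia.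
Qed.

(* Row [s] of the table (column [s] for the reversed graph) is replaced. *)
Definition new_row st A st' : Prop :=
  (forall q t, (q < Q1)%N -> dirT d (Tval st' k) q s t = A (q * pp)%N t) /\
  (forall k' q x y, (q < Q1)%N -> (k' != k) || ((if d then x else y) != s) ->
     Tval st' k' q x y = Tval st k' q x y).

Lemma write_spec st : run_env st ->
  wp W (For xq xQ (For xt xN (write_back d)))
    (Q1 * ((n * (60 + 10) + 8) + 10) + 8) (new_row st (Aval st)) st.
Proof.
move=> he; have [[[_ _ eQ] _ _] _ _ _] := he.
(* Lexicographic progress of the two nested loops: the cells before [(q0, t0)] are written, and
   other rows or columns of the table are intact. *)
pose J q0 (t0 : nat) st' :=
  (forall q (t : 'I_n), (q < q0)%N || ((q == q0) && (t < t0)%N) -> (q < Q1)%N ->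
     dirT d (Tval st' k) q s t = Aval st (q * pp)%N t) /\
  (forall k' q x y, (q < Q1)%N -> (k' != k) || ((if d then x else y) != s) ->
     Tval st' k' q x y = Tval st k' q x y).
apply: (wp_weaken (T := (Q1 * ((n * (60 + 10) + 8) + 10) + 8)%N)
   (Post := fun st' => J Q1 0 st')) => //; last first.
  by move=> st' [h1 h2]; split=> // q t hq; apply: h1; rewrite ?hq.
apply: (wp_for_const (I := fun q st' => J q 0 st')) => //; try by case: (d).
  by split=> // q t; rewrite ltn0 andbF.
move=> q st1 qQ f1 xq1 J1.
have he1 : run_env st1 by apply: (run_env_frame f1) => //; case: (d).
have [[[eN1 _ _] _ _] _ _ _] := he1.
have A1 : rmem st1 aD = rmem st aD by case: f1 => _ _ _ -> //; case: (d).
apply: (wp_weaken (T := (n * (60 + 10) + 8)%N)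
   (Post := fun st' => J q n st')) => //; last first.
  move=> st' [h1 h2] _; split=> // q' t; rewrite andbF orbF ltnS => qq q'Q.
  by apply: h1 => //; rewrite ltn_ord andbT orbC -leq_eqVlt.
apply: (wp_for_const (I := fun t st' => J q t st')) => //; try by case: (d).
move=> i st2 ni f2 xi [J2 J3].
have he2 : run_env st2 by apply: (run_env_frame f2) => //; case: (d).
have [[[eN2 eM2 eQ2] _ _] [ek eNB ep] es _] := he2.
apply: (wp_weaken (T := max_time (write_back d))
   (Post := fun st' => frame (write_back d) st2 st' -> J q i.+1 (set_wreg st' xt i.+1))) => //; try by case: (d).
apply: wp_den; first by case: (d).
move=> _.
have hq2 : wreg st2 xq = q by case: f2 => ->.
have A2 : rmem st2 aD = rmem st aD.
  by rewrite -A1; case: f2 => _ _ _ -> //; case: (d).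
have qpW : (q * pp < W)%N by nia.
have hix : weval W st2 (row_exp (WVar xq *w WVar xp) (WVar xt)) = (q * pp * n + i)%N.
  apply: weval_row_small => //=.
  - by rewrite hq2 ep modn_small.
  - exact: ltn_trans nW.
  - apply: leq_trans NBW; apply: lt_row => //; nia.
have hTix : weval W st2 (Tixd d (WVar xq) (WVar xs) (WVar xt)) =
   if d then tix Q1 n k q s i else tix Q1 n k q i s.
  exact: weval_Tixd.
pose ti := Ordinal ni.
have rE : reval W st2 (RLoad aD (row_exp (WVar xq *w WVar xp) (WVar xt))) =
    Aval st (q * pp)%N ti by rewrite /Aval -A2 -hix.
rewrite /J /write_back /den rE hTix.
set st3 := set_wreg _ _ _.
have T3 k' q' x y : (q' < Q1)%N -> Tval st3 k' q' x y =
   if [&& k' == k, q' == q & (if d then (x == s) && (y == ti) else (x == ti) && (y == s))]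
   then Aval st (q * pp)%N ti else Tval st2 k' q' x y.
  move=> q'Q.
  rewrite /st3 {1}/Tval /= /upd2 /upd /=.
  case: eqP => [e|ne].
    have {e} : tix Q1 n k' q' x y = if d then tix Q1 n k q s ti else tix Q1 n k q ti s by [].
    by case: (d) => /tix_inj [] // -> -> /val_inj -> /val_inj ->; rewrite !eqxx.
  case: and3P => // -[/eqP k1 /eqP q1 h]; case: ne; rewrite k1 q1.
  by move: h; case: (d) => /andP[/eqP -> /eqP ->].
split.
  move=> q' t h q'Q.
  have hlt : ~~ ((q' == q) && (t == ti)) -> (q' < q)%N || (q' == q) && (t < i)%N.
    have : (t == ti) = (val t == i) by [].
    by case: (ltngtP q' q) h => //= _; rewrite ltnS leq_eqVlt => /orP[/eqP ->|-> //]; rewrite eqxx => ->.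
  have -> : dirT d (Tval st3 k) q' s t = if (q' == q) && (t == ti)
      then Aval st (q * pp)%N ti else dirT d (Tval st2 k) q' s t.
    by rewrite /dirT; case: (d) T3 => T3; rewrite T3 // !eqxx ?andbT.
  case: ifPn => [/andP[/eqP -> /eqP ->] //|/hlt h2]; exact: J2.
move=> k' q' x y q'Q h; rewrite T3 //; case: ifPn => [/and3P[/eqP k1 _ h']|_].
  by move: h h'; rewrite k1 eqxx /=; case: (d) => /negbTE ->; rewrite ?andbF.
exact: J3.
Qed.

Definition run_time : nat :=
  (((NB * (((n * 70 + 8) + (m * 110 + 8)).+1 + 10) + 8) +
   (Q1 * ((n * (60 + 10) + 8) + 10) + 8)).+1)%N.

Lemma run_spec st : run_env st -> wp W (run d) run_time
  (fun st' => exists2 A, dp_ok (G := gdir d G) NB pp rounded_delay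
      (fun h x => dirT d (Tval st k) h s x) A & new_row st A st') st.
Proof.
move=> he; apply: wp_seq; apply: wp_weaken (dp_spec he) _ _ => //.
move=> st1 hdp f1.
have he1 : run_env st1 by apply: (run_env_frame f1) => //; case: (d).
have T1 : Tval st1 = Tval st.
  by rewrite /Tval; case: f1 => _ _ _ -> //; case: (d).
apply: wp_weaken (write_spec he1) _ _ => // st2 [h1 h2].
by exists (Aval st1) => //; split=> // k' q x y hq hx; rewrite -T1; exact: h2.
Qed.

End Spec.
End Run.

(** * Processing all vertices of one level *)

Section Invariants.
Context {R : realType} {n : nat} (G : digraph R n).
Variables (lev : 'I_n -> nat) (K Q1 W : nat) (u0 inf : R).
Hypothesis u0_gt0 : 0 < u0.
Hypothesis lev_le : forall v, (lev v <= K)%N.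
Implicit Types (T : nat -> 'I_n -> 'I_n -> R) (s t x y : 'I_n).

Definition sound_tab T : Prop := forall q s t, (q < Q1)%N ->
  @sound_len R n G inf s t (q%:R * u0) (T q s t).

Definition diag_tab T : Prop := forall q s, (q < Q1)%N -> T q s s <= 0.

Definition tab_inv i T : Prop :=
  [/\ sound_tab T, diag_tab T & complete_from lev K Q1 u0 G i T].

(** Within a level each vertex relies only on what level [i.+1] guarantees, so that this guarantee
    is carried along unchanged while the first [s0] vertices are treated. *)
Definition tab_inv_in i (s0 : nat) T : Prop :=
  tab_inv i.+1 T /\
  forall s t (p : seq 'I_(nedges G)), is_path s t p ->
    (lev s = i /\ (s < s0)%N) \/ (lev t = i /\ (t < s0)%N) ->
    tab_le Q1 u0 T s t (plen p) (pdel p + err lev K u0 i (verts s p)).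

Definition is_run d i s (T T' : nat -> 'I_n -> 'I_n -> R) : Prop :=
  exists A, [/\ dp_ok (G := gdir d G) (Q1.-1 * 2 ^ i).+1 (2 ^ i)
        (@rounded_delay R n G W (u0 / 2 ^+ i)) (fun h x => dirT d T h s x) A,
      forall q t, (q < Q1)%N -> dirT d T' q s t = A (q * 2 ^ i)%N t &
      forall q x y, (q < Q1)%N -> (if d then x else y) != s -> T' q x y = T q x y].

Lemma rounded_delay_le i e : (@rounded_delay R n G W (u0 / 2 ^+ i) e)%:R * (u0 / 2 ^+ i) <= edel e.
Proof.
have u_gt0 : 0 < u0 / 2 ^+ i by rewrite divr_gt0 ?exprn_gt0.
rewrite -ler_pdivlMr //; apply: le_trans (_ : (Num.truncn (edel e / (u0 / 2 ^+ i)))%:R <= _).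
  by rewrite ler_nat geq_minl.
by have /andP[] := truncn_itv (divr_ge0 (edel_ge0 e) (ltW u_gt0)).
Qed.

(** Row [q * 2 ^ i] starts from budget [q] itself, so a run can only lower entries. This is why
    earlier completeness guarantees persist. *)
Lemma run_le d i s T T' : is_run d i s T T' ->
  forall q x y, (q < Q1)%N -> T' q x y <= T q x y.
Proof.
move=> [A [hA hs ho]] q x y qQ.
have [e|ne] := eqVneq (if d then x else y) s; last by rewrite ho.
have lt : (q * 2 ^ i < (Q1.-1 * 2 ^ i).+1)%N.
  by rewrite ltnS leq_mul2r; apply/orP; right; lia.
have key z : dirT d T' q s z <= dirT d T q s z.
  by rewrite hs //; have [_ + _] := hA _ z lt; rewrite mulnK ?expn_gt0.
by move: e (key x) (key y); rewrite /dirT; case: (d) => ->.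
Qed.

Lemma run_sound d i s T T' : ((Q1.-1 * 2 ^ i).+1 < W)%N -> is_run d i s T T' ->
  sound_tab T -> sound_tab T'.
Proof.
move=> hW [A [hA hs ho]] hT q x y qQ.
have [e|ne] := eqVneq (if d then x else y) s; last by rewrite ho //; exact: hT.
have u_gt0 : 0 < u0 / 2 ^+ i by rewrite divr_gt0 ?exprn_gt0.
have u0E : u0 = (2 ^ i)%N%:R * (u0 / 2 ^+ i).
  by rewrite natrX mulrC divfK // expf_neq0.
have tr s' t' D z : @sound_len R n (gdir d G) inf s' t' D z <->
    @sound_len R n G inf (if d then s' else t') (if d then t' else s') D z.
  by case: (d); [|exact: sound_len_rev].
have key z : @sound_len R n (gdir d G) inf s z (q%:R * u0) (dirT d T' q s z).
  rewrite hs // {1}u0E mulrA -natrM.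
  apply: (dp_sound hA (ltW u_gt0)).
  (* An edge that fits into the rows is not capped, so that its floor plus one unit covers its
     delay. *)
  - move=> e' he; rewrite -ler_pdivrMr // /rounded_delay (minn_idPl _).
      by rewrite ltW // truncnS_gt.
    by move: he; rewrite /rounded_delay; lia.
  - move=> b t; rewrite ltnS => hb; rewrite -u0E; apply/tr.
    have bQ : (b %/ 2 ^ i < Q1)%N.
      rewrite ltn_divLR ?expn_gt0 //; have : (0 < 2 ^ i)%N by rewrite expn_gt0.
      by move: hb qQ; nia.
    by rewrite /dirT; case: (d); exact: hT.
  - by rewrite ltnS leq_mul2r; apply/orP; right; lia.
move: e (key x) (key y) => + /tr + /tr; rewrite /dirT.
by case: (d) => ->.
Qed.

Lemma complete_le T T' i : (forall q x y, (q < Q1)%N -> T' q x y <= T q x y) ->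
  complete_from lev K Q1 u0 G i T -> complete_from lev K Q1 u0 G i T'.
Proof.
move=> hT hC s t p hp hl; apply: tab_le_weaken (hC s t p hp hl) => // q qQ.
exact: hT.
Qed.

Lemma complete_rev T i : complete_from lev K Q1 u0 G i T ->
  complete_from lev K Q1 u0 (gdir false G) i (fun q s t => T q t s).
Proof.
move=> hC s t p hp hl.
have hp' : @is_path R n G t s (rev p) by rewrite -is_path_rev revK.
have hl' : (i <= lev t)%N || (i <= lev s)%N by rewrite orbC.
have := hC t s (rev p) hp' hl'; rewrite (plen_rev (G := G)) (pdel_rev (G := G)).
have hv : @verts R n (gdir false G) s p = rev (@verts R n G t (rev p)).
  by rewrite -(verts_rev hp') revK.
by rewrite hv err_rev.
Qed.

(** The forward run settles the pairs starting at [s], the backward run those ending there. The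
    latter is the same step for the reversed graph and the transposed table, and [err_rev]
    identifies the two errors. *)
Lemma tab_inv_next i s0 (s : 'I_n) T T1 T2 : (i <= K)%N ->
  ((Q1.-1 * 2 ^ i).+1 < W)%N -> s = s0 :> nat -> lev s = i ->
  is_run true i s T T1 -> is_run false i s T1 T2 ->
  tab_inv_in i s0 T -> tab_inv_in i s0.+1 T2.
Proof.
move=> iK hW ss0 ls r1 r2 [[hS hD hC] hI].
have le1 := run_le r1; have le2 := run_le r2.
have le12 q x y : (q < Q1)%N -> T2 q x y <= T q x y.
  by move=> qQ; apply: le_trans (le2 _ _ _ qQ) (le1 _ _ _ qQ).
have hD1 : diag_tab T1 by move=> q x qQ; apply: le_trans (le1 _ _ _ qQ) (hD _ _ qQ).
split; first split.
- by apply: (run_sound hW r2); apply: (run_sound hW r1).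
- by move=> q x qQ; apply: le_trans (le12 _ _ _ qQ) (hD _ _ qQ).
- exact: complete_le le12 hC.
move=> x y p hp hl.
have fwd : x = s -> tab_le Q1 u0 T2 x y (plen p) (pdel p + err lev K u0 i (verts x p)).
  move=> xs; rewrite xs in hp *.
  have [A [hA hs _]] := r1.
  have := complete_step u0_gt0 iK hA hs (rounded_delay_le i) (fun q hq => hD q s hq) hC hp.
  apply: tab_le_weaken => // q qQ; exact: le2.
have bwd : y = s -> tab_le Q1 u0 T2 x y (plen p) (pdel p + err lev K u0 i (verts x p)).
  move=> ys; rewrite ys in hp *.
  have [A [hA hs _]] := r2.
  have hC1 := complete_rev (complete_le le1 hC).
  have hp' : @is_path R n (gdir false G) s x (rev p) by rewrite is_path_rev.
  have := complete_step (G := gdir false G) (T' := fun q s t => T2 q t s)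
    u0_gt0 iK hA hs (rounded_delay_le i) (fun q hq => hD1 q s hq) hC1 hp'.
  rewrite (verts_rev hp) err_rev -[@plen R n (gdir false G) _]/(@plen R n G (rev p)).
  by rewrite -[@pdel R n (gdir false G) _]/(@pdel R n G (rev p)) plen_rev pdel_rev.
have old : (lev x = i /\ (x < s0)%N) \/ (lev y = i /\ (y < s0)%N) ->
    tab_le Q1 u0 T2 x y (plen p) (pdel p + err lev K u0 i (verts x p)).
  by move=> h; apply: tab_le_weaken (hI _ _ _ hp h) => // q qQ; exact: le12.
have eqs z : (z < s0.+1)%N -> ~~ (z < s0)%N -> z = s :> nat by lia.
case: hl => -[lx]; rewrite ltnS leq_eqVlt -ss0 => /orP[/eqP e|h].
- by apply: fwd; apply: val_inj.
- by apply: old; left; rewrite -ss0.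
- by apply: bwd; apply: val_inj.
- by apply: old; right; rewrite -ss0.
Qed.

Lemma tab_inv_skip i s0 (s : 'I_n) T : s = s0 :> nat -> lev s != i ->
  tab_inv_in i s0 T -> tab_inv_in i s0.+1 T.
Proof.
move=> ss0 ls [hT hI]; split=> // x y p hp hl; apply: hI => //.
have h z : lev z = i /\ (z < s0.+1)%N -> lev z = i /\ (z < s0)%N.
  move=> [lz]; rewrite ltnS leq_eqVlt => /orP[/eqP e|//].
  by case/eqP: ls; rewrite -lz; congr lev; apply: val_inj; exact: etrans ss0 (esym e).
by case: hl => /h ?; [left|right].
Qed.

Lemma tab_inv_start i T : tab_inv i.+1 T -> tab_inv_in i 0 T.
Proof. by move=> h; split=> // x y p hp [[]|[]]. Qed.

(** A pair with an endpoint above level [i] keeps its older and sharper bound; any other has an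
    endpoint of level exactly [i]. *)
Lemma tab_inv_finish i T : tab_inv_in i n T -> tab_inv i T.
Proof.
move=> [[hS hD hC] hI]; split=> // x y p hp hl.
have [h|h] := boolP ((i.+1 <= lev x) || (i.+1 <= lev y))%N.
  apply: tab_le_weaken (hC _ _ _ hp h) => //.
  by rewrite lerD2l; exact: err_mono.
apply: hI => //; move: hl h; rewrite !ltn_ord.
case: (ltngtP i (lev x)) => [//|_|->]; last by left.
by case: (ltngtP i (lev y)) => // ->; right.
Qed.

(** No vertex has level [K.+1], so completeness is vacuous at the start. *)
Lemma tab_inv_init T :
  (forall q s t, (q < Q1)%N -> T q s t = if s == t then 0 else inf) ->
  tab_inv K.+1 T.
Proof.
move=> hT; split=> [q s t qQ|q s qQ|s t p _].
- rewrite hT //; case: eqP => [->|_]; last by left.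
  right; exists [::]; split; rewrite /= ?eqxx /plen /pdel ?big_nil //.
  by rewrite mulr_ge0 // ltW.
- by rewrite hT // eqxx.
- by rewrite !ltnNge !lev_le.
Qed.

End Invariants.

(** * One scale of delays *)

Definition init_entry : cmd :=
  If (BAnd (BWle (WVar xs) (WVar xt)) (BWle (WVar xt) (WVar xs)))
    (RStore aT (Tixd true (WVar xq) (WVar xs) (WVar xt)) (ROfWord (WLit 0)))
    (RStore aT (Tixd true (WVar xq) (WVar xs) (WVar xt)) (RVar yinf)).

Definition process_vertex : cmd :=
  If (BAnd (BWle (WLoad apw (WVar xs)) (WVar xp))
           (BWle (WVar xp) (WLoad apw (WVar xs))))
    (run true ;; run false) Skip.

Definition set_unit : cmd :=
  RSet yu ((RVar yeps *r RVar ydel) /r (ROfWord (WVar xE) *r ROfWord (WVar xp))) ;;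
  WSet xNB ((WVar xQ -w WLit 1) *w WVar xp +w WLit 1).

Definition process_level : cmd :=
  set_unit ;; For xs xN process_vertex ;; WSet xp (WVar xp /w WLit 2).

Definition init_table : cmd := For xq xQ (For xs xN (For xt xN init_entry)).

Definition store_unit : cmd :=
  RStore aU (WVar xk) ((RVar yeps *r RVar ydel) /r ROfWord (WVar xE)).

Definition process_scale : cmd :=
  store_unit ;; init_table ;; WSet xp (WVar xP) ;; For xj xK1 process_level.

Section Scale.
Context {R : realType} {n : nat} (G : digraph R n).
Variables (W Q1 NS K E : nat) (lev : 'I_n -> nat) (eps inf : R).
Local Notation m := (nedges G).
Hypothesis n_gt1 : (1 < n)%N.
Hypothesis nW : (n < W)%N.
Hypothesis mW : (m < W)%N.
Hypothesis QW : (Q1 < W)%N.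
Hypothesis KW : (K.+1 < W)%N.
Hypothesis TW : (NS * Q1 * n * n <= W)%N.
Hypothesis AW : ((Q1.-1 * 2 ^ K).+1 * n < W)%N.
Hypothesis Q1_gt0 : (0 < Q1)%N.
Hypothesis E_gt0 : (0 < E)%N.
Hypothesis lev_le : forall v, (lev v <= K)%N.
Hypothesis eps_gt0 : 0 < eps.
Implicit Types st : state R.

Definition table_env st : Prop :=
  [/\ env G Q1 st,
      [/\ wreg st xK1 = K.+1, wreg st xP = (2 ^ K)%N & wreg st xE = E],
      rreg st yeps = eps /\ rreg st yinf = inf &
      forall v : 'I_n, wmem st apw v = (2 ^ lev v)%N].

Lemma table_env_frame c st st' : frame c st st' ->
  all (fun x => x \notin wmod c) [:: xN; xM; xQ; xK1; xP; xE] ->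
  all (fun x => x \notin rmod c) [:: yeps; yinf] ->
  all (fun x => x \notin wamod c) [:: 0; 1; apw]%N ->
  all (fun x => x \notin ramod c) [:: 0; 1]%N ->
  table_env st -> table_env st'.
Proof.
move=> f /and5P[w1 w2 w3 w4 /and3P[w5 w6 _]] /and3P[r1 r2 _].
move=> /and4P[a1 a2 a3 _] /and3P[b1 b2 _] [e [e1 e2 e3] [e4 e5] e6].
have [f1 f2 f3 f4] := f; split.
- by apply: env_frame f _ _ e; rewrite /= ?w1 ?w2 ?w3 ?a1 ?a2 ?b1 ?b2.
- by rewrite !f1.
- by rewrite !f2.
- by move=> v; rewrite f3.
Qed.

Section OneScale.
Variables (k : nat) (delta : R).
Hypothesis kNS : (k < NS)%N.
Hypothesis delta_gt0 : 0 < delta.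

Definition scale_unit0 : R := eps * delta / E%:R.

Lemma scale_unit0_gt0 : 0 < scale_unit0.
Proof. by rewrite divr_gt0 ?mulr_gt0 // ltr0n. Qed.

Definition scale_env st : Prop :=
  [/\ table_env st, wreg st xk = k & rreg st ydel = delta].

Lemma scale_env_frame c st st' : frame c st st' ->
  all (fun x => x \notin wmod c) [:: xN; xM; xQ; xK1; xP; xE; xk] ->
  all (fun x => x \notin rmod c) [:: yeps; yinf; ydel] ->
  all (fun x => x \notin wamod c) [:: 0; 1; apw]%N ->
  all (fun x => x \notin ramod c) [:: 0; 1]%N ->
  scale_env st -> scale_env st'.
Proof.
move=> f /and5P[w1 w2 w3 w4 /and4P[w5 w6 w7 _]] /and4P[r1 r2 r3 _] a b [e e1 e2].
have [f1 f2 _ _] := f; split; rewrite ?f1 ?f2 //.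
by apply: table_env_frame f _ _ _ _ e => //=;
  rewrite ?w1 ?w2 ?w3 ?w4 ?w5 ?w6 ?r1 ?r2.
Qed.

Definition keeps st st' : Prop := forall k' q (x y : 'I_n), (q < Q1)%N -> k' != k ->
  Tval Q1 st' k' q x y = Tval Q1 st k' q x y.

Lemma keeps_trans st1 st2 st3 : keeps st1 st2 -> keeps st2 st3 -> keeps st1 st3.
Proof. by move=> h1 h2 k' q x y hq hk; rewrite h2 // h1. Qed.

(** Just enough rows to contain row [q * 2 ^ i] for the largest budget [q = Q1.-1]. *)
Definition nrows i := (Q1.-1 * 2 ^ i).+1.

Lemma nrows_bound i : (i <= K)%N -> (nrows i * n <= W)%N /\ (nrows i < W)%N.
Proof.
move=> iK; have h : (2 ^ i <= 2 ^ K)%N by rewrite leq_exp2l.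
have h2 : (nrows i <= (Q1.-1 * 2 ^ K).+1)%N by rewrite ltnS leq_mul2l h orbT.
by move: AW n_gt1; split; nia.
Qed.

Definition level_env i st : Prop :=
  [/\ scale_env st, wreg st xp = (2 ^ i)%N, wreg st xNB = nrows i & rreg st yu = scale_unit0 / 2 ^+ i].

Lemma level_env_frame i c st st' : frame c st st' ->
  all (fun x => x \notin wmod c) [:: xN; xM; xQ; xK1; xP; xE; xk; xp; xNB] ->
  all (fun x => x \notin rmod c) [:: yeps; yinf; ydel; yu] ->
  all (fun x => x \notin wamod c) [:: 0; 1; apw]%N ->
  all (fun x => x \notin ramod c) [:: 0; 1]%N ->
  level_env i st -> level_env i st'.
Proof.
move=> f /and5P[w1 w2 w3 w4 /and5P[w5 w6 w7 w8 /andP[w9 _]]].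
move=> /and5P[r1 r2 r3 r4 _] a b [e e1 e2 e3].
have [f1 f2 _ _] := f; split; rewrite ?f1 ?f2 //.
by apply: scale_env_frame f _ _ _ _ e => //=;
  rewrite ?w1 ?w2 ?w3 ?w4 ?w5 ?w6 ?w7 ?r1 ?r2 ?r3.
Qed.

Lemma level_env_run_env i (s : 'I_n) st : level_env i st -> wreg st xs = s ->
  run_env G Q1 k (nrows i) (2 ^ i) s (scale_unit0 / 2 ^+ i) st.
Proof. by move=> [[[e e1 e2 e3] e4 e5] e6 e7 e8] es; split. Qed.

Definition scale_inv i st := tab_inv G lev K Q1 scale_unit0 inf i (Tval Q1 st k).
Definition scale_inv_in i s st := tab_inv_in G lev K Q1 scale_unit0 inf i s (Tval Q1 st k).

Lemma run_step d i (s : 'I_n) st : (i <= K)%N -> level_env i st -> wreg st xs = s ->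
  wp W (run d) (run_time G Q1 (nrows i)) (fun st' => keeps st st' /\
    is_run G Q1 W scale_unit0 d i s (Tval Q1 st k) (Tval Q1 st' k)) st.
Proof.
move=> iK he hs; have [h1 h2] := nrows_bound iK.
have pp : (0 < 2 ^ i)%N by rewrite expn_gt0.
apply: wp_weaken (run_spec nW mW QW TW d kNS pp (erefl _) Q1_gt0 h1 h2 (level_env_run_env he hs)) _ _ => //.
move=> st' [A hA [hn ho]]; split.
  by move=> k' q x y qQ kk; apply: ho => //; rewrite kk.
exists A; split=> // q x y qQ hx; apply: ho => //; rewrite hx orbT //.
Qed.

(** Every vertex pays the level test at each level, but the two runs only at its own. *)
Definition vertex_time i (v : 'I_n) : nat :=
  (if lev v == i then 2 * run_time G Q1 (nrows i) + 20 else 20)%N.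

Lemma vertex_spec i (s : 'I_n) st : (i <= K)%N -> level_env i st -> wreg st xs = s ->
  scale_inv_in i s st ->
  wp W process_vertex (vertex_time i s)
    (fun st' => keeps st st' /\ scale_inv_in i s.+1 st') st.
Proof.
move=> iK he hs hi.
have [[[e e1 e2 e3] e4 e5] e6 e7 e8] := he.
have cE : beval W st (BAnd (BWle (WLoad apw (WVar xs)) (WVar xp))
           (BWle (WVar xp) (WLoad apw (WVar xs)))) = (lev s == i).
  by rewrite /= hs e3 e6 -eqn_leq eqn_exp2l.
rewrite /vertex_time; case: eqP => [ls|/eqP ls]; last first.
  apply: wp_weaken (wp_if (T := 1) (Post := fun st' => st' = st) _) _ _ => //.
    by rewrite cE (negbTE ls); apply: wp_den.
  by move=> st' ->; split=> //; apply: tab_inv_skip hi.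
apply: wp_weaken (wp_if (T := (run_time G Q1 (nrows i) + run_time G Q1 (nrows i)).+1)
  (Post := fun st' => keeps st st' /\ scale_inv_in i s.+1 st') _) _ _ => //; last first.
  by rewrite /=; lia.
rewrite cE ls eqxx; apply: wp_seq.
apply: wp_weaken (run_step true iK he hs) _ _ => // st1 [k1 r1] f1.
have he1 : level_env i st1 by apply: level_env_frame f1 _ _ _ _ he.
have hs1 : wreg st1 xs = s by case: f1 => ->.
apply: wp_weaken (run_step false iK he1 hs1) _ _ => // st2 [k2 r2].
split; first exact: keeps_trans k1 k2.
have [_ h2] := nrows_bound iK.
exact: (tab_inv_next scale_unit0_gt0 iK h2 (erefl _) ls r1 r2 hi).
Qed.

Definition level_time i : nat := (\sum_(v < n) (vertex_time i v + 10) + 100)%N.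

Lemma level_spec i st : (i <= K)%N -> scale_env st -> wreg st xp = (2 ^ i)%N ->
  scale_inv i.+1 st ->
  wp W process_level (level_time i)
    (fun st' => [/\ keeps st st', scale_inv i st' & wreg st' xp = (2 ^ i %/ 2)%N]) st.
Proof.
move=> iK he hp hi.
have W2 : (2 < W)%N by apply: leq_ltn_trans nW.
have [_ NBW] := nrows_bound iK.
apply: (wp_weaken (T := (max_time set_unit + (\sum_(v < n) (vertex_time i v + 10) + 8 +
  max_time (WSet xp (WVar xp /w WLit 2))).+1).+1) (Post := fun st' =>
   [/\ keeps st st', scale_inv i st' & wreg st' xp = (2 ^ i %/ 2)%N])) => //; last first.
  by rewrite /level_time /=; lia.
apply: wp_seq; apply: wp_den => // f1.
set st1 := den _ _ _ in f1 *.
have he1 : level_env i st1.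
  have se : scale_env st1 by apply: scale_env_frame f1 _ _ _ _ he.
  have [[[[eN eM eQ] _ _] [eK eP eE] [e4 e5] _] ek ed] := he.
  split=> //.
  - by rewrite /st1 /= /upd /= eQ hp (modn_small (ltnW W2))
      modnDml subn1 addn1 modn_small.
  - by rewrite /st1 /= /upd /= e4 ed eE hp /scale_unit0 natrX invfM mulrA.
have T1 : Tval Q1 st1 = Tval Q1 st by rewrite /Tval; case: f1 => _ _ _ -> //.
have hi1 : scale_inv_in i 0 st1 by rewrite /scale_inv_in T1; exact: tab_inv_start hi.
apply: wp_seq.
have [[[[[eN1 _ _] _ _] _ _ _] _ _] hp1 _ _] := he1.
pose I (s : nat) st' := keeps st st' /\ scale_inv_in i s st'.
apply: (wp_weaken (T := \sum_(v < n) (vertex_time i v + 10) + 8) (Post := I n)) => //; last first.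
  move=> st2 [k2 i2] f2; apply: wp_den => //=; split.
  - by move=> k' q x y qQ kk; rewrite -k2.
  - by have h := tab_inv_finish scale_unit0_gt0 i2; exact: h.
  - have -> : wreg st2 xp = (2 ^ i)%N by case: f2 => ->.
    by rewrite /upd /= (modn_small W2).
(* [wp_for] takes a cost function on all natural numbers; 0 is a dummy outside the vertices. *)
pose t (v : nat) := if insub v is Some v' then vertex_time i v' else 0%N.
have tE (v : 'I_n) : t v = vertex_time i v by rewrite /t valK.
under eq_bigr => v _ do rewrite -tE.
apply: wp_for => //.
move=> s st2 sn f2 hs [k2 i2].
have he2 : level_env i st2 by apply: level_env_frame f2 _ _ _ _ he1.
rewrite -[s]/(val (Ordinal sn)) tE.
apply: wp_weaken (vertex_spec (s := Ordinal sn) iK he2 hs i2) _ _ => // st3 [k3 i3] _.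
split=> //; exact: keeps_trans k2 k3.
Qed.

Definition levels_time : nat := (\sum_(j < K.+1) (level_time (K - j) + 10) + 8)%N.

Lemma levels_spec st : scale_env st -> wreg st xp = (2 ^ K)%N -> scale_inv K.+1 st ->
  wp W (For xj xK1 process_level) levels_time
    (fun st' => keeps st st' /\ scale_inv 0 st') st.
Proof.
move=> he hp hi.
have [[_ [eK _ _] _ _] _ _] := he.
(* After level 0 the halving leaves 0 in [xp], hence the guard on the last clause. *)
pose I (j : nat) st' := [/\ keeps st st', scale_inv (K.+1 - j) st' &
  (j < K.+1)%N -> wreg st' xp = (2 ^ (K - j))%N].
apply: (wp_weaken (T := levels_time) (Post := I K.+1)) => //; last first.
  by move=> st' [h1 + _]; rewrite subnn.
rewrite /levels_time.
apply: (wp_for (t := fun j => level_time (K - j)%N)) => //.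
  by split=> //; rewrite subn0.
move=> j st1 jK f1 hj [k1 i1 /(_ jK) p1].
have he1 : scale_env st1 by apply: scale_env_frame f1 _ _ _ _ he.
rewrite subSn // in i1.
apply: wp_weaken (level_spec (leq_subr _ _) he1 p1 i1) _ _ => // st2 [k2 i2 p2] _.
split; first exact: keeps_trans k1 k2.
  by rewrite subSS.
move=> jK'; rewrite /= /upd /= p2.
have -> : (K - j = (K - j.+1).+1)%N by move: jK'; lia.
by rewrite expnS mulKn.
Qed.

Definition init_time : nat :=
  (Q1 * (n * (n * (60 + 10) + 8 + 10) + 8 + 10) + 8)%N.

Lemma init_table_spec st : scale_env st ->
  wp W init_table init_time (fun st' => keeps st st' /\ scale_inv K.+1 st') st.
Proof.
move=> he.
pose J q0 s0 t0 st' := keeps st st' /\ forall q (s t : 'I_n), (q < Q1)%N ->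
  (q < q0)%N || ((q == q0) && ((s < s0)%N || ((s == s0 :> nat) && (t < t0)%N))) ->
  Tval Q1 st' k q s t = if s == t then 0 else inf.
have [[[[eN eM eQ] _ _] _ _ _] _ _] := he.
apply: (wp_weaken (T := init_time) (Post := J Q1 0%N 0%N)) => //; last first.
  move=> st' [h1 h2]; split=> //; apply: (tab_inv_init G scale_unit0_gt0 lev_le) => q s t qQ.
  by apply: h2; rewrite ?qQ.
apply: (wp_for_const (I := fun q st' => J q 0%N 0%N st')) => //.
  by split=> // q s t _; rewrite !ltn0 andbF orbF andbF.
move=> q st1 qQ f1 hq J1.
have he1 : scale_env st1 by apply: scale_env_frame f1 _ _ _ _ he.
have [[[[eN1 _ _] _ _] _ _ _] _ _] := he1.
apply: (wp_weaken (T := (n * (n * (60 + 10) + 8 + 10) + 8)%N) (Post := J q n 0%N)) => //; last first.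
  move=> st' [h1 h2] _; split=> // q' s t q'Q; rewrite !ltn0 andbF orbF andbF orbF ltnS => hq'.
  by apply: h2 => //; rewrite ltn_ord andbT orbC -leq_eqVlt.
apply: (wp_for_const (I := fun s st' => J q s 0%N st')) => //.
move=> s st2 sn f2 hs J2.
have he2 : scale_env st2 by apply: scale_env_frame f2 _ _ _ _ he1.
have [[[[eN2 _ _] _ _] _ _ _] _ _] := he2.
have hq2 : wreg st2 xq = q by case: f2 => ->.
apply: (wp_weaken (T := (n * (60 + 10) + 8)%N) (Post := J q s n)) => //; last first.
  move=> st' [h1 h2] _; split=> // q' s' t q'Q; rewrite ltn0 andbF orbF ltnS => hq'.
  by apply: h2 => //; rewrite ltn_ord andbT -(orbC (_ == s :> nat)) -leq_eqVlt.
apply: (wp_for_const (I := fun t st' => J q s t st')) => //.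
move=> t st3 tn f3 ht [k3 i3].
have he3 : scale_env st3 by apply: scale_env_frame f3 _ _ _ _ he2.
have [[[[eN3 eM3 eQ3] _ _] _ [_ ei] _] ek _] := he3.
have hq3 : wreg st3 xq = q by case: f3 => ->.
have hs3 : wreg st3 xs = s by case: f3 => ->.
have hT : weval W st3 (Tixd true (WVar xq) (WVar xs) (WVar xt)) = tix Q1 n k q s t.
  rewrite -[RHS]/(if true then tix Q1 n k q s t else tix Q1 n k q t s).
  exact: (weval_Tixd nW TW).
apply: (wp_weaken (T := max_time init_entry)
   (Post := fun st' => frame init_entry st3 st' -> J q s t.+1 (set_wreg st' xt t.+1))) => //.
apply: wp_den => // _.
pose s' := Ordinal sn; pose t' := Ordinal tn.
have -> : den W init_entry st3 = set_rmem st3 aT (tix Q1 n k q s t) (if s' == t' then 0 else inf).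
  have cE : beval W st3 (BAnd (BWle (WVar xs) (WVar xt)) (BWle (WVar xt) (WVar xs))) = (s' == t').
    by rewrite /= hs3 ht -eqn_leq.
  by rewrite /init_entry; cbn [den]; rewrite cE hT; case: ifP => _ /=; rewrite ?mod0n ?ei.
set st4 := set_wreg _ _ _.
have T4 k' q' x y : (q' < Q1)%N -> Tval Q1 st4 k' q' x y =
   if [&& k' == k, q' == q, x == s' & y == t'] then (if s' == t' then 0 else inf)
   else Tval Q1 st3 k' q' x y.
  move=> q'Q; rewrite {1}/Tval /= /upd2 /upd /=.
  case: eqP => [e|ne].
    have {e} : tix Q1 n k' q' x y = tix Q1 n k q s' t' by [].
    by move=> /tix_inj [] // -> -> /val_inj -> /val_inj ->; rewrite !eqxx.
  by case: and4P => // -[/eqP k1 /eqP q1 /eqP xs1 /eqP yt1]; case: ne; rewrite k1 q1 xs1 yt1.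
split=> [k' q' x y q'Q kk|q' x y q'Q]; first by rewrite T4 // (negbTE kk) /= k3.
move=> h; rewrite T4 // eqxx /=; case: ifPn => [/and3P[_ /eqP -> /eqP ->] //|h2].
apply: i3 => //; move: h h2.
rewrite -!val_eqE /= ltnS.
by case: (ltngtP q' q) => //= _; case: (ltngtP (val x) s) => //= _; case: (ltngtP (val y) t).
Qed.

Definition scale_time : nat := (init_time + levels_time + 40)%N.

Lemma scale_spec st : scale_env st -> (NS <= W)%N ->
  wp W process_scale scale_time
    (fun st' => [/\ keeps st st', scale_inv 0 st', rmem st' aU k = scale_unit0 &
       forall k', k' != k -> rmem st' aU k' = rmem st aU k']) st.
Proof.
move=> he NSW.
pose P st' := [/\ keeps st st', scale_inv 0 st', rmem st' aU k = scale_unit0 &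
       forall k', k' != k -> rmem st' aU k' = rmem st aU k'].
apply: (wp_weaken (T := (max_time store_unit + (init_time +
   (max_time (WSet xp (WVar xP)) + levels_time).+1).+1).+1) (Post := P)) => //; last first.
  by rewrite /scale_time /=; lia.
apply: wp_seq; apply: wp_den => // f1; set st1 := den _ _ _ in f1 *.
have he1 : scale_env st1 by apply: scale_env_frame f1 _ _ _ _ he.
have T1 : Tval Q1 st1 = Tval Q1 st by rewrite /Tval.
have [[_ [_ _ eE] [ee _] _] ek ed] := he.
have U1 k' : rmem st1 aU k' = if k' == k then scale_unit0 else rmem st aU k'.
  by rewrite /st1 /= ek ee ed eE /upd2 /upd /=.
apply: wp_seq; apply: wp_weaken (init_table_spec he1) _ _ => // st2 [k2 i2] f2.
have he2 : scale_env st2 by apply: scale_env_frame f2 _ _ _ _ he1.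
apply: wp_seq; apply: wp_den => // f3; set st3 := den _ _ _ in f3 *.
have he3 : scale_env st3 by apply: scale_env_frame f3 _ _ _ _ he2.
have i3 : scale_inv K.+1 st3 by [].
have p3 : wreg st3 xp = (2 ^ K)%N.
  by have [[_ [_ eP _] _ _] _ _] := he2; rewrite /st3 /= /upd /=.
apply: wp_weaken (wp_frame (wp_weaken (levels_spec he3 p3 i3) (leqnn _) _)) _ _;
  [|exact: leqnn|by move=> st' h; exact: h].
move=> st4 [k4 i4] f4.
have U4 : rmem st4 aU = rmem st1 aU.
  have -> : rmem st4 aU = rmem st3 aU by case: f4 => _ _ _ ->.
  by have -> : rmem st3 aU = rmem st2 aU by []; case: f2 => _ _ _ ->.
split=> //; last 2 first.
- by rewrite U4 U1 eqxx.
- by move=> k' kk; rewrite U4 U1 (negbTE kk).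
move=> k' q x y qQ kk; rewrite k4 // -T1 -k2 //.
Qed.

End OneScale.
End Scale.

(** * Preprocessing *)

Definition copy_input : cmd :=
  WSet xN (WVar 0) ;; WSet xM (WVar 1) ;; WSet xK (WLit 0) ;; WSet xP (WLit 1).

Definition double_P : cmd :=
  If (BNot (BWle (WVar xN) (WVar xP)))
    (WSet xP (WVar xP +w WVar xP) ;; WSet xK (WVar xK +w WLit 1)) Skip.

Definition set_constants (e0 c : nat) : cmd :=
  WSet xE (WLit e0 *w WVar xK) ;;
  If (BRle (ROfWord (WLit 1)) (RVar 0))
    (RSet yeps (ROfWord (WLit 1))) (RSet yeps (RVar 0)) ;;
  Floor xQ (ROfWord (WVar xE +w WVar xE) /r RVar yeps) ;;
  WSet xQ (WVar xQ +w WVar xE +w WLit 1) ;;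
  WSet xNS (WLit c.+1 *w WVar xK) ;;
  WSet xK1 (WVar xK +w WLit 1) ;;
  RSet yinf (ROfWord (WLit 1)) ;;
  WSet xS (WLit 0).

Definition add_length : cmd := RSet yinf (RVar yinf +r RLoad 0 (WVar xe)).

Definition double_p : cmd :=
  If (BWle (WVar xr %w (WVar xp +w WVar xp)) (WLit 0))
    (WSet xp (WVar xp +w WVar xp)) Skip.

Definition store_level : cmd :=
  WStore apw (WVar xs) (WVar xp) ;; WSet xS (WVar xS +w WVar xp).

Definition draw_level : cmd :=
  Rand xr ;; WSet xp (WLit 1) ;; For xj xK double_p ;; store_level.

Definition log_entry : cmd :=
  If (BWle (WLit 2) (WVar xz))
    (WStore alg (WVar xz) (WLoad alg (WVar xz /w WLit 2) +w WLit 1)) Skip.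

Definition all_scales : cmd :=
  RSet ydel (RVar 1) ;;
  For xk xNS (process_scale ;; RSet ydel (RVar ydel +r RVar ydel)).

Definition guard (CS : nat) : bexp :=
  BWle (WVar xS) (WLit CS *w (WVar xP *w WVar xK)).

Definition preprocess (e0 c CS : nat) : cmd :=
  copy_input ;; For xj xN double_P ;; set_constants e0 c ;;
  For xe xM add_length ;; For xs xN draw_level ;; For xz xP log_entry ;;
  If (guard CS) all_scales Skip.

Section Preprocess.
Context {R : realType} {n : nat} (G : digraph R n) (eps Dmin Dmax : R).
Variables (W e0 c CS : nat) (rs : seq nat).
Local Notation m := (nedges G).
Implicit Types st : state R.

Definition logceil : nat := up_log 2 n.
Definition slack : nat := (e0 * logceil)%N.
(** Replacing larger values of [eps] by 1 matches the max(1, 1/eps) of the time bound. *)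
Definition clip_eps : R := if 1 <= eps then 1 else eps.
(** A query at scale delta has D < 2 delta, so [D] is less than [2 * slack / clip_eps] units; the
    cell it reads lies [slack] further. *)
Definition nbudgets : nat := (Num.truncn ((slack + slack)%N%:R / clip_eps) + slack + 1)%N.
(** The ratio [Dmax / Dmin] is at most [2 ^ (c * logceil)]; the last [logceil] scales leave room for
    the logarithm read from the table by [find_scale]. *)
Definition nscales : nat := (c.+1 * logceil)%N.
(* Larger than the length of any simple path. *)
Definition big_len : R := 1 + \sum_(e < m) elen e.
Definition word_level (v : 'I_n) : nat := level logceil (nth 0%N rs v).
Definition scale_unit (k : nat) : R := clip_eps * (Dmin * 2 ^+ k) / slack%:R.
Definition totalwork : nat := (\sum_(v < n) 2 ^ word_level v)%N.

Hypothesis n_gt1 : (1 < n)%N.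
Hypothesis mW : (m < W)%N.
Hypothesis QW : (nbudgets < W)%N.
Hypothesis KW : (logceil.+1 < W)%N.
Hypothesis NSW : (nscales < W)%N.
Hypothesis TW : (nscales * nbudgets * n * n <= W)%N.
Hypothesis AW : ((nbudgets.-1 * 2 ^ logceil).+1 * n < W)%N.
Hypothesis SW : (n * 2 ^ logceil < W)%N.
Hypothesis SBW : (CS * (2 ^ logceil * logceil) < W)%N.
Hypothesis EEW : (slack + slack < W)%N.
Hypothesis e0W : (e0 < W)%N.
Hypothesis cW : (c.+1 < W)%N.
Hypothesis CSW : (CS < W)%N.
Hypothesis e0_gt0 : (0 < e0)%N.
Hypothesis eps_gt0 : 0 < eps.
Hypothesis Dmin_gt0 : 0 < Dmin.
Hypothesis rs_size : (n <= size rs)%N.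
Hypothesis rsW : all (fun r => r < W)%N rs.

Lemma logceil_gt0 : (0 < logceil)%N.
Proof. by rewrite /logceil up_log_gt0. Qed.

Lemma leq_exp_logceil : (n <= 2 ^ logceil)%N.
Proof. exact: up_logP. Qed.

Let nW : (n < W)%N.
Proof. by have := SW; have := leq_exp_logceil; nia. Qed.

Let W2 : (2 < W)%N. Proof. exact: leq_ltn_trans nW. Qed.
Let W1 : (1 < W)%N. Proof. exact: ltnW. Qed.
Let PW : (2 ^ logceil < W)%N. Proof. by have := SW; nia. Qed.

Lemma clip_eps_gt0 : 0 < clip_eps.
Proof. by rewrite /clip_eps; case: ifP. Qed.

Lemma slack_gt0 : (0 < slack)%N. Proof. by rewrite muln_gt0 e0_gt0 logceil_gt0. Qed.

Definition input_env st : Prop :=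
  [/\ wreg st xN = n, wreg st xM = m,
      forall e : 'I_m, wmem st 0 e = (ends e).1 /\ wmem st 1 e = (ends e).2,
      forall e : 'I_m, rmem st 0 e = elen e /\ rmem st 1 e = edel e &
      rreg st 0 = eps /\ rreg st 1 = Dmin].

Lemma input_env_init :
  input_env (den W copy_input (init_state G eps Dmin Dmax rs)).
Proof.
split=> //= e; split; rewrite (nth_map e) ?size_enum_ord // nth_ord_enum //.
Qed.

Lemma input_env_frame c' st st' : frame c' st st' ->
  all (fun x => x \notin wmod c') [:: xN; xM] ->
  all (fun x => x \notin rmod c') [:: 0; 1]%N ->
  all (fun x => (x \notin wamod c') && (x \notin ramod c')) [:: 0; 1]%N ->
  input_env st -> input_env st'.
Proof.
move=> [f1 f2 f3 f4] /and3P[w1 w2 _] /and3P[r1 r2 _].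
move=> /and3P[/andP[a1 b1] /andP[a2 b2] _] [e1 e2 e3 e4 [e5 e6]].
by split; rewrite ?f1 ?f2 ?f3 ?f4.
Qed.

Definition pow_time : nat := (n * (30 + 10) + 8)%N.

Lemma pow_spec st : input_env st -> wreg st xK = 0%N -> wreg st xP = 1%N ->
  tape st = rs ->
  wp W (For xj xN double_P) pow_time
    (fun st' => [/\ wreg st' xK = logceil, wreg st' xP = (2 ^ logceil)%N & tape st' = rs]) st.
Proof.
move=> he hK hP ht.
(* As long as [2 ^ xK < n], every round has doubled and [xK] counts the rounds. After [n] rounds
   this would give [2 ^ n < n]; so the doubling has stopped, and by the fourth clause it did so at
   the least exponent. *)
pose I (j : nat) st' := [/\ tape st' = rs, wreg st' xP = (2 ^ wreg st' xK)%N,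
  (wreg st' xK <= j)%N, (0 < wreg st' xK)%N -> (2 ^ (wreg st' xK).-1 < n)%N &
  (2 ^ wreg st' xK < n)%N -> wreg st' xK = j].
have [eN _ _ _ _] := he.
apply: (wp_weaken (T := pow_time) (Post := I n)) => //; last first.
  move=> st' [h0 h1 h2 h3 h4].
  have hn : (n <= 2 ^ wreg st' xK)%N.
    by rewrite leqNgt; apply/negP => h; have e := h4 h; move: h; rewrite e ltnNge ltnW // ltn_expl.
  have hk : (0 < wreg st' xK)%N.
    by case: (wreg st' xK) hn => //; rewrite expn0; move: n_gt1; lia.
  have KE : wreg st' xK = logceil.
    rewrite /logceil -(prednK hk); apply/esym/up_log_eq => //.
    by rewrite prednK // h3.
  by split=> //; rewrite h1 KE.
apply: wp_for_const => //.
  by split; rewrite /= /upd /= ?hK ?hP.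
move=> j st1 jn f1 hj [h0 h1 h2 h3 h4].
have [eN1 _ _ _ _] : input_env st1 by apply: input_env_frame f1 _ _ _ he.
apply: (wp_weaken (T := max_time double_P)
  (Post := fun st' => frame double_P st1 st' -> I j.+1 (set_wreg st' xj j.+1))) => //.
apply: wp_den => // _.
rewrite /double_P; cbn [den].
have -> : beval W st1 (BNot (BWle (WVar xN) (WVar xP))) = (wreg st1 xP < n)%N.
  by rewrite /= eN1 ltnNge.
rewrite h1; case: ifPn => [lt|]; last first.
  rewrite -leqNgt => ge; split=> //; first exact: leqW.
  by rewrite /= /upd /= ltnNge ge.
have hKj := h4 lt.
have dP : ((wreg st1 xP + wreg st1 xP) %% W = 2 ^ (wreg st1 xK).+1)%N.
  rewrite h1 addnn -mul2n -expnS modn_small //.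
  by apply: leq_ltn_trans SW; rewrite expnS; have := leq_exp_logceil; nia.
have dK : ((wreg st1 xK + 1 %% W) %% W = (wreg st1 xK).+1)%N.
  by rewrite (modn_small W1) addn1 modn_small // hKj; lia.
rewrite h1 in dP.
split; rewrite /= /upd /= ?h1 ?dP ?dK ?hKj //.
by rewrite -hKj.
Qed.

Definition const_env st : Prop :=
  [/\ input_env st, [/\ wreg st xK = logceil, wreg st xP = (2 ^ logceil)%N & wreg st xE = slack],
      [/\ wreg st xQ = nbudgets, wreg st xNS = nscales & wreg st xK1 = logceil.+1] &
      rreg st yeps = clip_eps].

Lemma const_env_frame c' st st' : frame c' st st' ->
  all (fun x => x \notin wmod c') [:: xN; xM; xK; xP; xE; xQ; xNS; xK1] ->
  all (fun x => x \notin rmod c') [:: 0; 1; yeps]%N ->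
  all (fun x => (x \notin wamod c') && (x \notin ramod c')) [:: 0; 1]%N ->
  const_env st -> const_env st'.
Proof.
move=> f /and5P[w1 w2 w3 w4 /and5P[w5 w6 w7 w8 _]] /and4P[r1 r2 r3 _] a.
move=> [e [e1 e2 e3] [e4 e5 e6] e7].
have [f1 f2 _ _] := f; split; rewrite ?f1 ?f2 //.
by apply: input_env_frame f _ _ _ e; rewrite /= ?w1 ?w2 ?r1 ?r2.
Qed.

Lemma constants_spec st : input_env st -> wreg st xK = logceil -> wreg st xP = (2 ^ logceil)%N ->
  let st' := den W (set_constants e0 c) st in
  [/\ const_env st', rreg st' yinf = 1, wreg st' xS = 0%N & tape st' = tape st].
Proof.
move=> he hK hP st'.
have f : frame (set_constants e0 c) st st'.
  have [st1 [k1 [h1 _ e1]]] : wp W (set_constants e0 c) (max_time (set_constants e0 c))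
      (fun st1 => st1 = st') st by apply: wp_den.
  by rewrite -e1; exact: exec_frame h1.
have he' : input_env st' by apply: input_env_frame f _ _ _ he.
have [eN eM _ _ [e1 e2]] := he.
have st'E : st' = den W (Floor xQ (ROfWord (WVar xE +w WVar xE) /r RVar yeps) ;;
    WSet xQ (WVar xQ +w WVar xE +w WLit 1) ;;
    WSet xNS (WLit c.+1 *w WVar xK) ;;
    WSet xK1 (WVar xK +w WLit 1) ;;
    RSet yinf (ROfWord (WLit 1)) ;;
    WSet xS (WLit 0)) (set_rreg (set_wreg st xE slack) yeps clip_eps).
  have h1 : weval W st (WLit e0 *w WVar xK) = slack.
    by rewrite /= hK (modn_small e0W) -/slack modn_small //; move: EEW; lia.
  rewrite /st' /set_constants; cbn [den]; rewrite h1.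
  have -> : beval W (set_wreg st xE slack) (BRle (ROfWord (WLit 1)) (RVar 0)) = (1 <= eps).
    by rewrite /= (modn_small W1) e1.
  rewrite /clip_eps; case: ifP => _.
    by rewrite -[reval W (set_wreg st 6 slack) (ROfWord (WLit 1))]/((1 %% W)%N%:R) (modn_small W1).
  by rewrite -[reval W (set_wreg st 6 slack) (RVar 0)]/(rreg st 0) e1.
have EEm : ((slack + slack) %% W = slack + slack)%N by rewrite modn_small.
have fl : (Num.truncn ((slack + slack)%N%:R / clip_eps) < W)%N.
  by apply: leq_ltn_trans QW; rewrite /nbudgets -addnA leq_addr.
have QE : wreg st' xQ = nbudgets.
  rewrite st'E /= /upd /= EEm (minn_idPl _); last by rewrite -ltnS prednK // ltnW.
  rewrite (modn_small W1) modnDml modn_small // /nbudgets.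
split.
- split=> //.
  + split; rewrite st'E /= /upd /= ?hK ?hP //.
  + split=> //; rewrite st'E /= /upd /= hK.
      by rewrite (modn_small cW) modn_small.
    by rewrite (modn_small W1) addn1 modn_small.
- by rewrite st'E /= /upd /=.
- by rewrite st'E /= /upd /= (modn_small W1).
- by rewrite st'E /= /upd /= mod0n.
- by rewrite st'E.
Qed.


Definition inf_time : nat := (m * (20 + 10) + 8)%N.

Lemma inf_spec st : const_env st -> rreg st yinf = 1 -> wreg st xS = 0%N -> tape st = rs ->
  wp W (For xe xM add_length) inf_time
    (fun st' => [/\ rreg st' yinf = big_len, wreg st' xS = 0%N & tape st' = rs]) st.
Proof.
move=> he hi hS ht.
have [[_ eM _ _ _] _ _ _] := he.
pose I (j : nat) st' := [/\ rreg st' yinf = 1 + \sum_(e < m | (e < j)%N) elen e,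
  wreg st' xS = 0%N & tape st' = rs].
apply: (wp_weaken (T := inf_time) (Post := I m)) => //; last first.
  move=> st' [h1 h2 h3]; split=> //; rewrite h1; congr (_ + _).
  by apply: eq_bigl => e; rewrite ltn_ord.
apply: wp_for_const => //.
  by split=> //=; rewrite hi big1 ?addr0.
move=> j st1 jm f1 hj [h1 h2 h3].
have [[_ _ _ e4 _] _ _ _] : const_env st1 by apply: const_env_frame f1 _ _ _ he.
apply: (wp_weaken (T := max_time add_length)
  (Post := fun st' => frame add_length st1 st' -> I j.+1 (set_wreg st' xe j.+1))) => //.
apply: wp_den => // _; split=> //=.
rewrite /upd /= h1 hj; have [-> _] := e4 (Ordinal jm).
have -> : \sum_(e < m | (e < j.+1)%N) elen e =
    \sum_(e < m | (e < j)%N) elen e + elen (Ordinal jm).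
  rewrite (bigD1 (Ordinal jm)) //= addrC; congr (_ + _); apply: eq_bigl => e.
  by rewrite -val_eqE /= ltnS leq_eqVlt; case: ltngtP.
by rewrite addrA.
Qed.

Definition double_time : nat := (logceil * (40 + 10) + 8)%N.

Lemma double_spec st r (tl : seq nat) : const_env st -> wreg st xr = r -> wreg st xp = 1%N ->
  tape st = tl ->
  wp W (For xj xK double_p) double_time
    (fun st' => wreg st' xp = (2 ^ level logceil r)%N /\ tape st' = tl) st.
Proof.
move=> he hr hp ht.
have [_ [eK _ _] _ _] := he.
pose I (j : nat) st' := wreg st' xp = (2 ^ level j r)%N /\ tape st' = tl.
apply: (wp_weaken (T := double_time) (Post := I logceil)) => //.
apply: wp_for_const => //; first by apply: ltn_trans KW.
move=> j st1 jK f1 hj [h1 h2].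
have hr1 : wreg st1 xr = r by case: f1 => ->.
apply: (wp_weaken (T := max_time double_p)
  (Post := fun st' => frame double_p st1 st' -> I j.+1 (set_wreg st' xj j.+1))) => //.
apply: wp_den => // _.
have dE : ((wreg st1 xp + wreg st1 xp) %% W = 2 ^ (level j r).+1)%N.
  rewrite h1 addnn -mul2n -expnS modn_small //; apply: leq_ltn_trans PW.
  by rewrite leq_exp2l //; have := level_le j r; lia.
rewrite /double_p; cbn [den].
have -> : beval W st1 (BWle (WVar xr %w (WVar xp +w WVar xp)) (WLit 0)) =
    (2 ^ (level j r).+1 %| r)%N.
  by rewrite /= dE hr1 mod0n leqn0.
by rewrite /I /=; case: ifP => _; split; rewrite //= /upd /= ?dE.
Qed.

Definition base_env st : Prop := const_env st /\ rreg st yinf = big_len.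

Lemma base_env_frame c' st st' : frame c' st st' ->
  all (fun x => x \notin wmod c') [:: xN; xM; xK; xP; xE; xQ; xNS; xK1] ->
  all (fun x => x \notin rmod c') [:: 0; 1; yeps; yinf]%N ->
  all (fun x => (x \notin wamod c') && (x \notin ramod c')) [:: 0; 1]%N ->
  base_env st -> base_env st'.
Proof.
move=> f w /and5P[r1 r2 r3 r4 _] a [e e1]; have [_ f2 _ _] := f.
by split; [apply: const_env_frame f w _ a e; rewrite /= r1 r2 r3|rewrite f2].
Qed.

Definition draw_time : nat := (n * ((double_time + 30) + 10) + 8)%N.

Lemma draw_levels_spec st : base_env st -> wreg st xS = 0%N -> tape st = rs ->
  wp W (For xs xN draw_level) draw_time
    (fun st' => (forall v : 'I_n, wmem st' apw v = (2 ^ word_level v)%N) /\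
                wreg st' xS = totalwork) st.
Proof.
move=> he hS ht.
have [[[eN _ _ _ _] _ _ _] _] := he.
pose I (j : nat) st' := [/\ forall v : 'I_n, (v < j)%N -> wmem st' apw v = (2 ^ word_level v)%N,
  wreg st' xS = (\sum_(v < n | (v < j)%N) 2 ^ word_level v)%N & tape st' = drop j rs].
apply: (wp_weaken (T := draw_time) (Post := I n)) => //; last first.
  move=> st' [h1 h2 h3]; split=> [v|]; first exact: h1.
  by rewrite h2; apply: eq_bigl => v; rewrite ltn_ord.
apply: wp_for_const => //.
  by split=> //=; rewrite ?drop0 // /upd /= hS big1.
move=> j st1 jn f1 hj [h1 h2 h3].
have he1 : base_env st1 by apply: base_env_frame f1 _ _ _ he.
have js : (j < size rs)%N by apply: leq_trans rs_size.
set r := nth 0%N rs j.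
have tE : tape st1 = r :: drop j.+1 rs by rewrite h3 (drop_nth 0%N).
apply: (wp_weaken (T := (1 + (2 + (double_time + max_time store_level).+1).+1).+1)
  (Post := fun st' => frame draw_level st1 st' -> I j.+1 (set_wreg st' xs j.+1))) => //; last first.
  by rewrite /=; lia.
apply: wp_seq.
exists (set_tape (set_wreg st1 xr r) (drop j.+1 rs)), 1%N; split=> //; first exact: ExRand.
move=> f2; set st2 := set_tape _ _ in f2 *.
apply: wp_seq; apply: (@wp_den R W (WSet xp (WLit 1))) => // f3; set st3 := den _ _ _ in f3 *.
have he2 : base_env st2 by apply: base_env_frame f2 _ _ _ he1.
have he3 : base_env st3 by apply: base_env_frame f3 _ _ _ he2.
have p3 : wreg st3 xp = 1%N by rewrite /st3 /= /upd /= modn_small.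
apply: wp_seq; apply: wp_weaken (double_spec (r := r) (proj1 he3) _ p3 (erefl _)) _ _ => //.
move=> st4 [p4 t4] f4; apply: wp_den => // _.
have f14 x : x \notin [:: xr; xp; xj] -> wreg st4 x = wreg st1 x.
  move=> hx; have -> : wreg st4 x = wreg st3 x.
    by case: f4 => -> //; apply: contra hx; rewrite !inE => /orP[] ->; rewrite ?orbT.
  rewrite /st3 /st2 /= !upd_neq //; apply: contra hx; rewrite !inE => ->; rewrite ?orbT //.
have m14 : wmem st4 apw = wmem st1 apw by case: f4 => _ _ ->.
have s4 : wreg st4 xs = j by rewrite f14.
have S4 : wreg st4 xS = (\sum_(v < n | (v < j)%N) 2 ^ word_level v)%N by rewrite f14.
have rE : level logceil r = word_level (Ordinal jn) by [].
have sumE : (\sum_(v < n | (v < j.+1)%N) 2 ^ word_level v =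
    \sum_(v < n | (v < j)%N) 2 ^ word_level v + 2 ^ word_level (Ordinal jn))%N.
  rewrite (bigD1 (Ordinal jn)) //= addnC; congr (_ + _)%N; apply: eq_bigl => v.
  by rewrite -val_eqE /= ltnS leq_eqVlt; case: ltngtP.
have sumW : (\sum_(v < n | (v < j.+1)%N) 2 ^ word_level v < W)%N.
  apply: leq_ltn_trans SW; rewrite -[n in (_ <= n * _)%N]card_ord -sum_nat_const.
  rewrite [leqRHS](bigID (fun v : 'I_n => (v < j.+1)%N)) /=; apply: leq_trans (leq_addr _ _).
  by apply: leq_sum => v _; rewrite leq_exp2l // level_le.
rewrite rE in p4; split.
- move=> v; rewrite ltnS leq_eqVlt /= /upd2 /upd /= s4 => /orP[/eqP vj|vj].
    rewrite vj eqxx p4; congr (2 ^ word_level _)%N; exact: val_inj.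
  by rewrite ltn_eqF // m14 h1.
- by rewrite /= /upd /= p4 S4 -sumE modn_small.
- by rewrite /= t4.
Qed.

Definition log_time : nat := (2 ^ logceil * (40 + 10) + 8)%N.

(** Entry [z] is entry [z / 2] plus one. The entry of 1 is not written: it is the 0 of the initial
    memory. *)
Lemma log_table_spec st : base_env st -> (forall z, wmem st alg z = 0%N) ->
  wp W (For xz xP log_entry) log_time
    (fun st' => (forall z, (0 < z)%N -> (z < 2 ^ logceil)%N -> wmem st' alg z = trunc_log 2 z)) st.
Proof.
move=> he h0.
have [[_ [_ eP _] _ _] _] := he.
pose I (j : nat) st' := (forall z, (0 < z)%N -> (z < j)%N -> wmem st' alg z = trunc_log 2 z) /\
  (wmem st' alg 1%N = 0%N).
apply: (wp_weaken (T := log_time) (Post := I (2 ^ logceil)%N)) => //; last by move=> st' [].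
apply: wp_for_const => //.
  by split=> [z _|]; rewrite ?ltn0 //= h0.
move=> j st1 jP f1 hj [h1 h2].
apply: (wp_weaken (T := max_time log_entry)
  (Post := fun st' => frame log_entry st1 st' -> I j.+1 (set_wreg st' xz j.+1))) => //.
apply: wp_den => // _; rewrite /log_entry; cbn [den].
have -> : beval W st1 (BWle (WLit 2) (WVar xz)) = (2 <= j)%N.
  by rewrite /= hj modn_small.
case: ifPn => [j2|].
  have lE : weval W st1 (WLoad alg (WVar xz /w WLit 2) +w WLit 1) = trunc_log 2 j.
    rewrite /= hj (modn_small W2) (modn_small W1) divn2.
    have hlf : (0 < j./2)%N && (j./2 < j)%N by lia.
    case/andP: hlf => g1 g2; rewrite h1 // addn1 -trunc_log2S //.
    rewrite modn_small //; apply: ltn_trans (ltn_trans jP PW).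
    have /andP[lo _] := trunc_log_bounds (isT : 1 < 2)%N (ltnW j2).
    by apply: leq_trans lo; rewrite ltn_expl.
  rewrite lE; split.
    move=> z z0; rewrite ltnS leq_eqVlt /= /upd2 /upd /= hj => /orP[/eqP ->|zj].
      by rewrite eqxx.
    by rewrite ltn_eqF // h1.
  by rewrite /= /upd2 /upd /= hj ltn_eqF.
rewrite -ltnNge ltnS => j1; split=> // z z0 zj.
have -> : z = 1%N by lia.
by rewrite /= h2 (trunc_log1 2).
Qed.


Lemma tab_inv_ext i (u0 inf : R) lev K Q1 T T' :
  (forall q x y, (q < Q1)%N -> T' q x y = T q x y) ->
  tab_inv G lev K Q1 u0 inf i T -> tab_inv G lev K Q1 u0 inf i T'.
Proof.
move=> hT [h1 h2 h3]; split.
- by move=> q x y qQ; rewrite hT //; exact: h1.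
- by move=> q x qQ; rewrite hT //; exact: h2.
- by move=> x y p hp hl q qQ hq; rewrite hT //; exact: (h3 x y p hp hl).
Qed.

Definition scale_done st k : Prop :=
  tab_inv G word_level logceil nbudgets (scale_unit k) big_len 0 (Tval nbudgets st k) /\ rmem st aU k = scale_unit k.

Definition all_time : nat :=
  (nscales * ((scale_time G nbudgets logceil word_level + 30) + 10) + 20)%N.

Lemma all_scales_spec st : base_env st -> (forall v : 'I_n, wmem st apw v = (2 ^ word_level v)%N) ->
  wp W all_scales all_time
    (fun st' => forall k, (k < nscales)%N -> scale_done st' k) st.
Proof.
move=> he ha.
pose I (k : nat) st' := rreg st' ydel = Dmin * 2 ^+ k /\
  forall k', (k' < k)%N -> scale_done st' k'.
apply: (wp_weaken (T := (2 + (nscales * ((scale_time G nbudgets logceil word_level + 30) + 10) + 8)).+1)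
  (Post := I nscales)) => //; last 2 first.
- by rewrite /all_time; lia.
- by move=> st' [].
apply: wp_seq; apply: (@wp_den R W (RSet ydel (RVar 1))) => // f1.
set st1 := den _ _ _ in f1 *.
have he1 : base_env st1 by apply: base_env_frame f1 _ _ _ he.
have [[[_ _ _ _ [_ eD]] _ _ _] _] := he.
have [[_ _ [_ eNS _] _] _] := he1.
apply: wp_for_const => //.
  by split=> //=; rewrite /upd /= eD mulr1.
move=> k st2 kN f2 hk [d2 h2].
have he2 : base_env st2 by apply: base_env_frame f2 _ _ _ he1.
have [[[eN eM e3 e4 _] [eK eP eE] [eQ _ eK1] ee] ei] := he2.
have ge : table_env G nbudgets logceil slack word_level clip_eps big_len st2.
  split=> // v; have -> : wmem st2 apw = wmem st1 apw by case: f2 => _ _ ->.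
  by rewrite ha.
have dk : 0 < Dmin * 2 ^+ k by rewrite mulr_gt0 ?exprn_gt0.
have se : scale_env G nbudgets logceil slack word_level clip_eps big_len k (Dmin * 2 ^+ k) st2 by split.
apply: (wp_weaken (T := (scale_time G nbudgets logceil word_level + 4).+1) (Post := fun st' =>
   frame (process_scale ;; RSet ydel (RVar ydel +r RVar ydel)) st2 st' ->
   I k.+1 (set_wreg st' xk k.+1))) => //; last by lia.
have lev_le v : (word_level v <= logceil)%N by exact: level_le.
apply: wp_seq; apply: wp_weaken (scale_spec n_gt1 nW mW QW KW TW AW _ slack_gt0 lev_le clip_eps_gt0 kN dk se (ltnW NSW)) _ _ => //.
  by rewrite /nbudgets addn1.
move=> st3 [k3 i3 u3 o3] f3; apply: (@wp_den R W (RSet ydel (RVar ydel +r RVar ydel))) => // _.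
have d3 : rreg st3 ydel = Dmin * 2 ^+ k by case: f3 => _ ->.
split.
  by rewrite /= /upd /= d3 exprS; ring.
move=> k'; rewrite ltnS leq_eqVlt => /orP[/eqP ->|k'k] //.
have ne : k' != k by rewrite ltn_eqF.
have [t1 u1] := h2 k' k'k; split; last by rewrite /= o3.
by apply: tab_inv_ext t1 => q x y qQ; rewrite -k3.
Qed.

Definition pre_post st : Prop :=
  [/\ base_env st,
      forall z, (0 < z)%N -> (z < 2 ^ logceil)%N -> wmem st alg z = trunc_log 2 z &
      (totalwork <= CS * (2 ^ logceil * logceil))%N ->
      forall k, (k < nscales)%N -> scale_done st k].

Definition main_time : nat :=
  if (totalwork <= CS * (2 ^ logceil * logceil))%N then all_time else 1.

Definition pre_time : nat :=
  (pow_time + inf_time + draw_time + log_time + main_time + 200)%N.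

Lemma preprocess_spec :
  wp W (preprocess e0 c CS) pre_time pre_post (init_state G eps Dmin Dmax rs).
Proof.
set st0 := init_state _ _ _ _ _.
have al0 z : wmem st0 alg z = 0%N by [].
apply: (wp_weaken (T := (max_time copy_input + (pow_time +
  (max_time (set_constants e0 c) + (inf_time + (draw_time + (log_time +
    (bcost (guard CS) + main_time).+1).+1).+1).+1).+1).+1).+1) (Post := pre_post)) => //; last first.
  by rewrite /pre_time /=; lia.
apply: wp_seq; apply: wp_den => // f1.
have e1 := input_env_init; set st1 := den _ _ _ in f1 e1 *.
have k1 : wreg st1 xK = 0%N by rewrite /st1 /= /upd /= mod0n.
have p1 : wreg st1 xP = 1%N by rewrite /st1 /= /upd /= modn_small.
apply: wp_seq; apply: wp_weaken (pow_spec e1 k1 p1 (erefl _)) _ _ => //.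
move=> st2 [k2 p2 t2] f2.
have e2 : input_env st2 by apply: input_env_frame f2 _ _ _ e1.
apply: wp_seq; apply: wp_den => // f3.
have := constants_spec e2 k2 p2; set st3 := den _ _ _ in f3 * => -[c3 i3 s3 t3].
apply: wp_seq; apply: wp_weaken (inf_spec c3 i3 s3 _) _ _ => //; first by rewrite t3.
move=> st4 [i4 s4 t4] f4.
have b4 : base_env st4 by split=> //; apply: const_env_frame f4 _ _ _ c3.
apply: wp_seq; apply: wp_weaken (draw_levels_spec b4 s4 t4) _ _ => //.
move=> st5 [a5 s5] f5.
have b5 : base_env st5 by apply: base_env_frame f5 _ _ _ b4.
have al5 z : wmem st5 alg z = 0%N.
  have -> : wmem st5 alg = wmem st4 alg by case: f5 => _ _ ->.
  have -> : wmem st4 alg = wmem st3 alg by case: f4 => _ _ ->.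
  have -> : wmem st3 alg = wmem st2 alg by case: f3 => _ _ ->.
  by have -> : wmem st2 alg = wmem st1 alg by case: f2 => _ _ ->.
apply: wp_seq; apply: wp_weaken (log_table_spec b5 al5) _ _ => //.
move=> st6 l6 f6.
have b6 : base_env st6 by apply: base_env_frame f6 _ _ _ b5.
have a6 v : wmem st6 apw v = wmem st5 apw v by case: f6 => _ _ ->.
have s6 : wreg st6 xS = totalwork by case: f6 => ->.
apply: wp_if.
have [[_ [eK eP _] _ _] _] := b6.
have -> : beval W st6 (guard CS) = (totalwork <= CS * (2 ^ logceil * logceil))%N.
  by rewrite /= eK eP s6 (modn_small CSW) modnMmr modn_small.
case: ifPn => hw; last first.
  apply: wp_weaken (wp_den (c := Skip) (Post := fun st' => st' = st6) _ _) _ _ => //.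
    by rewrite /main_time (negbTE hw).
  by move=> st' ->; split=> // h; rewrite h in hw.
apply: wp_frame; apply: wp_weaken (all_scales_spec b6 _) _ _ => //.
- by move=> v; rewrite a6.
- by rewrite /main_time hw.
move=> st7 h7 f7; split=> //.
- by apply: base_env_frame f7 _ _ _ b6.
- by move=> z z0 zP; rewrite -l6 //; case: f7 => _ _ ->.
Qed.

End Preprocess.

Arguments logceil n : clear implicits.
Arguments slack n e0 : clear implicits.
Arguments nscales n c : clear implicits.
Arguments nbudgets {R} n eps e0.
Arguments scale_unit {R} n eps Dmin e0 k.

(** * Queries *)

(* D / Dmin, divided by powers of xP. *)
Local Notation yy := 8%N (only parsing).

(** A logarithm in constant time: at most [c] divisions bring [D / Dmin] below [P], each shifting
    the scale by [xK], the binary logarithm of [P]. As [c] is a constant, the loop is unrolled; the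
    table of logarithms does the rest. *)
Fixpoint reduce (j : nat) : cmd :=
  if j is j'.+1 then
    If (BRle (ROfWord (WVar xP)) (RVar yy))
      (RSet yy (RVar yy /r ROfWord (WVar xP)) ;; WSet xk (WVar xk +w WVar xK)) Skip ;;
    reduce j'
  else Skip.

Definition find_scale (c : nat) : cmd :=
  RSet yy (RVar 0 /r RVar 1) ;; WSet xk (WLit 0) ;; reduce c ;;
  Floor xz (RVar yy) ;; WSet xk (WVar xk +w WLoad alg (WVar xz)).

Definition look_up : cmd :=
  Floor xq (RVar 0 /r RLoad aU (WVar xk)) ;;
  WSet xq (WVar xq +w WVar xE) ;;
  RSet yc (RLoad aT (Tixd true (WVar xq) (WVar 0) (WVar 1))).

Definition give_answer : cmd :=
  If (BRle (RVar yinf) (RVar yc)) (WSet 0 (WLit 0))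
     (WSet 0 (WLit 1) ;; RSet 0 (RVar yc)).

Definition query (c : nat) : cmd := find_scale c ;; look_up ;; give_answer.

Lemma straight_reduce j : straight (reduce j).
Proof. by elim: j => //= j ->. Qed.

Lemma straight_query c : straight (query c).
Proof. by rewrite /= straight_reduce. Qed.

Lemma wmod_reduce j : {subset wmod (reduce j) <= [:: xk]}.
Proof. by elim: j => //= j IH x; rewrite !inE => /orP[->//|/IH]; rewrite inE. Qed.

Lemma rmod_reduce j : {subset rmod (reduce j) <= [:: yy]}.
Proof. by elim: j => //= j IH x; rewrite !inE => /orP[->//|/IH]; rewrite inE. Qed.

Lemma amod_reduce j : wamod (reduce j) = [::] /\ ramod (reduce j) = [::].
Proof. by elim: j => //= j [h1 h2]; split. Qed.

Section Query.
Context {R : realType} {n : nat} (G : digraph R n) (eps Dmin : R).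
Variables (W e0 c : nat).
Local Notation m := (nedges G).
Local Notation K := (logceil n).
Local Notation E := (slack n e0).
Local Notation Q1 := (nbudgets n eps e0).
Local Notation NS := (nscales n c).
Local Notation P := (2 ^ logceil n)%N.
Local Notation unit := (scale_unit n eps Dmin e0).
Implicit Types st : state R.

Hypothesis n_gt1 : (1 < n)%N.
Hypothesis nW : (n < W)%N.
Hypothesis QW : (Q1 < W)%N.
Hypothesis NSW : (NS < W)%N.
Hypothesis TW : (NS * Q1 * n * n <= W)%N.
Hypothesis PW : (P < W)%N.
Hypothesis e0_gt0 : (0 < e0)%N.
Hypothesis eps_gt0 : 0 < eps.
Hypothesis Dmin_gt0 : 0 < Dmin.

Definition query_env st : Prop :=
  [/\ wreg st xN = n, wreg st xQ = Q1,
      [/\ wreg st xK = K, wreg st xP = P & wreg st xE = E],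
      rreg st 1 = Dmin /\ rreg st yinf = big_len G &
      forall z, (0 < z)%N -> (z < P)%N -> wmem st alg z = trunc_log 2 z].

Lemma P_gt1 : (1 < P)%N.
Proof. by rewrite -{1}(expn0 2) ltn_exp2l // logceil_gt0. Qed.

(** The non-strict bound admits a quotient equal to [P ^+ j] and still suffices: for [j = 0] it
    gives at most 1, and [1 < P]. The second alternative covers a quotient that falls below [P]
    early. *)
Lemma reduce_spec D j st : wreg st xK = K -> wreg st xP = P ->
  1 <= rreg st yy -> rreg st yy <= P%:R ^+ j \/ rreg st yy < P%:R ->
  (wreg st xk + j * K <= c * K)%N -> D = rreg st yy * Dmin * 2 ^+ wreg st xk ->
  let st' := den W (reduce j) st in
  [/\ 1 <= rreg st' yy, rreg st' yy < P%:R, (wreg st' xk <= c * K)%N &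
      D = rreg st' yy * Dmin * 2 ^+ wreg st' xk].
Proof.
have P0 : 0 < P%:R :> R by rewrite ltr0n expn_gt0.
elim: j st => [|j IH] st hK hP y1 yP kc hD /=.
  split=> //; last by move: kc; rewrite mul0n addn0.
  case: yP => //; rewrite expr0 => /le_lt_trans; apply.
  by rewrite ltr1n P_gt1.
rewrite hP; case: (leP P%:R (rreg st yy)) => h; last first.
  by apply: IH => //; [right|rewrite mulSn in kc; lia].
have kW : ((wreg st xk + wreg st xK) %% W = wreg st xk + K)%N.
  rewrite hK modn_small //; apply: leq_ltn_trans NSW; rewrite /nscales.
  by move: kc; rewrite !mulSn; lia.
apply: IH => //=; rewrite /upd /= ?kW ?hP.
- by rewrite ler_pdivlMr // mul1r.
- case: yP => [h2|h2]; last by move: (le_lt_trans h h2); rewrite ltxx.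
  by left; rewrite ler_pdivrMr // -exprSr.
- by move: kc; rewrite mulSn; lia.
- rewrite hD exprD natrX; field.
  by rewrite expf_neq0.
Qed.

Lemma find_scale_spec D st : query_env st -> rreg st 0 = D -> Dmin <= D ->
  D / Dmin <= P%:R ^+ c ->
  let st' := den W (find_scale c) st in
  [/\ (wreg st' xk < NS)%N, Dmin * 2 ^+ wreg st' xk <= D &
      D < 2 * (Dmin * 2 ^+ wreg st' xk)].
Proof.
move=> [eN eQ [eK eP eE] [eD ei] hlg] e0D Dge Dle.
pose st1 := den W (RSet yy (RVar 0 /r RVar 1) ;; WSet xk (WLit 0)) st.
have y1E : rreg st1 yy = D / Dmin by rewrite /st1 /= /upd /= e0D eD.
have k1E : wreg st1 xk = 0%N by rewrite /st1 /= /upd /= mod0n.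
have := @reduce_spec D c st1 eK eP; rewrite y1E k1E.
case=> [||||]; rewrite ?add0n ?leqnn //.
- by rewrite ler_pdivlMr // mul1r.
- by left.
- by rewrite expr0 mulr1 divfK // gt_eqF.
set st2 := den W (reduce c) st1; set y := rreg st2 yy; set k := wreg st2 xk.
move=> y1 yP kc hD st'.
have fr : frame (reduce c) st1 st2.
  have [st3 [k3 [h3 _ <-]]] : wp W (reduce c) (max_time (reduce c))
      (fun st3 => st3 = st2) st1 by apply: wp_den => //; exact: straight_reduce.
  exact: exec_frame h3.
have lgE : wmem st2 alg = wmem st alg.
  by case: fr => _ _ -> //; have [-> _] := amod_reduce c.
pose z := Num.truncn y.
have /andP[zy yz] : (z%:R <= y < z.+1%:R) by apply: truncn_itv; lra.
have z0 : (0 < z)%N by rewrite -ltnS -(ltr_nat R); apply: le_lt_trans yz.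
have zP : (z < P)%N by rewrite -(ltr_nat R); apply: le_lt_trans yP.
have /andP[lo hi] := trunc_log_bounds (isT : 1 < 2)%N z0.
set l := trunc_log 2 z in lo hi.
have lK : (l < K)%N by rewrite -(ltn_exp2l _ _ (isT : 1 < 2)%N); apply: leq_ltn_trans zP.
have kl : (k + l < NS)%N by rewrite /nscales mulSn; lia.
have k'E : wreg st' xk = (k + l)%N.
  rewrite /st' /find_scale.
  have -> : den W (RSet yy (RVar 0 /r RVar 1) ;; WSet xk (WLit 0) ;; reduce c ;;
    Floor xz (RVar yy) ;; WSet xk (WVar xk +w WLoad alg (WVar xz))) st =
    den W (Floor xz (RVar yy) ;; WSet xk (WVar xk +w WLoad alg (WVar xz))) st2 by [].
  rewrite /= /upd /= -/y -/z (minn_idPl _); last first.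
    by rewrite -ltnS (ltn_predK PW) (ltn_trans zP).
  by rewrite lgE hlg // modn_small // (ltn_trans kl).
rewrite k'E; split=> //.
  rewrite hD exprD mulrA -/y mulrAC ler_pM2r ?exprn_gt0 //.
  rewrite mulrC ler_pM2r //; apply: le_trans zy.
  by rewrite -natrX ler_nat.
rewrite hD -/y -/k.
have -> : 2 * (Dmin * 2 ^+ (k + l)) = 2 ^+ l.+1 * Dmin * 2 ^+ k by rewrite exprD exprS; ring.
rewrite ltr_pM2r ?exprn_gt0 // ltr_pM2r //; apply: lt_le_trans yz _.
by rewrite -natrX ler_nat.
Qed.

Lemma frame_den c' st : straight c' -> frame c' st (den W c' st).
Proof.
move=> hs; have [st3 [k3 [h3 _ <-]]] : wp W c' (max_time c')
    (fun st3 => st3 = den W c' st) st by apply: wp_den.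
exact: exec_frame h3.
Qed.

Lemma scale_unit_gt0 k : 0 < unit k.
Proof.
rewrite divr_gt0 ?mulr_gt0 ?exprn_gt0 ?ltr0n ?slack_gt0 //; exact: clip_eps_gt0.
Qed.

Lemma query_spec D (s t : 'I_n) st : query_env st -> wreg st 0 = s -> wreg st 1 = t ->
  rreg st 0 = D -> Dmin <= D -> D / Dmin <= P%:R ^+ c ->
  (forall k, (k < NS)%N -> rmem st aU k = unit k) ->
  exists k f, [/\ (k < NS)%N, Dmin * 2 ^+ k <= D,
    f%:R * unit k <= D < f.+1%:R * unit k,  (f + E < Q1)%N &
    answer (den W (query c) st) =
      (let x := Tval Q1 st k (f + E) s t in
       if big_len G <= x then None else Some x)].
Proof.
move=> he hs ht hD Dge Dle hU.
have [eN eQ [eK eP eE] [eD ei] _] := he.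
have := find_scale_spec he hD Dge Dle.
set st1 := den W (find_scale c) st; set k := wreg st1 xk => -[kN lo hi].
have sf : straight (find_scale c) by rewrite /= straight_reduce.
have fr := frame_den st sf; rewrite -/st1 in fr.
have wf x : x \notin [:: xk; xz] -> x \notin wmod (find_scale c).
  move=> hx; rewrite /= !inE /wmod /= mem_cat !inE -/wmod.
  apply: contra hx; rewrite !inE => /or4P[->//|/wmod_reduce|->|->]; rewrite ?orbT //.
  by rewrite inE => ->.
have rf x : x \notin [:: yy] -> x \notin rmod (find_scale c).
  apply: contra; rewrite /rmod /= in_cons mem_cat.
  by case/orP=> [/eqP -> //|/orP[/rmod_reduce //|//]].
have raf : rmem st1 = rmem st.
  apply/funext => a; case: fr => _ _ _ -> //.
  by rewrite /ramod /=; have [_] := amod_reduce c; rewrite /ramod => ->.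
have [fw frr _ _] := fr.
have uk := scale_unit_gt0 k.
pose f := Num.truncn (D / unit k).
have D0 : 0 < D by apply: lt_le_trans Dge.
have /andP[f1 f2] : (f%:R <= D / unit k < f.+1%:R).
  by apply: truncn_itv; rewrite divr_ge0 // ltW.
have e1 := clip_eps_gt0 eps_gt0.
have E0 : 0 < E%:R :> R by rewrite ltr0n slack_gt0.
have fE : (f <= Num.truncn ((E + E)%N%:R / clip_eps eps))%N.
  apply: le_truncn; rewrite ler_pdivrMr //.
  have -> : (E + E)%N%:R / clip_eps eps * unit k = 2 * (Dmin * 2 ^+ k).
    by rewrite natrD /scale_unit; field; rewrite ?gt_eqF.
  exact: ltW.
have fQ : (f + E < Q1)%N by rewrite /nbudgets addn1 ltnS leq_add2r.
exists k, f; split=> //.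
  by rewrite -ler_pdivlMr // f1 -ltr_pdivrMr.
have s0 : wreg st1 0 = s by rewrite fw ?wf.
have t1 : wreg st1 1 = t by rewrite fw ?wf.
have n1 : wreg st1 xN = n by rewrite fw ?wf.
have Q1E : wreg st1 xQ = Q1 by rewrite fw ?wf.
have E1 : wreg st1 xE = E by rewrite fw ?wf.
have D1 : rreg st1 0 = D by rewrite frr ?rf.
have i1 : rreg st1 yinf = big_len G by rewrite frr ?rf.
have qE : den W (query c) st = den W (look_up ;; give_answer) st1 by [].
clearbody st1.
have fW : (f <= W.-1)%N.
  rewrite -ltnS (ltn_predK QW); apply: ltn_trans QW.
  by apply: leq_ltn_trans fQ; rewrite leq_addr.
pose st2 := set_wreg (set_wreg st1 xq f) xq (f + E)%N.
have st2E : den W (Floor xq (RVar 0 /r RLoad aU (WVar xk)) ;;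
    WSet xq (WVar xq +w WVar xE)) st1 = st2.
  rewrite /st2 /= D1 raf hU // -/f (minn_idPl fW).
  by rewrite /upd /= E1 modn_small // (ltn_trans fQ).
pose x := Tval Q1 st k (f + E) s t.
have xE : reval W st2 (RLoad aT (Tixd true (WVar xq) (WVar 0) (WVar 1))) = x.
  have ix : weval W st2 (Tixd true (WVar xq) (WVar 0) (WVar 1)) = tix Q1 n k (f + E) s t.
    rewrite -[RHS]/(if true then tix Q1 n k (f + E) s t else tix Q1 n k (f + E) t s).
    exact: (weval_Tixd nW TW).
  by rewrite /x /Tval -raf -ix.
have -> : den W (query c) st = den W give_answer (set_rreg st2 yc x).
  by rewrite qE -xE -st2E.
rewrite /give_answer; cbn [den].
have -> : beval W (set_rreg st2 yc x) (BRle (RVar yinf) (RVar yc)) = (big_len G <= x).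
  by rewrite /= /upd /= i1.
rewrite -/x; case: ifP => _; first by rewrite /answer /= /upd /= mod0n.
by rewrite /answer /= /upd /= modn_small // (leq_trans n_gt1) // ltnW.
Qed.

End Query.

(** * Correctness of the answers *)

Section Correctness.
Context {R : realType} {n : nat} (G : digraph R n).
Implicit Types (s t : 'I_n).

(** At level [K] both gaps are at most [2 ^ K], so their term is at most 2. With [K.+1] units and
    two gap costs the sum is [16 * g * K + K + 3], which is at most [(16 * g + 5) * K - 1] because
    [0 < K]. This is the origin of [e0]. *)
Lemma err_gap_cost (lev : 'I_n -> nat) K g (u : R) vs : 0 <= u -> (0 < K)%N ->
  uniq vs -> (n <= 2 ^ K)%N ->
  gap_cost K lev 0 vs <= (8 * g * K)%:R :> R ->
  gap_cost K lev 0 (rev vs) <= (8 * g * K)%:R :> R ->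
  err lev K u 0 vs <= (((16 * g + 5) * K).-1)%:R * u.
Proof.
move=> u0 K0 uvs nK h1 h2.
have errE : err lev K u 0 vs = u * (K.+1%:R + gap_cost K lev 0 vs +
    gap_cost K lev 0 (rev vs) + (gap lev K vs + gap lev K (rev vs))%:R / 2 ^+ K).
  rewrite /err big_split /= sumr_const_nat subn0 -[u *+ _]mulr_natr.
  rewrite big_nat_recr //= /gap_cost !mulrDr -!addrA; congr (_ + _).
  rewrite addrA !mulr_sumr -big_split /=; congr (_ + _); last by ring.
  by apply: eq_bigr => j _; rewrite natrD; ring.
have sz : (size vs <= n)%N.
  by move/card_uniqP: uvs => <-; rewrite -[X in (_ <= X)%N]card_ord max_card.
have hK : (gap lev K vs + gap lev K (rev vs))%:R / 2 ^+ K <= 2 :> R.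
  rewrite ler_pdivrMr ?exprn_gt0 // -natrX -natrM ler_nat mul2n -addnn leq_add //.
    by apply: leq_trans (find_size _ _) _; apply: leq_trans nK.
  by apply: leq_trans (find_size _ _) _; rewrite size_rev; apply: leq_trans nK.
rewrite errE mulrC ler_wpM2r //.
apply: le_trans (_ : K.+1%:R + (8 * g * K)%:R + (8 * g * K)%:R + 2%:R <= _).
  by apply: lerD => //; apply: lerD => //; apply: lerD.
rewrite -!natrD ler_nat; nia.
Qed.

(** Cell [f + E] offers [f.+1] units that cover [D] and [E.-1] that cover the error. Conversely its
    path has delay at most [D + E * u], and [E * u = eps' * delta <= eps * D]. A stored value of at
    least [big_len] rules out any path within [D], since a simple one would be shorter. *)
Lemma answer_ok (lev : 'I_n -> nat) K Q1 E (eps eps' u delta D : R) T s t f :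
  0 < u -> 0 < eps -> eps' <= eps -> u = eps' * delta / E%:R -> (0 < E)%N ->
  tab_inv G lev K Q1 u (big_len G) 0 T -> delta <= D -> 0 <= eps' -> 0 <= delta ->
  f%:R * u <= D < f.+1%:R * u -> (f + E < Q1)%N ->
  ((exists p : seq 'I_(nedges G), is_path s t p /\ pdel p <= f.+1%:R * u) ->
   exists p : seq 'I_(nedges G), [/\ is_path s t p, pdel p <= f.+1%:R * u, uniq (verts s p),
     forall p' : seq 'I_(nedges G), is_path s t p' -> pdel p' <= f.+1%:R * u -> plen p <= plen p' &
     err lev K u 0 (verts s p) <= E.-1%:R * u]) ->
  correct_answer G eps s t D
    (let x := T (f + E)%N s t in if big_len G <= x then None else Some x).
Proof.
move=> u0 e0 ee uE E0 [hS _ hC] dD e'0 d0 /andP[f1 f2] fQ hmin.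
set x := T _ s t.
have up (p : seq 'I_(nedges G)) : is_path s t p -> pdel p <= D -> x <= plen p /\ x < big_len G.
  move=> hp dp; have [|p' [hp' dp' up' mp' ep']] := hmin.
    by exists p; split=> //; apply: le_trans dp _; exact: ltW.
  have xp' : x <= plen p'.
    apply: (hC s t p' hp' isT) => //.
    apply: le_trans (lerD dp' ep') _.
    by rewrite -mulrDl -natrD addSnnS prednK.
  split; first by apply: le_trans xp' _; apply: mp' => //; apply: le_trans dp _; exact: ltW.
  apply: le_lt_trans xp' _; apply: le_lt_trans (plen_simple up') _.
  by rewrite /big_len ltrDr.
rewrite /=; case: (leP (big_len G) x) => hx.
  rewrite /correct_answer /dist.
  have -> : [set x0 | exists p : seq 'I_(nedges G), [/\ is_path s t p, pdel p <= D & x0 = (plen p)%:E]]%classic = set0.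
    rewrite -subset0 => y [p [hp dp _]].
    by have [_ h] := up p hp dp; move: (le_lt_trans hx h); rewrite ltxx.
  exact: ereal_inf0.
case: (hS (f + E)%N s t fQ) => [h|[p [hp lp dp]]].
  by move: (le_lt_trans h hx); rewrite ltxx.
exists p; split=> //.
  rewrite lp; apply: le_ereal_inf_tmp => y [p' [hp' dp' ->]].
  by rewrite lee_fin; have [] := up p' hp' dp'.
apply: le_trans dp _; rewrite natrD mulrDl mulrDl mul1r; apply: lerD => //.
rewrite uE mulrC divfK ?pnatr_eq0 -?lt0n //.
exact: ler_pM.
Qed.

End Correctness.

(** * Running time *)

Section Time.
Context {R : realType} {n : nat} (G : digraph R n).
Local Notation m := (nedges G).
Local Open Scope nat_scope.

Lemma run_time_le Q1 i : 0 < n -> 0 < Q1 ->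
  run_time G Q1 (nrows Q1 i) <= 250 * (Q1 * (n + m)) * 2 ^ i.
Proof.
move=> n0 Q0; rewrite /run_time /nrows.
have p0 : 0 < 2 ^ i by rewrite expn_gt0.
set p := 2 ^ i in p0 *.
have h1 : (Q1.-1 * p).+1 <= Q1 * p by nia.
set a := n + m; set NB := (Q1.-1 * p).+1 in h1 *.
have b1 : (n * 70 + 8 + (m * 110 + 8)).+1 + 10 <= 140 * a by rewrite /a; lia.
have b2 : n * (60 + 10) + 8 + 10 <= 90 * a by rewrite /a; lia.
have a0 : 0 < a by rewrite /a; lia.
have X0 : 1 <= Q1 * p * a by nia.
have c1 : NB * ((n * 70 + 8 + (m * 110 + 8)).+1 + 10) <= 140 * (Q1 * p * a).
  by apply: leq_trans (leq_mul h1 b1) _; nia.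
have c2 : Q1 * (n * (60 + 10) + 8 + 10) <= 90 * (Q1 * p * a).
  by apply: leq_trans (leq_mul (leqnn Q1) b2) _; nia.
have -> : 250 * (Q1 * a) * p = 250 * (Q1 * p * a) by nia.
lia.
Qed.

(** Each vertex is run at exactly one level, so the double sum collapses to the sum of [2 ^ lev v];
    the other terms pay for level tests and loops. *)
Lemma levels_time_le (lev : 'I_n -> nat) K Q1 : 0 < n -> 0 < Q1 ->
  (forall v, lev v <= K) ->
  levels_time G Q1 K lev <=
    500 * (Q1 * (n + m)) * (\sum_(v < n) 2 ^ lev v) + K.+1 * (30 * n + 110) + 8.
Proof.
move=> n0 Q0 hl; rewrite /levels_time leq_add2r.
set B := 500 * (Q1 * (n + m)).
have hv i v : vertex_time G Q1 lev i v + 10 <= B * ((lev v == i) * 2 ^ lev v) + 30.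
  rewrite /vertex_time; case: eqP => [->|_]; last by lia.
  have := run_time_le i n0 Q0; rewrite /B mul1n; set r := run_time _ _ _.
  move=> h; nia.
apply: (@leq_trans (\sum_(j < K.+1) (B * (\sum_(v < n) (lev v == K - j) * 2 ^ lev v)
    + (30 * n + 110)))).
  apply: leq_sum => j _; rewrite /level_time.
  have : \sum_(v < n) (vertex_time G Q1 lev (K - j) v + 10) <=
      \sum_(v < n) (B * ((lev v == K - j) * 2 ^ lev v) + 30).
    by apply: leq_sum => v _; exact: hv.
  have -> : \sum_(v < n) (B * ((lev v == K - j) * 2 ^ lev v) + 30) =
      B * (\sum_(v < n) (lev v == K - j) * 2 ^ lev v) + n * 30.
    by rewrite big_split /= -big_distrr /= sum_nat_const card_ord.
  lia.
rewrite big_split /= sum_nat_const card_ord leq_add2r -big_distrr /= leq_mul2l.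
apply/orP; right; rewrite exchange_big /=; apply: leq_sum => v _.
rewrite -big_distrl /= -[leqRHS]mul1n leq_mul2r; apply/orP; right.
have h : K - lev v < K.+1 by rewrite ltnS leq_subr.
rewrite (bigD1 (Ordinal h)) //= big1 => [|j jne].
  by rewrite addn0 leq_b1.
have hK := hl v; have jK := ltn_ord j.
apply/eqP; rewrite eqb0; apply: contra jne => /eqP e.
by apply/eqP/val_inj => /=; lia.
Qed.

Lemma init_time_le Q1 : 0 < n -> 0 < Q1 -> @init_time n Q1 <= 122 * (Q1 * n * n).
Proof.
move=> n0 Q0; rewrite /init_time.
have h1 : n * (60 + 10) + 8 + 10 <= 88 * n by lia.
have h2 : n * (n * (60 + 10) + 8 + 10) + 8 + 10 <= 106 * (n * n).
  by have := leq_mul (leqnn n) h1; nia.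
have Y1 : 0 < Q1 * n * n by rewrite !muln_gt0 Q0 n0.
have := leq_mul (leqnn Q1) h2.
have -> : Q1 * (106 * (n * n)) = 106 * (Q1 * n * n) by ring.
lia.
Qed.

Variables (eps : R) (e0 c CS : nat) (rs : seq nat).
Local Notation K := (logceil n).
Local Notation Q1 := (nbudgets n eps e0).

(** Also the length of the tape, hence the need for [n_le_time_bound]. *)
Definition time_bound : nat :=
  c.+1 * (1000 * CS + 2000) * (K * (n * (n + m) * K * Q1)).

Lemma pre_time_le : 1 < n -> pre_time G eps e0 c CS rs <= time_bound.
Proof.
move=> n1.
have Q0 : 0 < Q1 by rewrite /nbudgets addn1.
have K0 := logceil_gt0 n1.
have Pn : 2 ^ K <= 2 * n.
  rewrite -(prednK K0) expnS leq_mul2l /=; apply: ltnW.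
  exact: up_log_gtn.
have n0 : 0 < n by lia.
set X := n * (n + m) * K * Q1.
have X1 : 1 <= X by rewrite !muln_gt0 n0 K0 Q0 addn_gt0 n0.
have a0 : 0 < n + m by rewrite addn_gt0 n0.
have nX : n <= X by rewrite /X -!mulnA leq_pmulr // !muln_gt0 a0 K0.
have KnX : K * n <= X.
  have -> : X = K * n * ((n + m) * Q1) by rewrite /X; ring.
  by rewrite leq_pmulr // muln_gt0 a0.
have mX : m <= X.
  have -> : X = (n + m) * (n * K * Q1) by rewrite /X; ring.
  by apply: leq_trans (leq_addl n m) _; rewrite leq_pmulr // !muln_gt0 n0 K0.
have QX : Q1 * n * n <= X.
  have -> : X = Q1 * n * ((n + m) * K) by rewrite /X; ring.
  by rewrite leq_mul2l; apply/orP; right; apply: leq_trans (leq_addr m n) _; rewrite leq_pmulr.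
have KX : X <= K * X by rewrite leq_pmull.
have mainX : main_time G eps e0 c CS rs <= c.+1 * (1000 * CS + 560) * (K * X) + 20.
  rewrite /main_time; case: ifP => hw; last by lia.
  have lev_le (v : 'I_n) : word_level rs v <= K by exact: level_le.
  have i1 := init_time_le n0 Q0.
  have l1 := levels_time_le n0 Q0 lev_le.
  rewrite -/(@totalwork n rs) in l1.
  have w1 : @totalwork n rs <= CS * (2 * n * K).
    by apply: leq_trans hw _; rewrite leq_mul2l leq_mul2r Pn !orbT.
  have l2 : 500 * (Q1 * (n + m)) * @totalwork n rs <= 1000 * CS * X.
    apply: leq_trans (leq_mul (leqnn _) w1) _; rewrite /X.
    by apply: eq_leq; ring.
  have l3 : K.+1 * (30 * n + 110) <= 170 * (K * n) + 170 * n by nia.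
  rewrite /all_time /scale_time /nscales.
  set S := init_time _ + _ + _.
  have S1 : S <= (1000 * CS + 512) * X.
    by rewrite /S mulnDl; move: i1 l1 l2 l3; lia.
  have -> : c.+1 * (1000 * CS + 560) * (K * X) = c.+1 * K * ((1000 * CS + 560) * X) by ring.
  rewrite leq_add2r leq_mul2l; apply/orP; right.
  by move: S1; rewrite !mulnDl; lia.
rewrite /pre_time /time_bound -/X.
have e1 : @pow_time n + inf_time G + @draw_time n + @log_time n + 220 <= 700 * (K * X).
  rewrite /pow_time /inf_time /draw_time /double_time /log_time.
  by move: nX KnX mX KX X1 Pn; set Y := K * X; nia.
have e2 : c.+1 * (1000 * CS + 560) * (K * X) + 700 * (K * X) <=
    c.+1 * (1000 * CS + 2000) * (K * X).
  by rewrite -mulnDl leq_mul2r; apply/orP; right; nia.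
by move: e1 e2 mainX; lia.
Qed.

Lemma n_le_time_bound : 1 < n -> n <= time_bound.
Proof.
move=> n1; rewrite /time_bound.
have Q0 : 0 < Q1 by rewrite /nbudgets addn1.
have K0 := logceil_gt0 n1.
have a0 : 0 < n + m by lia.
apply: (@leq_trans (K * (n * (n + m) * K * Q1))); last by rewrite leq_pmull // muln_gt0 addnS.
have -> : K * (n * (n + m) * K * Q1) = n * (K * (n + m) * K * Q1) by ring.
by rewrite leq_pmulr // !muln_gt0 K0 a0.
Qed.

End Time.

(** * Bounds on words and probabilities *)

Section Bounds.
Context {R : realType}.
Variables (n c e0 : nat) (eps : R).
Hypothesis n_gt1 : (1 < n)%N.
Hypothesis eps_gt0 : 0 < eps.
Hypothesis e0_gt0 : (0 < e0)%N.
Local Notation K := (logceil n).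
Local Notation P := (2 ^ logceil n)%N.
Local Notation ieps := (Num.max 1 eps^-1).

Lemma ln2_ge_half : 2^-1 <= ln 2 :> R.
Proof.
rewrite -ler_expR lnK ?posrE //.
apply: le_trans (expR_le_inv _) _; first by lra.
by rewrite (_ : 1 - 2^-1 = 2^-1) ?invrK //; lra.
Qed.

Lemma ln_ge_half : 2^-1 <= ln n%:R :> R.
Proof.
apply: le_trans ln2_ge_half _; rewrite ler_ln ?posrE ?ltr0n ?ler_nat //.
exact: ltnW.
Qed.

(** From [2 ^ K.-1 < n] and [ln 2 >= 1/2] one gets [K.-1 <= 2 * ln n]; the missing 1 is at most
    [2 * ln n] as well. *)
Lemma logceil_le_ln : K%:R <= 4 * ln n%:R :> R.
Proof.
have h := ln_ge_half; have K0 := logceil_gt0 n_gt1.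
have lt : (2 ^ K.-1 < n)%N by exact: up_log_gtn.
have : ln (2 ^+ K.-1) <= ln n%:R :> R.
  by rewrite ler_ln ?posrE ?exprn_gt0 ?ltr0n // -?natrX ?ler_nat ltnW // ltnW.
rewrite lnXn // -[_ *+ K.-1]mulr_natr => h1.
have h2 := ln2_ge_half.
have e : K%:R = K.-1%:R + 1 :> R by rewrite natr1 prednK.
have k0 : 0 <= K.-1%:R :> R by rewrite ler0n.
have h3 := ler_wpM2l k0 h2; rewrite mulrC in h1.
have h4 := le_trans h3 h1; rewrite e; lra.
Qed.

Lemma inv_clip_eps : (clip_eps eps)^-1 = ieps.
Proof.
rewrite /clip_eps; case: leP => h.
  by rewrite invr1 max_l // invf_le1.
by rewrite max_r // invf_ge1 // ltW.
Qed.

Lemma ieps_ge1 : 1 <= ieps.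
Proof. by rewrite le_max lexx. Qed.

Lemma nbudgets_le : (nbudgets n eps e0)%:R <= 4 * e0%:R * K%:R * ieps.
Proof.
have i1 := ieps_ge1.
have E1 : 1 <= (slack n e0)%:R :> R by rewrite ler1n slack_gt0.
have EE : (slack n e0)%:R = e0%:R * K%:R :> R by rewrite /slack natrM.
have tr : (Num.truncn ((slack n e0 + slack n e0)%:R / clip_eps eps))%:R <=
    (slack n e0 + slack n e0)%:R / clip_eps eps :> R.
  have h0 : 0 <= (slack n e0 + slack n e0)%:R / clip_eps eps :> R.
    by rewrite divr_ge0 // ltW // clip_eps_gt0.
  by have /andP[] := truncn_itv h0.
rewrite /nbudgets; set tr' := Num.truncn _ in tr *.
rewrite !natrD; rewrite inv_clip_eps natrD in tr.
apply: le_trans (lerD (lerD tr (lexx _)) (lexx _)) _.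
rewrite -[4 * _ * _]mulrA -EE; nra.
Qed.

Lemma time_bound_prep (G : digraph R n) CS :
  (time_bound G eps e0 c CS)%:R <=
  (c.+1 * (1000 * CS + 2000) * (1024 * e0))%:R * prep_bound n (nedges G) eps.
Proof.
have i1 := ieps_ge1.
set A := (c.+1 * _)%N; rewrite /time_bound -/A !(natrM _ A) -mulrA.
apply: ler_wpM2l; first by rewrite ler0n.
have l1 := ln_ge_half; have k1 := logceil_le_ln; have q1 := nbudgets_le.
rewrite /prep_bound !natrM natrD.
set l := ln n%:R in l1 k1 *; set i := ieps in i1 q1 *.
set N := n%:R; set M := (nedges G)%:R; set k := K%:R in k1 q1 *.
set q := (nbudgets _ _ _)%:R in q1 *; set e := e0%:R in q1 *.
have N0 : 0 <= N by rewrite ler0n.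
have M0 : 0 <= M by rewrite ler0n.
have k0 : 0 <= k by rewrite ler0n.
have e00 : 0 <= e by rewrite ler0n.
have l0 : 0 <= l by lra.
have i0 : 0 <= i by lra.
have k3 : k ^+ 3 <= (4 * l) ^+ 3 by rewrite lerXn2r ?nnegrE // mulr_ge0.
have h1 : k * (N * (N + M) * k * q) <= 4 * e * i * (N * (N + M)) * (4 * l) ^+ 3.
  apply: le_trans (_ : k * (N * (N + M) * k * (4 * e * k * i)) <= _).
    by rewrite !ler_wpM2l // !mulr_ge0 // addr_ge0.
  have -> : k * (N * (N + M) * k * (4 * e * k * i)) = 4 * e * i * (N * (N + M)) * k ^+ 3 by ring.
  by rewrite ler_wpM2l // !mulr_ge0 // addr_ge0.
apply: le_trans h1 _.
(* The first power of 1/eps is absorbed by the second, and log^3 by log^5, as [ln n >= 1/2]. The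
   constant 1024 consists of this 4, the 4 of [nbudgets_le] and the [4 ^ 3] of [logceil_le_ln]. *)
have h2 : N ^+ 2 * l ^+ 3 * i <= 4 * (N ^+ 2 * l ^+ 5 * i ^+ 2).
  have -> : 4 * (N ^+ 2 * l ^+ 5 * i ^+ 2) = N ^+ 2 * l ^+ 3 * i * (4 * l ^+ 2 * i) by ring.
  rewrite ler_peMr ?mulr_ge0 ?exprn_ge0 //.
  have h3 : 1 <= 4 * l ^+ 2 by rewrite expr2; nra.
  by rewrite mulr_ege1.
have h4 : 0 <= M * N * l ^+ 3 * i by rewrite !mulr_ge0 ?exprn_ge0.
have -> : 4 * e * i * (N * (N + M)) * (4 * l) ^+ 3 =
   256 * e * (M * N * l ^+ 3 * i + N ^+ 2 * l ^+ 3 * i) by ring.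
have -> : 1024%:R * e = 256 * e * 4 :> R by ring.
rewrite -[leRHS]mulrA ler_wpM2l ?mulr_ge0 //; lra.
Qed.

Local Open Scope nat_scope.

Hypothesis epsc : (eps^-1 <= n%:R ^+ c)%R.

Lemma nbudgets_le_pow : nbudgets n eps e0 <= 4 * e0 * P ^ c.+1.
Proof.
have nP : n <= P by exact: leq_exp_logceil.
have h : (ieps <= P%:R ^+ c)%R.
  have Pc : (n%:R ^+ c <= P%:R ^+ c :> R)%R by rewrite lerXn2r ?nnegrE ?ler0n // ler_nat.
  rewrite ge_max (le_trans epsc Pc) andbT exprn_ege1 // ler1n expn_gt0 //.
have KP : (K%:R <= P%:R :> R)%R by rewrite ler_nat ltnW // ltn_expl.
rewrite -(ler_nat R); apply: le_trans nbudgets_le _.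
rewrite expnS mulnA !natrM [X in (_ <= _ * X)%R]natrX.
apply: ler_pM => //; first by rewrite le_max ler01.
by rewrite ler_wpM2l // mulr_ge0 ?ler0n.
Qed.

Section Failure.
Variables (a g : nat).
Hypothesis e0E : e0 = 16 * g + 5.
Hypothesis gE : g = (a + c + 5) + (20 + a + 2 * c).

(** Of the exponent [g], the part [a + c + 5] pays for the powers of [P] in the number of events and
    for [n ^ a]. The rest pays for the factor [11 * e0 * c.+1], which depends on [g] through [e0],
    but only linearly. *)
Lemma failure_bound :
  ((2 * (nscales n c * (nbudgets n eps e0).+1 * n * n)%:R * 2 ^+ K + 1) * 2 ^- (g * K)
    <= (n%:R ^+ a)^-1 :> R)%R.
Proof.
have nP : n <= P by exact: leq_exp_logceil.
have KP : K <= P by exact/ltnW/ltn_expl.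
have P0 : 0 < P by rewrite expn_gt0.
have n0 : (0 < n%:R :> R)%R by rewrite ltr0n ltnW.
rewrite ler_pdivrMr ?exprn_gt0 // ler_pdivlMl ?exprn_gt0 // mulrC.
rewrite -!natrX -!natrM natr1 -natrM ler_nat.
rewrite (mulnC g) expnM.
have na : n ^ a <= P ^ a by case: (a) => // a'; rewrite leq_exp2r.
have I1 : nscales n c * (nbudgets n eps e0).+1 * n * n <= 5 * e0 * c.+1 * P ^ (c + 4).
  apply: (@leq_trans (c.+1 * P * (5 * e0 * P ^ c.+1) * P * P)).
    rewrite !leq_mul //; apply: (@leq_trans (4 * e0 * P ^ c.+1 + 1)).
      by rewrite addn1 ltnS; exact: nbudgets_le_pow.
    have : 0 < P ^ c.+1 by rewrite expn_gt0 P0.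
    nia.
  by apply: eq_leq; rewrite addnC !expnS; ring.
have I2 : (2 * (nscales n c * (nbudgets n eps e0).+1 * n * n) * P).+1 <= 11 * e0 * c.+1 * P ^ (c + 5).
  have -> : P ^ (c + 5) = P ^ (c + 4) * P by rewrite addnS expnSr.
  have := leq_mul I1 (leqnn P).
  have -> : 5 * e0 * c.+1 * P ^ (c + 4) * P = 5 * (e0 * c.+1 * (P ^ (c + 4) * P)) by ring.
  have -> : 11 * e0 * c.+1 * (P ^ (c + 4) * P) = 11 * (e0 * c.+1 * (P ^ (c + 4) * P)) by ring.
  have : 0 < e0 * c.+1 * (P ^ (c + 4) * P) by rewrite !muln_gt0 e0_gt0 expn_gt0 P0.
  rewrite -mulnA; set X := (_ * _)%N; set Y := (_ * P)%N; lia.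
apply: leq_trans (leq_mul I2 na) _.
have c2 : c.+1 <= 2 ^ c by exact: ltn_expl.
have a2 : a.+1 <= 2 ^ a by exact: ltn_expl.
have -> : P ^ g = P ^ (20 + a + 2 * c) * (P ^ (c + 5) * P ^ a).
  by rewrite -!expnD gE; congr (_ ^ _); lia.
rewrite -mulnA leq_mul2r; apply/orP; right.
apply: (@leq_trans (2 ^ (20 + a + 2 * c))); last first.
  by case: (20 + _ + _) => // z; rewrite leq_exp2r // P_gt1.
have -> : 2 ^ (20 + a + 2 * c) = 2 ^ 20 * 2 ^ a * (2 ^ c * 2 ^ c).
  by rewrite !expnD muln1.
apply: (@leq_trans (2 ^ 13 * a.+1 * (c.+1 * c.+1))); last first.
  by rewrite !leq_mul // leq_exp2l.
have h1 : 16 * g + 5 <= 16 * (32 * (a.+1 * c.+1)) by rewrite gE; nia.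
rewrite e0E (_ : 2 ^ 13 = 16 * (16 * 32)); last first.
  by rewrite -[16]/(2 ^ 4) -[32]/(2 ^ 5) -!expnD.
have -> : 16 * (16 * 32) * a.+1 * (c.+1 * c.+1) =
    16 * (16 * (32 * (a.+1 * c.+1))) * c.+1 by ring.
by rewrite leq_mul2r; apply/orP; right; apply: leq_mul.
Qed.

End Failure.

Variables (CS kappa : nat).
Local Notation B := (4 * e0 * c.+1 + CS + c + 2).
Hypothesis kappaE : kappa = B + c + 2.
Local Notation W := (2 ^ (kappa.+3 * logceil n)).

(** [W] splits as [P ^ B.+1 * P ^ (c + 4)]: the first factor absorbs constants up to [B], the second
    the polynomial part. *)
Lemma lt_word_bound x a e : x <= a * P ^ e -> a <= B -> e <= c + 4 -> x < W.
Proof.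
move=> xa aB ec; apply: leq_ltn_trans xa _.
have P1 : 1 < P by exact: P_gt1.
have -> : W = P ^ (B.+1) * P ^ (c + 4).
  by rewrite -expnD mulnC expnM; congr (_ ^ _); rewrite kappaE; lia.
have lB : a < P ^ B.+1.
  apply: leq_ltn_trans aB _; apply: (@leq_trans (2 ^ B.+1)).
    by apply/ltnW/ltn_expl.
  by rewrite leq_exp2r.
apply: (@leq_trans (P ^ B.+1 * P ^ e)).
  by rewrite ltn_pmul2r // expn_gt0 ltnW.
by rewrite leq_mul2l leq_exp2l // ec orbT.
Qed.

Lemma word_bounds (G : digraph R n) :
  [/\ [/\ nedges G < W, nbudgets n eps e0 < W, K.+1 < W & nscales n c < W],
      [/\ nscales n c * nbudgets n eps e0 * n * n <= W,
          ((nbudgets n eps e0).-1 * P).+1 * n < W & n * P < W],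
      [/\ CS * (P * K) < W & slack n e0 + slack n e0 < W] &
      [/\ e0 < W, c.+1 < W & CS < W]].
Proof.
have nP : n <= P by exact: leq_exp_logceil.
have KP : K < P by exact: ltn_expl.
have Q1P := nbudgets_le_pow; have P1 : 1 < P by exact: P_gt1.
have e1 : e0 <= 4 * e0 * c.+1 by nia.
have e4 : 4 * e0 <= 4 * e0 * c.+1 by nia.
have mn : nedges G <= n * n.
  by have := leq_card _ (@ends_inj R n G); rewrite card_prod !card_ord.
split; split.
- by apply: (@lt_word_bound _ 1 2); [rewrite mul1n -mulnn; nia|lia|lia].
- by apply: (lt_word_bound Q1P); lia.
- by apply: (@lt_word_bound _ 1 1); [rewrite mul1n expn1|lia|lia].
- by apply: (@lt_word_bound _ c.+1 1); [rewrite /nscales expn1 leq_mul2l ltnW ?orbT|lia|lia].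
- apply/ltnW/(@lt_word_bound _ (4 * e0 * c.+1) (c + 4)); [|lia|lia].
  apply: (@leq_trans (c.+1 * P * (4 * e0 * P ^ c.+1) * P * P)).
    by rewrite !leq_mul // ltnW.
  by apply: eq_leq; rewrite addnC !expnS; ring.
- apply: (@lt_word_bound _ (4 * e0) (c + 3)); [|lia|lia].
  apply: (@leq_trans (nbudgets n eps e0 * P * n)).
    rewrite leq_mul2r; apply/orP; right.
    by rewrite ltn_pmul2r ?expn_gt0 // /nbudgets addn1.
  apply: (@leq_trans (4 * e0 * P ^ c.+1 * P * P)); first by rewrite !leq_mul.
  by apply: eq_leq; rewrite addnC !expnS; ring.
- by apply: (@lt_word_bound _ 1 2); [rewrite mul1n -mulnn leq_mul2r nP orbT|lia|lia].
- by apply: (@lt_word_bound _ CS 2); [rewrite leq_mul2l -mulnn leq_mul2l (ltnW KP) !orbT|lia|lia].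
- by apply: (@lt_word_bound _ (2 * e0) 1); [rewrite /slack expn1; nia|lia|lia].
- by apply: (@lt_word_bound _ e0 0); [rewrite muln1|lia|lia].
- by apply: (@lt_word_bound _ c.+1 0); [rewrite muln1|lia|lia].
- by apply: (@lt_word_bound _ CS 0); [rewrite muln1|lia|lia].
Qed.

End Bounds.

(** * The data structure *)

Lemma wmod_query c x : x \notin [:: xk; xz; xq; 0%N] -> x \notin wmod (query c).
Proof.
apply: contra.
have -> : wmod (query c) =
    (xk :: wmod (reduce c) ++ [:: xz; xk]) ++ [:: xq; xq; 0%N; 0%N] by [].
rewrite mem_cat in_cons mem_cat.
case/orP=> [/or3P[/eqP -> //|/wmod_reduce|]|]; rewrite !inE; first by move=> ->.
  by case/orP=> ->; rewrite ?orbT.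
by case/or4P=> ->; rewrite ?orbT.
Qed.

Lemma rmod_query c x : x \notin [:: yy; yc; 0%N] -> x \notin rmod (query c).
Proof.
apply: contra.
have -> : rmod (query c) = (yy :: rmod (reduce c) ++ [::]) ++ [:: yc; 0%N] by [].
rewrite mem_cat in_cons cats0.
case/orP=> [/orP[/eqP -> //|/rmod_reduce]|]; rewrite !inE; first by move=> ->.
by case/orP=> ->; rewrite ?orbT.
Qed.

Lemma amod_query c : wamod (query c) = [::] /\ ramod (query c) = [::].
Proof.
rewrite /wamod /ramod /=; have [h1 h2] := amod_reduce c.
by rewrite /wamod /ramod in h1 h2; rewrite h1 h2.
Qed.

Section BestPath.
Context {R : realType} {n : nat} (G : digraph R n).

(** Chosen from the graph alone, hence independent of the tape, as the union bound requires; [[::]]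
    is a default for budgets that no path meets. *)
Definition best_path (s t : 'I_n) (D : R) : seq 'I_(nedges G) :=
  if pselect (exists p : seq 'I_(nedges G), is_path s t p /\ pdel p <= D) is left h
  then sval (cid (min_path h)) else [::].

Lemma best_pathP s t D :
  (exists p : seq 'I_(nedges G), is_path s t p /\ pdel p <= D) ->
  [/\ is_path s t (best_path s t D), pdel (best_path s t D) <= D,
      uniq (verts s (best_path s t D)) &
      forall p' : seq 'I_(nedges G), is_path s t p' -> pdel p' <= D -> plen (best_path s t D) <= plen p'].
Proof.
by move=> h; rewrite /best_path; case: pselect => // h'; case: cid.
Qed.

End BestPath.

Lemma tape_prob_le (R : realType) W L (P Q : L.-tuple 'I_W -> Prop) :
  (forall r, P r -> Q r) -> tape_prob R P <= tape_prob R Q.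
Proof.
move=> PQ; rewrite /tape_prob ler_wpM2r ?invr_ge0 ?ler0n // ler_nat.
apply/subset_leq_card/fintype.subsetP => r; rewrite !inE => /asboolP h.
by apply: PQ; exact/asboolP.
Qed.

Section DataStructure.
Context {R : realType} {n : nat} (G : digraph R n) (eps Dmin Dmax : R).
Variables (W e0 c g : nat).
Local Notation K := (logceil n).
Local Notation E := (slack n e0).
Local Notation Q1 := (nbudgets n eps e0).
Local Notation NS := (nscales n c).
Local Notation unit := (scale_unit n eps Dmin e0).
Hypothesis n_gt1 : (1 < n)%N.
Hypothesis nW : (n < W)%N.
Hypothesis QW : (Q1 < W)%N.
Hypothesis NSW : (NS < W)%N.
Hypothesis TW : (NS * Q1 * n * n <= W)%N.
Hypothesis PW : (2 ^ K < W)%N.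
Hypothesis e0E : e0 = (16 * g + 5)%N.
Hypothesis eps_gt0 : 0 < eps.
Hypothesis Dmin_gt0 : 0 < Dmin.
Hypothesis Dc : Dmax / Dmin <= n%:R ^+ c.
Variable rs : seq nat.
Local Notation lev := (@word_level n rs).

Definition ready st : Prop :=
  query_env G eps Dmin e0 st /\ forall k, (k < NS)%N -> scale_done G eps Dmin e0 rs st k.

Lemma query_exec s t (D : R) (st st' : state R) k : exec W (query c) (load_query (n := n) st s t D) st' k ->
  st' = den W (query c) (load_query st s t D).
Proof.
move=> h; have [st2 [k2 [h2 _ <-]]] : wp W (query c) (max_time (query c))
    (fun st2 => st2 = den W (query c) (load_query st s t D)) (load_query st s t D).
  by apply: wp_den => //; exact: straight_query.
by have [] := exec_det h h2.
Qed.

(** Queries write no array, and among the registers only their arguments and temporaries; so the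
    data structure survives any sequence of them. *)
Lemma ready_query s t (D : R) (st st' : state R) k : ready st ->
  exec W (query c) (load_query (n := n) st s t D) st' k -> ready st'.
Proof.
move=> [[e1 e2 [e3 e4 e5] [e6 e7] e8] hs] /exec_frame [f1 f2 f3 f4].
have [wa ra] := amod_query c.
have g3 a : wmem st' a = wmem st a by rewrite f3 // wa.
have g4 a : rmem st' a = rmem st a by rewrite f4 // ra.
have g1 x : x \notin [:: xk; xz; xq; 0%N; 1%N] -> wreg st' x = wreg st x.
  rewrite !in_cons !negb_or => /and5P[h1 h2 h3 h4 /andP[h5 _]].
  rewrite f1 /= ?upd_neq //; apply: wmod_query.
  by rewrite !in_cons !negb_or h1 h2 h3 h4.
have g2 x : x \notin [:: yy; yc; 0%N] -> rreg st' x = rreg st x.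
  move=> hx; rewrite f2; last exact: rmod_query.
  move: hx; rewrite !in_cons !negb_or => /and4P[_ _ h _].
  by rewrite /= upd_neq.
split; first by split; rewrite ?g1 ?g2 // => z z0 zP; rewrite g3 e8.
move=> k' kN; have [h1 h2] := hs k' kN; split; last by rewrite g4.
by apply: tab_inv_ext h1 => q x y _; rewrite /Tval g4.
Qed.

Lemma ready_reachable st st1 : ready st ->
  reachable (n := n) Dmin Dmax W (query c) st st1 -> ready st1.
Proof.
move=> h; elim=> // st1' st2 s t D k _ IH _ hx; exact: ready_query IH hx.
Qed.

Lemma ready_correct st :
  (forall k f (s t : 'I_n), (k < NS)%N -> (f < Q1)%N ->
    let vs := verts s (best_path G s t (f.+1%:R * unit k)) in
    uniq vs ->
    gap_cost K lev 0 vs <= (8 * g * K)%:R :> R /\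
    gap_cost K lev 0 (rev vs) <= (8 * g * K)%:R :> R) ->
  ready st -> queries_correct G eps Dmin Dmax W (query c) st.
Proof.
move=> hgood hst st1 hr s t D /andP[Dlo Dhi] st2 k2 /query_exec ->.
have [hq hs] := ready_reachable hst hr.
have e00 : (0 < e0)%N by rewrite e0E addn_gt0 orbT.
have P0 := @expn_gt0 2 K.
have DP : D / Dmin <= (2 ^ K)%:R ^+ c.
  apply: le_trans (_ : Dmax / Dmin <= _); first by rewrite ler_wpM2r // invr_ge0 ltW.
  apply: le_trans Dc _; rewrite lerXn2r ?nnegrE ?ler0n // ler_nat.
  exact: leq_exp_logceil.
have hq' : query_env G eps Dmin e0 (load_query st1 s t D) by [].
have [//|k [f [kN lo fD fQ ->]]] :=
  query_spec n_gt1 nW QW NSW TW PW e00 eps_gt0 Dmin_gt0 hq'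
    (erefl _) (erefl _) (erefl _) Dlo DP.
  by move=> k kN; have [_ ->] := hs k kN.
have [hT _] := hs k kN.
have u0 := scale_unit_gt0 n_gt1 e00 eps_gt0 Dmin_gt0 k.
have ee : clip_eps eps <= eps by rewrite /clip_eps; case: ifP.
have f1 : (f < Q1)%N by apply: leq_ltn_trans fQ; rewrite leq_addr.
apply: (answer_ok (lev := lev) (K := K) (Q1 := Q1) (eps' := clip_eps eps) (delta := Dmin * 2 ^+ k)
  u0 eps_gt0 ee (erefl _) (slack_gt0 n_gt1 e00) hT lo _ _ fD fQ) => //.
- exact/ltW/clip_eps_gt0.
- by rewrite mulr_ge0 ?exprn_ge0 // ltW.
move=> hex; have [b1 b2 b3 b4] := best_pathP hex.
exists (best_path G s t (f.+1%:R * unit k)); split=> //.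
have [g1 g2] := hgood k f s t kN f1 b3.
have -> : E = ((16 * g + 5) * K)%N by rewrite /slack e0E.
exact: (err_gap_cost (ltW u0) (logceil_gt0 n_gt1) b3 leq_exp_logceil g1 g2).
Qed.

End DataStructure.

Lemma word_level_vlev L b n (nL : (n <= L)%N) (r : L.-tuple 'I_(2 ^ b)) :
  @word_level n [seq val x | x <- r] = vlev (logceil n) nL r.
Proof.
apply/funext => v; rewrite /word_level /vlev (tnth_nth (tnth r (slot nL v))).
by rewrite (nth_map (tnth r (slot nL v))) // size_tuple (leq_trans (ltn_ord v)).
Qed.

(* [c] bounds the exponents of the polynomials in the assumptions, [a] is the
   exponent of the failure probability. *)
Theorem theorem7p1 (R : realType) (a c : nat) :
  exists (kappa C Q : nat) (preprocess query : cmd),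
  forall (n : nat) (G : digraph R n) (eps Dmin Dmax : R),
    (2 <= n)%N ->
    0 < eps -> eps^-1 <= n%:R ^+ c ->
    0 < Dmin -> Dmin <= Dmax -> Dmax / Dmin <= n%:R ^+ c ->
  let W := word_bound kappa n in
  exists L : nat,
    [/\ L%:R <= C%:R * prep_bound n (nedges G) eps,
        (forall r : L.-tuple 'I_W, exists st k,
           [/\ exec W preprocess
                 (init_state G eps Dmin Dmax [seq val x | x <- r]) st k,
               (k <= L)%N & queries_halt (n := n) Dmin Dmax W query Q st])
      & 1 - (n%:R ^+ a)^-1 <= tape_prob R (fun r : L.-tuple 'I_W =>
          forall st k,
            exec W preprocess
              (init_state G eps Dmin Dmax [seq val x | x <- r]) st k ->
            queries_correct G eps Dmin Dmax W query st)].
Proof.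
(* The four constants are dictated, in this order, by [failure_bound], [err_gap_cost], [good] and
   [lt_word_bound]. *)
pose g := ((a + c + 5) + (20 + a + 2 * c))%N.
pose e0 := (16 * g + 5)%N; pose CS := (2 * g + 4)%N.
pose kappa := ((4 * e0 * c.+1 + CS + c + 2) + c + 2)%N.
exists kappa, (c.+1 * (1000 * CS + 2000) * (1024 * e0))%N, (max_time (query c)),
  (preprocess e0 c CS), (query c).
move=> n G eps Dmin Dmax n1 eps0 epsc Dmin0 DD Dc W.
have e00 : (0 < e0)%N by rewrite /e0 addn_gt0 orbT.
have [[mW QW KW NSW] [TW AW SW] [SBW EEW] [e0W cW CSW]] :=
  word_bounds n1 eps0 e00 epsc (erefl kappa) G.
pose L := time_bound G eps e0 c CS.
have nL : (n <= L)%N by exact: n_le_time_bound.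
have pre (r : L.-tuple 'I_W) := preprocess_spec (rs := [seq val x | x <- r]) Dmax n1 mW QW KW NSW TW AW SW
  SBW EEW e0W cW CSW e00 eps0 Dmin0.
have {}pre (r : L.-tuple 'I_W) : wp W (preprocess e0 c CS) L
    (pre_post G eps Dmin e0 c CS [seq val x | x <- r])
    (init_state G eps Dmin Dmax [seq val x | x <- r]).
  apply: wp_weaken (pre r _ _) _ _ => //.
  - by rewrite size_map size_tuple.
  - by apply/allP => _ /mapP[x _ ->]; exact: ltn_ord.
  - exact: pre_time_le.
exists L; split.
- exact: time_bound_prep.
- move=> r; have [st [k [h1 h2 _]]] := pre r; exists st, k; split=> //.
  (* A query is loop-free and halts in any state, even if the preprocessing gave up. *)
  move=> st1 _ s t D _.
  have [st2 [k2 [h3 h4 _]]] : wp W (query c) (max_time (query c)) (fun=> True)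
      (load_query st1 s t D) by apply: wp_den => //; exact: straight_query.
  by exists st2, k2.
(* Scales, budgets and pairs of vertices. There is one budget more than the table has, because the
   comparison path for quotient [f] has budget [f.+1]. *)
pose K := logceil n; pose I : finType := ('I_(nscales n c) * 'I_(nbudgets n eps e0).+1 * 'I_n * 'I_n)%type.
pose vs0 (i : I) := verts i.1.2 (best_path G i.1.2 i.2
  ((i.1.1.2 : nat)%:R * scale_unit n eps Dmin e0 i.1.1.1)).
(* The exponential moments concern lists without repetitions; the empty list is a harmless
   default. *)
pose vsf (i : I) := if uniq (vs0 i) then vs0 i else [::].
have vsfu i : uniq (vsf i) by rewrite /vsf; case: ifP.
have K0 := logceil_gt0 n1.
have Kb : (K <= kappa.+3 * K)%N by rewrite leq_pmull.
have nP : (n <= 2 ^ K)%N by exact: leq_exp_logceil.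
have nW : (n < W)%N.
  by apply: leq_ltn_trans SW; rewrite leq_pmulr // expn_gt0.
have PW : (2 ^ K < W)%N.
  by apply: leq_ltn_trans SW; rewrite leq_pmull // ltnW.
have := prob_good (R := R) Kb nL g vsfu K0 nP.
rewrite !card_prod !card_ord => hp.
apply: le_trans (_ : _ <= _) (le_trans hp _).
  by rewrite lerD2l lerN2; exact: failure_bound.
apply: tape_prob_le => r [hw hgap] st k hx.
have [st' [k' [hx' _ [[hc hi] hl hsc]]]] := pre r.
(* By determinism, the given execution is the one provided by the specification. *)
have [-> _] := exec_det hx hx'.
have hlev := word_level_vlev nL r.
apply: (@ready_correct R n G eps Dmin Dmax W e0 c g n1 nW QW NSW TW PW (erefl _)
  eps0 Dmin0 Dc [seq val x | x <- r]).
  move=> k1 f s t kN fQ vs uvs.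
  have fQ1 : (f.+1 < (nbudgets n eps e0).+1)%N by [].
  have := hgap (Ordinal kN, Ordinal fQ1, s, t).
  by rewrite /vsf -[vs0 _]/vs uvs hlev.
split.
  have [[e1 _ _ _ [_ e2]] [e3 e4 e5] [e6 _ _] _] := hc.
  by split.
by apply: hsc; rewrite /totalwork hlev.
Qed.
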